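(* Let $\mathbb{K}=\mathbb{R}$ or $\mathbb{C}$, and fix one of the classes of smooth functions described in the context. Let $\mathfrak{g}$ be a finite-dimensional Lie algebra over $\mathbb{K}$, let $\rho:\mathfrak{g}\to\mathfrak{gl}(V)$ be a linear representation of $\mathfrak{g}$ in a finite-dimensional $\mathbb{K}$-vector space $V$, and let $m\ge 0$ be an integer. If the representation $(\mathfrak{g},\rho,V)$ has the Dixmier property, then the representation $(\mathfrak{g}_m,\rho_m,V_m)$ also has the Dixmier property (with respect to the same class of smooth functions).
   Context: Smooth functions. The base field is $\mathbb{K}=\mathbb{R}$ or $\mathbb{C}$. ''Smooth'' refers to one fixed class of (scalar- or vector-valued) functions on finite-dimensional $\mathbb{K}$-vector spaces, used throughout, among the following: polynomial functions ($\mathbb{K}=\mathbb{R}$ or $\mathbb{C}$); real analytic functions ($\mathbb{K}=\mathbb{R}$); $C^\infty$ functions ($\mathbb{K}=\mathbb{R}$); entire holomorphic functions ($\mathbb{K}=\mathbb{C}$). Vector spaces and Lie algebras are finite-dimensional over $\mathbb{K}$. Vector fields with parameters. For finite-dimensional $\mathbb{K}$-vector spaces $W$ and $E$, a vector field on $E$ with parameters in $W$ is a smooth function $a:W\times E\to E$. It acts on smooth functions $\varphi:E\to\mathbb{K}$ by $(L\varphi)(w,e)=\left.\frac{d}{dt}\right|_{t=0}\varphi(e+t\,a(w,e))$; it annihilates $\varphi$ if $(L\varphi)(w,e)=0$ for all $(w,e)\in W\times E$. Invariant functions. For a linear representation $\rho:\mathfrak{h}\to\mathfrak{gl}(E)$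 of a Lie algebra $\mathfrak{h}$, a smooth function $\varphi:E\to\mathbb{K}$ is $\mathfrak{h}$-invariant if $\left.\frac{d}{dt}\right|_{t=0}\varphi(e+t\rho(x).e)=0$ for all $x\in\mathfrak{h}$, $e\in E$. Dixmier property. The representation $(\mathfrak{h},\rho,E)$ has the Dixmier property if, for every finite-dimensional $\mathbb{K}$-vector space $W$ and every vector field with parameters $a:W\times E\to E$ annihilating all smooth $\mathfrak{h}$-invariant functions on $E$, there exists a smooth function $b:W\times E\to\mathfrak{h}$ such that $a(w,e)=\rho(b(w,e)).e$ for all $(w,e)\in W\times E$. Generalized Takiff algebras. For a Lie algebra $\mathfrak{g}$ and an integer $m\ge0$, $\mathfrak{g}_m$ is the Lie algebra of elements $X=x_0+x_1T+\cdots+x_mT^m=(x_0,\dots,x_m)$, $x_j\in\mathfrak{g}$, $T$ an indeterminate, with bracket $[\sum_r x_rT^r,\sum_s y_sT^s]=\sum_{r,s}[x_r,y_s]T^{r+s}$ mod $T^{m+1}$. For a representation $\rho:\mathfrak{g}\to\mathfrak{gl}(V)$, $V_m$ is the vector space of elements $F=f_0+f_1T+\cdots+f_mT^m=(f_0,\dots,f_m)$, $f_j\in V$, and $\rho_m:\mathfrak{g}_m\to\mathfrak{gl}(V_m)$ is the representation determined by $\rho_m(x_rT^r).(f_sT^s)=(\rho(x_r).f_s)T^{r+s}$ mod $T^{m+1}$. *)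

(* Defs.v *)
From HB Require Import structures.
From mathcomp Require Import all_boot all_order all_algebra finmap complex.
From mathcomp Require Import all_classical all_reals all_analysis.
From mathcomp.analysis.showcase Require Import summability.
From mathcomp Require mpoly.

Set Implicit Arguments.
Unset Strict Implicit.
Unset Printing Implicit Defensive.

Import Order.TTheory GRing.Theory Num.Theory.
Import numFieldNormedType.Exports.

Local Open Scope classical_set_scope.
Local Open Scope ring_scope.

Section CoordinateClasses.
Variables (K : numFieldType) (n : nat).
Implicit Type f : 'rV[K]_n -> K.

Definition polynomial_fun f : Prop :=
  exists p : mpoly.mpoly n K, forall x, f x = mpoly.meval (fun i => x 0 i) p.

(* [f] is, near every point [a], the sum of a power series in the variables
   [x 0 i - a 0 i].  The series is indexed by multi-indices and is summed along
   the directed set of their finite subsets, i.e. unconditionally; for real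
   series this is absolute convergence. *)
Definition analytic_fun f : Prop :=
  forall a : 'rV[K]_n, exists c : {ffun 'I_n -> nat} -> K,
    nbhs a [set x : 'rV[K]_n |
      partial_sum (fun al => c al * \prod_(i < n) (x 0 i - a 0 i) ^+ al i : K^o)
        @ totally --> (f x : K^o)].

Fixpoint Ck_fun (k : nat) f : Prop :=
  match k with
  | 0%N => continuous f
  | k'.+1 => (forall x, differentiable (f : 'rV[K]_n -> K^o) x) /\
             forall v : 'rV[K]_n, Ck_fun k' (fun x => 'd (f : 'rV[K]_n -> K^o) x v)
  end.

Definition Cinfty_fun f : Prop := forall k, Ck_fun k f.

(* Meant for complex [K]: the differential is [K]-linear. *)
Definition entire_fun f : Prop :=
  forall x, differentiable (f : 'rV[K]_n -> K^o) x.

End CoordinateClasses.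

Inductive smooth_class : Type :=
  | RealPolynomial | ComplexPolynomial | RealAnalytic | RealCinfty | EntireHolomorphic.

(* The field is determined by the class: [R] or the complex numbers [R[i]]. *)
Definition base_field (R : realType) (c : smooth_class) : numFieldType :=
  match c with
  | RealPolynomial | RealAnalytic | RealCinfty => R
  | ComplexPolynomial | EntireHolomorphic => R[i]
  end.

Definition smooth_coord (R : realType) (c : smooth_class) (n : nat) :
    ('rV[base_field R c]_n -> base_field R c) -> Prop :=
  match c with
  | RealPolynomial => @polynomial_fun R n
  | ComplexPolynomial => @polynomial_fun R[i] n
  | RealAnalytic => @analytic_fun R n
  | RealCinfty => @Cinfty_fun R n
  | EntireHolomorphic => @entire_fun R[i] n
  end.

(* On abstract spaces smoothness is read off in the coordinates of one fixed
   basis; all the classes being stable under linear changes of variables, the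
   choice of the basis is immaterial. *)
Definition smooth_scalar (R : realType) (c : smooth_class)
    (E : vectType (base_field R c)) (phi : E -> base_field R c) : Prop :=
  smooth_coord (fun x => phi (passmx.vecof (vbasis {:E}) x)).

Definition smooth_map (R : realType) (c : smooth_class)
    (E F : vectType (base_field R c)) (f : E -> F) : Prop :=
  forall i, smooth_scalar (fun e => coord (vbasis {:F}) i (f e)).

HB.mixin Record Vector_isLieAlgebra (K : numFieldType) g of Vector K g := {
  lie_br : g -> g -> g ;
  lie_br_linearl : forall y, linear (lie_br^~ y) ;
  lie_br_linearr : forall x, linear (lie_br x) ;
  lie_brxx : forall x, lie_br x x = 0 ;
  lie_jacobi : forall x y z,
    lie_br x (lie_br y z) + lie_br y (lie_br z x) + lie_br z (lie_br x y) = 0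
}.

#[short(type="lieAlgType")]
HB.structure Definition LieAlgebra (K : numFieldType) :=
  {g of Vector K g & Vector_isLieAlgebra K g}.

Record lieRep (K : numFieldType) (g : lieAlgType K) (V : vectType K) := LieRep {
  rep_map :> {linear g -> 'End(V)} ;
  rep_br : forall x y,
    rep_map (lie_br x y) = ((rep_map x \o rep_map y) - (rep_map y \o rep_map x))%VF
}.

Section Dixmier.
Variables (R : realType) (c : smooth_class).
Local Notation K := (base_field R c).

(* [t] ranges over [K]: for complex [K] this is a complex derivative. *)
Definition lie_derivative (W E : vectType K) (a : W * E -> E) (phi : E -> K)
    (w : W) (e : E) : K :=
  derive1 (fun t : K => phi (e + t *: a (w, e)) : K^o) 0.

Definition annihilates (W E : vectType K) (a : W * E -> E) (phi : E -> K) : Prop :=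
  forall w e, lie_derivative a phi w e = 0.

Variables (h : lieAlgType K) (E : vectType K) (rho : lieRep h E).

Definition invariant_fun (phi : E -> K) : Prop :=
  forall x e, derive1 (fun t : K => phi (e + t *: rho x e) : K^o) 0 = 0.

Definition dixmier : Prop :=
  forall (W : vectType K) (a : W * E -> E),
    smooth_map a ->
    (forall phi : E -> K, smooth_scalar phi -> invariant_fun phi -> annihilates a phi) ->
    exists2 b : W * E -> h, smooth_map b & forall w e, a (w, e) = rho (b (w, e)) e.

End Dixmier.

(* [takiff T m] is the space of [x_0 + x_1 T + ... + x_m T^m], represented by the
   family of its coefficients. *)
Definition takiff (T : Type) (m : nat) : Type := {ffun 'I_m.+1 -> T}.

HB.instance Definition _ (K : numFieldType) (V : vectType K) (m : nat) :=
  Vector.copy (takiff V m) {ffun 'I_m.+1 -> V}.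

Section TruncatedProducts.
Variables (m : nat) (U : nmodType).
Implicit Type F : 'I_m.+1 -> 'I_m.+1 -> 'I_m.+1 -> U.

Lemma sum_ord_eq (j : nat) (P : pred nat) (x : U) :
  (P j -> (j < m.+1)%N) ->
  \sum_(s < m.+1 | P s && (j == s)) x = if P j then x else 0.
Proof.
move=> Pj; case: ifPn => [PJ|nPJ]; last first.
  by rewrite big1 // => s /andP[Ps /eqP js]; rewrite js Ps in nPJ.
rewrite (big_pred1 (Ordinal (Pj PJ))) // => s /=.
by apply/andP/eqP => [[_ /eqP js]|->] /=; [exact/val_inj | rewrite PJ eqxx].
Qed.

Lemma nested_sumr F (k : 'I_m.+1) :
  \sum_(r < m.+1) \sum_(s < m.+1 | (r + s == k)%N)
    \sum_(p < m.+1) \sum_(q < m.+1 | (p + q == s)%N) F r p q =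
  \sum_(r < m.+1) \sum_(p < m.+1) \sum_(q < m.+1 | (r + p + q == k)%N) F r p q.
Proof.
apply: eq_bigr => r _; rewrite exchange_big /=; apply: eq_bigr => p _.
rewrite (exchange_big_dep predT) //= [RHS]big_mkcond /=; apply: eq_bigr => q _.
rewrite (sum_ord_eq (P := fun s => (r + s == k)%N)) ?addnA // => /eqP E.
by apply: leq_ltn_trans (ltn_ord k); rewrite -E -addnA leq_addl.
Qed.

Lemma nested_suml F (k : 'I_m.+1) :
  \sum_(r < m.+1) \sum_(s < m.+1 | (r + s == k)%N)
    \sum_(p < m.+1) \sum_(q < m.+1 | (p + q == r)%N) F p q s =
  \sum_(p < m.+1) \sum_(q < m.+1) \sum_(s < m.+1 | (p + q + s == k)%N) F p q s.
Proof.
transitivity (\sum_(s < m.+1) \sum_(p < m.+1) \sum_(q < m.+1)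
    if (p + q + s == k)%N then F p q s else 0).
  rewrite (exchange_big_dep predT) //=; apply: eq_bigr => s _.
  rewrite exchange_big /=; apply: eq_bigr => p _.
  rewrite (exchange_big_dep predT) //=; apply: eq_bigr => q _.
  rewrite (sum_ord_eq (P := fun r => (r + s == k)%N)) // => /eqP E.
  by apply: leq_ltn_trans (ltn_ord k); rewrite -E leq_addr.
rewrite exchange_big /=; apply: eq_bigr => p _.
rewrite exchange_big /=; apply: eq_bigr => q _.
by rewrite [RHS]big_mkcond.
Qed.

End TruncatedProducts.

Section TakiffAlgebra.
Variables (K : numFieldType) (g : lieAlgType K) (m : nat).
Implicit Types X Y Z : takiff g m.

Definition takiff_br X Y : takiff g m :=
  [ffun k : 'I_m.+1 =>
     \sum_(r < m.+1) \sum_(s < m.+1 | (r + s == k)%N) lie_br (X r) (Y s)].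

Lemma lie_brDl (x y z : g) : lie_br (x + y) z = lie_br x z + lie_br y z.
Proof. by have /= := lie_br_linearl z 1 x y; rewrite !scale1r. Qed.

Lemma lie_brDr (x y z : g) : lie_br z (x + y) = lie_br z x + lie_br z y.
Proof. by have /= := lie_br_linearr z 1 x y; rewrite !scale1r. Qed.

Lemma lie_br0r (x : g) : lie_br x 0 = 0.
Proof. by apply: (addrI (lie_br x 0)); rewrite -lie_brDr !addr0. Qed.

Lemma lie_brC (x y : g) : lie_br x y = - lie_br y x.
Proof.
apply/eqP; rewrite -addr_eq0; apply/eqP.
have := lie_brxx (x + y); rewrite lie_brDl !lie_brDr !lie_brxx.
by rewrite add0r addr0.
Qed.

Lemma lie_br_sumr (I : Type) (r : seq I) (P : pred I) (F : I -> g) (x : g) :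
  lie_br x (\sum_(i <- r | P i) F i) = \sum_(i <- r | P i) lie_br x (F i).
Proof. by elim/big_rec2: _ => [|i y z _ <-]; rewrite ?lie_br0r ?lie_brDr. Qed.

Lemma takiff_br_linearl Y : linear (takiff_br^~ Y).
Proof.
move=> a X X'; apply/ffunP => k; rewrite !ffunE scaler_sumr -big_split /=.
apply: eq_bigr => r _; rewrite scaler_sumr -big_split /=; apply: eq_bigr => s _.
by rewrite !ffunE lie_br_linearl.
Qed.

Lemma takiff_br_linearr X : linear (takiff_br X).
Proof.
move=> a Y Y'; apply/ffunP => k; rewrite !ffunE scaler_sumr -big_split /=.
apply: eq_bigr => r _; rewrite scaler_sumr -big_split /=; apply: eq_bigr => s _.
by rewrite !ffunE lie_br_linearr.
Qed.

Lemma takiff_brxx X : takiff_br X X = 0.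
Proof.
apply/ffunP => k; rewrite !ffunE; set S := (LHS).
have SN : S = - S.
  rewrite {1}/S (exchange_big_dep predT) //= /S -sumrN; apply: eq_bigr => r _.
  rewrite -sumrN; apply: eq_big => [s|s _]; first by rewrite addnC.
  exact: lie_brC.
have /eqP : 2%:R *: S = 0 by rewrite scaler_nat mulr2n {1}SN addNr.
by rewrite scaler_eq0 pnatr_eq0 /= => /eqP.
Qed.

Lemma takiff_br_brE X Y Z (k : 'I_m.+1) :
  takiff_br X (takiff_br Y Z) k =
  \sum_(r < m.+1) \sum_(p < m.+1) \sum_(q < m.+1 | (r + p + q == k)%N)
     lie_br (X r) (lie_br (Y p) (Z q)).
Proof.
rewrite ffunE -nested_sumr; apply: eq_bigr => r _; apply: eq_bigr => s _.
by rewrite ffunE lie_br_sumr; apply: eq_bigr => p _; rewrite lie_br_sumr.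
Qed.

Lemma takiff_jacobi X Y Z :
  takiff_br X (takiff_br Y Z) + takiff_br Y (takiff_br Z X)
    + takiff_br Z (takiff_br X Y) = 0.
Proof.
apply/ffunP => k.
transitivity (takiff_br X (takiff_br Y Z) k + takiff_br Y (takiff_br Z X) k
    + takiff_br Z (takiff_br X Y) k); first by rewrite !ffunE.
rewrite !takiff_br_brE ffunE.
have rot (F : 'I_m.+1 -> 'I_m.+1 -> 'I_m.+1 -> g) :
    \sum_(r < m.+1) \sum_(p < m.+1) \sum_(q < m.+1 | (r + p + q == k)%N) F r p q =
    \sum_(r < m.+1) \sum_(p < m.+1) \sum_(q < m.+1 | (r + p + q == k)%N) F q r p.
  under eq_bigr => r _ do under eq_bigr => p _ do rewrite big_mkcond.
  under [RHS]eq_bigr => r _ do under eq_bigr => p _ do rewrite big_mkcond.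
  rewrite [LHS]exchange_big /=; apply: eq_bigr => p _.
  rewrite [LHS]exchange_big /=; apply: eq_bigr => q _.
  by apply: eq_bigr => r _; rewrite -addnA addnC.
rewrite [X in _ + X]rot [X in _ + X + _]rot [X in _ + X + _]rot -!big_split /=.
apply: big1 => r _; rewrite -!big_split /=.
apply: big1 => p _; rewrite -!big_split /=.
by apply: big1 => q _; rewrite lie_jacobi.
Qed.

HB.instance Definition _ := Vector_isLieAlgebra.Build K (takiff g m)
  takiff_br_linearl takiff_br_linearr takiff_brxx takiff_jacobi.

End TakiffAlgebra.

Section TakiffRepresentation.
Variables (K : numFieldType) (g : lieAlgType K) (V : vectType K).
Variables (rho : lieRep g V) (m : nat).
Implicit Types (X Y : takiff g m) (F : takiff V m).

Definition takiff_act X F : takiff V m :=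
  [ffun k : 'I_m.+1 =>
     \sum_(r < m.+1) \sum_(s < m.+1 | (r + s == k)%N) rho (X r) (F s)].

Lemma takiff_act_linearr X : linear (takiff_act X).
Proof.
move=> a F F'; apply/ffunP => k; rewrite !ffunE scaler_sumr -big_split /=.
apply: eq_bigr => r _; rewrite scaler_sumr -big_split /=; apply: eq_bigr => s _.
by rewrite !ffunE linearP.
Qed.

HB.instance Definition _ X := GRing.isLinear.Build K (takiff V m) (takiff V m) _
  (takiff_act X) (takiff_act_linearr X).

Definition takiff_map X : 'End(takiff V m) := linfun (takiff_act X).

Lemma takiff_map_linear : linear takiff_map.
Proof.
move=> a X X'; apply/lfunP => F; rewrite add_lfunE scale_lfunE !lfunE /=.
apply/ffunP => k; rewrite !ffunE scaler_sumr -big_split /=.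
apply: eq_bigr => r _; rewrite scaler_sumr -big_split /=; apply: eq_bigr => s _.
by rewrite !ffunE linearP add_lfunE scale_lfunE.
Qed.

HB.instance Definition _ :=
  GRing.isLinear.Build K (takiff g m) 'End(takiff V m) _ takiff_map takiff_map_linear.

Lemma takiff_act_actE X Y F (k : 'I_m.+1) :
  takiff_act X (takiff_act Y F) k =
  \sum_(r < m.+1) \sum_(p < m.+1) \sum_(q < m.+1 | (r + p + q == k)%N)
     rho (X r) (rho (Y p) (F q)).
Proof.
rewrite ffunE -nested_sumr; apply: eq_bigr => r _; apply: eq_bigr => s _.
by rewrite ffunE linear_sum; apply: eq_bigr => p _; rewrite linear_sum.
Qed.

Lemma takiff_map_br X Y :
  takiff_map (lie_br X Y) =
  ((takiff_map X \o takiff_map Y) - (takiff_map Y \o takiff_map X))%VF.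
Proof.
apply/lfunP => F; rewrite add_lfunE opp_lfunE !comp_lfunE !lfunE /=.
apply/ffunP => k.
transitivity (takiff_act X (takiff_act Y F) k - takiff_act Y (takiff_act X F) k);
  last by rewrite !ffunE.
rewrite !takiff_act_actE ffunE.
transitivity (\sum_(r < m.+1) \sum_(s < m.+1 | (r + s == k)%N)
    \sum_(p < m.+1) \sum_(q < m.+1 | (p + q == r)%N)
      rho (lie_br (X p) (Y q)) (F s)).
  apply: eq_bigr => r _; apply: eq_bigr => s _.
  rewrite ffunE linear_sum sum_lfunE; apply: eq_bigr => p _.
  by rewrite linear_sum sum_lfunE.
rewrite nested_suml [X in _ - X]exchange_big /= -sumrB; apply: eq_bigr => p _.
rewrite -sumrB; apply: eq_bigr => q _.
rewrite [X in _ - X](eq_bigl (fun s : 'I_m.+1 => (p + q + s == k)%N)); last first.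
  by move=> s; rewrite (addnC q p).
rewrite -sumrB; apply: eq_bigr => s _.
by rewrite rep_br add_lfunE opp_lfunE !comp_lfunE.
Qed.

Definition takiff_rep : lieRep (takiff g m) (takiff V m) :=
  LieRep takiff_map_br.

End TakiffRepresentation.

(* Main.v *)
Require Import Defs.
From HB Require Import structures.
From mathcomp Require Import all_boot all_order all_algebra finmap complex.
From mathcomp Require Import all_classical all_reals all_analysis.
From mathcomp.analysis.showcase Require Import summability.
From mathcomp Require mpoly.
From mathcomp Require Import ring lra.

Set Implicit Arguments.
Unset Strict Implicit.
Unset Printing Implicit Defensive.

Import Order.TTheory GRing.Theory Num.Theory.
Import numFieldNormedType.Exports.

Local Open Scope classical_set_scope.
Local Open Scope ring_scope.

(** Write phi(f_0 + f_1 T + ...) = phi_0 + phi_1 T + ... for an invariant phi on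
    [V]; every phi_k is an invariant of [g_m], and when [G_j = 0] for [j < k] the
    derivative of phi_k at [F] in the direction [G] is d(phi)(f_0).G_k.  Hence if a
    vector field [a] annihilates the invariants and its coefficients below [k]
    vanish, its [k]-th coefficient annihilates the invariants of [V], the other
    f_j being treated as parameters; by the Dixmier property it equals rho(b).f_0,
    and subtracting the action of [b T^k] kills one more coefficient.

    All this uses only the closure properties [smooth_calculus] of the class of
    smooth functions, of which two are not elementary.  That a directional
    derivative of an entire function is again entire follows from a mean value
    inequality, which is obtained from Goursat's argument in polar coordinates.
    Real analytic functions are handled as sums of homogeneous polynomials whose
    l^1 coefficient norms grow at most geometrically. *)

(** Up to the factor k! the phi_k come from phi(f_0) by repeated differentiation along the linear
    field F -> dF/dT. As d/dT is a derivation, its commutator with the field of X in [takiff g m] is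
    the field of dX/dT, and invariance passes from phi_k to phi_(k+1). The obstacle is that d/dT
    does not preserve the ideal generated by T^(m+1): the Leibniz rule fails in degree m. The error
    lies in the coefficient of T^m alone, and for k < m the derivative of phi_k in such a direction
    is zero.

    All fields along which one differentiates are linear, and the correction subtracted from [a] is
    bilinear in (b, F). Hence multiplication by coordinates is the only product needed, and no
    composition beyond linear substitution; symmetry of second derivatives serves the commutator.

    For entire functions the difference quotient of f at 0 need not be known to be holomorphic at 0.
    Multiplying its k-th power by w restores differentiability there, and letting k grow removes the
    cost of this factor. The resulting Lipschitz bound replaces the Cauchy estimates. *)

Record smooth_calculus (K : numFieldType)
    (S : forall n, ('rV[K]_n -> K) -> Prop) : Prop := SmoothCalculus {
  sc_cst : forall n a, S n (fun=> a);
  sc_add : forall n f g, S n f -> S n g -> S n (fun x => f x + g x);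
  sc_scale : forall n a f, S n f -> S n (fun x => a * f x);
  sc_coord : forall n (i : 'I_n) f, S n f -> S n (fun x => x 0 i * f x);
  sc_pull : forall n p (A : 'M[K]_(p, n)) f, S n f -> S p (fun x => f (x *m A));
  sc_diff : forall n f, S n f -> forall x, differentiable (f : 'rV[K]_n -> K^o) x;
  sc_dir : forall n f, S n f ->
    forall v, S n (fun x => 'd (f : 'rV[K]_n -> K^o) x v);
  sc_sym : forall n f, S n f -> forall u v x,
    'd ((fun y => 'd (f : 'rV[K]_n -> K^o) y u) : 'rV[K]_n -> K^o) x v =
    'd ((fun y => 'd (f : 'rV[K]_n -> K^o) y v) : 'rV[K]_n -> K^o) x u
}.

(** * Directional derivatives *)

Definition dir (K : numFieldType) (E : lmodType K) (f : E -> K) (v x : E) : K :=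
  derive1 (fun t : K => f (x + t *: v) : K^o) 0.

Lemma dir_diff (K : numFieldType) n (f : 'rV[K]_n -> K) v x :
  differentiable (f : 'rV[K]_n -> K^o) x ->
  dir f v x = 'd (f : 'rV[K]_n -> K^o) x v.
Proof.
move=> df; rewrite -(@deriveE K _ (K^o)) // /dir /derive1 /derive.
apply: (congr1 (fun g : K -> K^o => lim (g @ 0^'))); apply/funext => h /=.
by rewrite addr0 scale0r addr0 (addrC x).
Qed.

Lemma dir_derivable (K : numFieldType) n (f : 'rV[K]_n -> K) v x :
  differentiable (f : 'rV[K]_n -> K^o) x ->
  derivable (fun t : K => f (x + t *: v) : K^o) 0 1.
Proof.
move=> df; have /(@derivable1P _ _ K^o) := @diff_derivable K _ K^o f x v df.
by under eq_fun do rewrite addrC.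
Qed.

(** No differentiability of [f] is required: both sides differentiate the same function of t. *)
Lemma dir_comp_linear (K : numFieldType) (E F : lmodType K) (f : F -> K)
  (L : E -> F) v x : linear L -> dir (fun y => f (L y)) v x = dir f (L v) (L x).
Proof.
move=> hL; rewrite /dir; suff -> : (fun t : K => f (L (x + t *: v))) =
  (fun t : K => f (L x + t *: L v)) by [].
by apply/funext=> t; rewrite addrC hL addrC.
Qed.

(** * Smooth functions and maps on abstract vector spaces *)

Section Abstract.
Import passmx.
Variables (R : realType) (c : smooth_class).
Hypothesis SC : smooth_calculus (@smooth_coord R c).
Local Notation K := (base_field R c).
Implicit Types (E F G : vectType K).
Local Notation vec E := (passmx.vecof (vbasis (@fullv _ E))).
Local Notation rv E := (passmx.rVof (vbasis (@fullv _ E))).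

Let vecK E : cancel (vec E) (rv E).
Proof. exact: (passmx.vecofK (vbasisP _)). Qed.

Let rvK E : cancel (rv E) (vec E).
Proof. exact: (passmx.rVofK (vbasisP _)). Qed.

Lemma smooth_scalar_cst E a : @smooth_scalar R c E (fun=> a).
Proof. exact: (sc_cst SC). Qed.

Lemma smooth_scalarD E (f g : E -> K) :
  smooth_scalar f -> smooth_scalar g -> smooth_scalar (fun x => f x + g x).
Proof. exact: (sc_add SC). Qed.

Lemma smooth_scalarZ E a (f : E -> K) :
  smooth_scalar f -> smooth_scalar (fun x => a * f x).
Proof. exact: (sc_scale SC). Qed.

Lemma smooth_scalar_sum E (I : Type) (r : seq I) (P : pred I) (f : I -> E -> K) :
  (forall i, P i -> smooth_scalar (f i)) ->
  smooth_scalar (fun x => \sum_(i <- r | P i) f i x).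
Proof.
move=> h; elim: r => [|i r IH].
  by under eq_fun do rewrite big_nil; exact: smooth_scalar_cst.
under eq_fun do rewrite big_cons; case: (boolP (P i)) => // Pi.
by apply: smooth_scalarD => //; exact: h.
Qed.

Lemma linear_coords E (l : {linear E -> K^o}) (x : 'rV_(\dim (@fullv _ E))) :
  l (vec E x) = \sum_(i < \dim (@fullv _ E)) l ((vbasis (@fullv _ E))`_i) * x 0 i.
Proof.
rewrite /passmx.vecof linear_sum; apply: eq_bigr => i _.
by rewrite linearZ /= /GRing.scale /= mulrC.
Qed.

(** In coordinates a linear form is a combination of the x_i, so [sc_coord] and sums suffice. *)
Lemma smooth_scalarM_linear E (l : {linear E -> K^o}) (f : E -> K) :
  smooth_scalar f -> smooth_scalar (fun x => l x * f x).
Proof.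
move=> hf.
have -> : (fun x => l x * f x) =
  (fun x => \sum_(i < \dim (@fullv _ E)) l ((vbasis (@fullv _ E))`_i) * (rv E x 0 i * f x)).
  apply/funext=> x; rewrite -[in l x](rvK x) linear_coords mulr_suml.
  by apply: eq_bigr => i _; rewrite mulrA.
apply: smooth_scalar_sum => i _; apply: smooth_scalarZ; rewrite /smooth_scalar.
by under eq_fun do rewrite vecK; exact: (sc_coord SC).
Qed.

Lemma smooth_scalar_comp E F (L : {linear E -> F}) (f : F -> K) :
  smooth_scalar f -> smooth_scalar (fun x => f (L x)).
Proof.
move=> hf; rewrite /smooth_scalar.
have -> : (fun x => f (L (vec E x))) =
    (fun x => f (vec F (x *m passmx.mxof (vbasis fullv) (vbasis fullv) (linfun L)))).
  by apply/funext=> x; rewrite -passmx.hom_vecof ?lfunE // vbasisP.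
exact: (sc_pull SC (passmx.mxof (vbasis fullv) (vbasis fullv) (linfun L)) hf).
Qed.

Lemma dir_coords E (f : E -> K) v x : smooth_scalar f ->
  dir f v x = 'd ((fun y => f (vec E y)) : _ -> K^o) (rv E x) (rv E v).
Proof.
move=> hf; rewrite -dir_diff; last exact: (sc_diff SC).
by rewrite (dir_comp_linear f _ _ (passmx.vecof_linear _)) !rvK.
Qed.

Lemma smooth_scalar_dir E (f : E -> K) v :
  smooth_scalar f -> smooth_scalar (dir f v).
Proof.
move=> hf; rewrite /smooth_scalar; under eq_fun do rewrite dir_coords // vecK.
exact: (sc_dir SC).
Qed.

Lemma dirD E (f : E -> K) u v x : smooth_scalar f ->
  dir f (u + v) x = dir f u x + dir f v x.
Proof. by move=> hf; rewrite !dir_coords // !linearD. Qed.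

Lemma dirZ E (f : E -> K) a v x : smooth_scalar f ->
  dir f (a *: v) x = a * dir f v x.
Proof. by move=> hf; rewrite !dir_coords // linearZ (linearZ_LR ('d _ _)). Qed.

Lemma dir_sumr E (f : E -> K) I (r : seq I) (P : pred I) (v : I -> E) x :
  smooth_scalar f ->
  dir f (\sum_(i <- r | P i) v i) x = \sum_(i <- r | P i) dir f (v i) x.
Proof.
move=> hf; rewrite dir_coords // !linear_sum; apply: eq_bigr => i _.
by rewrite dir_coords.
Qed.

Lemma dir_vec E (f : E -> K) w : smooth_scalar f -> (fun y => dir f w (vec E y)) =
    (fun y => 'd ((fun z => f (vec E z)) : _ -> K^o) y (rv E w)).
Proof.
by move=> hf; apply/funext=> y; rewrite (@dir_coords E f w (vec E y) hf) (vecK y).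
Qed.

Lemma dir_sym E (f : E -> K) u v x : smooth_scalar f ->
  dir (dir f u) v x = dir (dir f v) u x.
Proof.
move=> hf; rewrite !dir_coords; try exact: smooth_scalar_dir.
rewrite !dir_vec //; exact: (sc_sym SC).
Qed.

Lemma smooth_derivable E (f : E -> K) v x : smooth_scalar f ->
  derivable (fun t : K => f (x + t *: v) : K^o) 0 1.
Proof.
move=> hf.
have := @dir_derivable _ _ _ (rv E v) _ (sc_diff SC hf (rv E x)).
suff -> : (fun t => f (vec E (rv E x + t *: rv E v))) = (fun t => f (x + t *: v)) by [].
apply/funext=> t; congr f; rewrite -[RHS](rvK (x + t *: v)); congr (vec E _).
by rewrite [RHS]linearD [in RHS]linearZ.
Qed.

Lemma dir_suml E n (f : 'I_n -> E -> K) v x :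
  (forall i, smooth_scalar (f i)) ->
  dir (fun y => \sum_i f i y) v x = \sum_i dir (f i) v x.
Proof.
move=> hf; rewrite /dir derive1E.
under [RHS]eq_bigr do rewrite derive1E.
rewrite -derive_sum; last by move=> i; exact: smooth_derivable.
suff -> : (fun t : K => \sum_i f i (x + t *: v) : K^o) =
  \sum_(i < n) (fun t : K => f i (x + t *: v) : K^o) by [].
by apply/funext => t; rewrite fct_sumE.
Qed.

Lemma dir_linearM E (l : {linear E -> K^o}) (f : E -> K) v x :
  smooth_scalar f ->
  dir (fun y => l y * f y) v x = l v * f x + l x * dir f v x.
Proof.
move=> hf; rewrite /dir !derive1E.
have dl : is_derive (0 : K) (1 : K) (fun t : K => l (x + t *: v) : K^o) (l v).
  have -> : (fun t : K => l (x + t *: v) : K^o) = (cst (l x) + (fun t => l v *: t)).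
    apply/funext=> t /=; rewrite linearD linearZ /=.
    by rewrite [t *: _]mulrC.
  have := @is_deriveD K K (K^o) _ _ (0:K) 1 _ _
    (is_derive_cst (l x : K^o) _ _) (is_deriveZ (l v) (is_derive_id (0:K) 1)).
  by rewrite add0r [l v *: 1]mulr1.
have dM := @deriveM K _ _ _ (0:K) 1 (@ex_derive _ _ _ _ _ _ _ dl)
  (@smooth_derivable E f v x hf).
rewrite (@derive_val _ _ _ _ _ _ _ dl) /= scale0r addr0 in dM.
by rewrite [LHS]dM addrC [X in X + _ = _]mulrC.
Qed.

Lemma smooth_scalar_comp_linear E F (L : E -> F) (f : F -> K) :
  linear L -> smooth_scalar f -> smooth_scalar (fun x => f (L x)).
Proof.
move=> hL; pose LL : {linear E -> F} := HB.pack L (GRing.isLinear.Build K E F _ L hL).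
exact: (@smooth_scalar_comp E F LL).
Qed.

Lemma smooth_map_scalar E F (f : E -> F) (l : F -> K^o) :
  linear l -> smooth_map f -> smooth_scalar (fun x => l (f x)).
Proof.
move=> hl hf; pose ll : {linear F -> K^o} := HB.pack l (GRing.isLinear.Build K F K^o _ l hl).
have -> : (fun x => l (f x)) =
    (fun x => \sum_(i < \dim (@fullv _ F))
      ll (vbasis fullv)`_i * coord (vbasis fullv) i (f x)).
  apply/funext=> x; rewrite [f x in LHS](coord_vbasis (memvf _)).
  rewrite -[l]/(ll : _ -> _) linear_sum; apply: eq_bigr => i _.
  by rewrite linearZ; exact: mulrC.
by apply: smooth_scalar_sum => i _; apply: smooth_scalarZ; exact: hf.
Qed.

Lemma smooth_mapD E F (f g : E -> F) :
  smooth_map f -> smooth_map g -> smooth_map (fun x => f x + g x).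
Proof.
move=> hf hg i; have -> : (fun x => coord (vbasis fullv) i (f x + g x)) =
  (fun x => coord (vbasis fullv) i (f x) + coord (vbasis fullv) i (g x)).
  by apply/funext=> x; rewrite linearD.
exact: smooth_scalarD.
Qed.

Lemma smooth_map_lcomp E F G (L : F -> G) (f : E -> F) :
  linear L -> smooth_map f -> smooth_map (fun x => L (f x)).
Proof.
move=> hL hf i.
apply: (@smooth_map_scalar E F f (fun y => coord (vbasis fullv) i (L y))) => // a x y.
by rewrite hL linearD linearZ.
Qed.

Lemma smooth_map_rcomp E F G (L : E -> F) (f : F -> G) :
  linear L -> smooth_map f -> smooth_map (fun x => f (L x)).
Proof.
move=> hL hf i.
exact: (@smooth_scalar_comp_linear E F L (fun y => coord (vbasis fullv) i (f y))).
Qed.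

Lemma smooth_map0 E F : @smooth_map R c E F (fun=> 0).
Proof.
move=> i; have -> : (fun=> coord (vbasis fullv) i 0) = (fun=> 0) :> (E -> K).
  by apply/funext=> x; rewrite linear0.
exact: smooth_scalar_cst.
Qed.

(** Only one argument of [B] is nonlinear in x. Expanding it in a basis leaves products of a linear
    form with a smooth function. This is what makes (w, F) -> b(w, F).F smooth. *)
Lemma smooth_map_bilinear E F G (H : vectType K) (B : F -> G -> H) (f : E -> F) (L : E -> G) :
  (forall y, linear (B^~ y)) -> (forall x, linear (B x)) -> linear L ->
  smooth_map f -> smooth_map (fun x => B (f x) (L x)).
Proof.
move=> hB1 hB2 hL hf i.
pose c1 j x : K^o := coord (vbasis (@fullv _ H)) i (B (vbasis (@fullv _ F))`_j (L x)).
have hc1 j : linear (c1 j).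
  by move=> a x y; rewrite /c1 hL hB2 linearD linearZ.
pose c2 j : {linear E -> K^o} := HB.pack (c1 j) (GRing.isLinear.Build K E K^o _ _ (hc1 j)).
have -> : (fun x => coord (vbasis fullv) i (B (f x) (L x))) =
  (fun x => \sum_(j < \dim (@fullv _ F)) c2 j x * coord (vbasis fullv) j (f x)).
  apply/funext=> x.
  pose BL : {linear F -> H} := HB.pack (B^~ (L x)) (GRing.isLinear.Build K F H _ _ (hB1 (L x))).
  rewrite -[B (f x) _]/(BL (f x)) [f x in LHS](coord_vbasis (memvf _)) !linear_sum.
  by apply: eq_bigr => j _; rewrite !linearZ; exact: mulrC.
apply: smooth_scalar_sum => j _; apply: smooth_scalarM_linear; exact: hf.
Qed.

Lemma dir0r E (f : E -> K) x : smooth_scalar f -> dir f 0 x = 0.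
Proof. by move=> hf; rewrite -(scale0r 0) dirZ // mul0r. Qed.

Lemma dir_basis E (f : E -> K) (v x : E) : smooth_scalar f ->
  dir f v x = \sum_(i < \dim (@fullv _ E))
    coord (vbasis fullv) i v * dir f (vbasis fullv)`_i x.
Proof.
move=> hf; rewrite {1}(coord_vbasis (memvf v)) dir_sumr //.
by apply: eq_bigr => i _; rewrite dirZ.
Qed.

Section LinearField.
Variables (E : vectType K) (f : E -> K) (A : E -> E).
Hypotheses (hf : smooth_scalar f) (hA : linear A).

Let cA i : E -> K^o := fun x => coord (vbasis (@fullv _ E)) i (A x).
Let cA_linear i : linear (cA i).
Proof. by move=> a x y; rewrite /cA hA linearD linearZ. Qed.
Let cA' i : {linear E -> K^o} := HB.pack (cA i) (GRing.isLinear.Build K E K^o _ _ (cA_linear i)).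

Lemma dir_field_basis : (fun x => dir f (A x) x) =
  (fun x => \sum_(i < \dim (@fullv _ E)) cA' i x * dir f (vbasis fullv)`_i x).
Proof. by apply/funext => x; rewrite dir_basis. Qed.

Lemma smooth_scalar_dir_field : smooth_scalar (fun x => dir f (A x) x).
Proof.
rewrite dir_field_basis; apply: smooth_scalar_sum => i _.
by apply: smooth_scalarM_linear; exact: smooth_scalar_dir.
Qed.

(** Product rule for df(y)(A y), with the order of differentiation exchanged in the second
    derivative term so that it becomes a derivative of [dir f v]. *)
Lemma dir_dir_field v x : dir (fun y => dir f (A y) y) v x =
  dir f (A v) x + dir (dir f v) (A x) x.
Proof.
rewrite dir_field_basis dir_suml; last first.
  by move=> i; apply: smooth_scalarM_linear; exact: smooth_scalar_dir.
rewrite [in RHS]dir_basis // [X in _ + X]dir_basis; last exact: smooth_scalar_dir.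
rewrite -big_split /=; apply: eq_bigr => i _.
rewrite (@dir_linearM E (cA' i) _ v x); last exact: smooth_scalar_dir.
by rewrite (@dir_sym E f _ v).
Qed.

End LinearField.

(** The second derivatives in the two iterated derivatives agree by symmetry, which leaves the
    bracket of the linear fields. *)
Lemma dir_field_comm E (f : E -> K) (A B : E -> E) x : smooth_scalar f ->
  linear A -> linear B ->
  dir (fun y => dir f (B y) y) (A x) x = dir (fun y => dir f (A y) y) (B x) x
    + dir f (B (A x) - A (B x)) x.
Proof.
move=> hf hA hB.
rewrite (@dir_dir_field E f B hf hB) (@dir_dir_field E f A hf hA).
rewrite (@dir_sym E f (B x)) // -[- A _]scaleN1r dirD // dirZ // mulN1r.
by rewrite [RHS]addrAC [X in _ = X + _]addrCA subrr addr0.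
Qed.

End Abstract.

(** * The operator d/dT on truncated polynomials *)

Section TakiffShift.
Variables (K : numFieldType) (m : nat).

(** This is d/dT. The coefficient of T^m in dF/dT would involve the truncated f_(m+1) and is set to
    0. *)
Definition takiff_deriv (U : vectType K) (F : takiff U m) : takiff U m :=
  [ffun j : 'I_m.+1 =>
     if (j < m)%N then j.+1%:R *: F (inord j.+1) else 0].

Definition takiff_mono (U : vectType K) (k : 'I_m.+1) (x : U) : takiff U m :=
  [ffun j => if j == k then x else 0].

Lemma takiff_deriv_linear (U : vectType K) : linear (@takiff_deriv U).
Proof.
move=> a F G; apply/ffunP => j; rewrite !ffunE; case: ifP => _.
  by rewrite scalerDr !scalerA mulrC.
by rewrite scaler0 addr0.
Qed.

Lemma takiff_mono_linear (U : vectType K) k : linear (@takiff_mono U k).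
Proof.
move=> a x y; apply/ffunP => j; rewrite !ffunE; case: ifP => _ //.
by rewrite scaler0 addr0.
Qed.

Variables (g : lieAlgType K) (V : vectType K) (rho : lieRep g V).

Lemma takiff_actE (X : takiff g m) (F : takiff V m) (k : nat) : (k <= m)%N ->
  takiff_act rho X F (inord k) =
  \sum_(0 <= r < k.+1) rho (X (inord r)) (F (inord (k - r))).
Proof.
move=> km; rewrite ffunE inordK // big_mkord.
rewrite (big_ord_widen m.+1 (fun r => rho (X (inord r)) (F (inord (k - r))))) //.
rewrite [RHS]big_mkcond /=; apply: eq_bigr => r _; rewrite ltnS.
case: ifPn => rk.
  rewrite (big_pred1 (inord (k - r))).
    by rewrite inord_val.
  move=> s /=; apply/eqP/eqP => [<-|->]; first by rewrite addKn inord_val.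
  by rewrite inordK ?subnKC // ltnS (leq_trans (leq_subr _ _)).
rewrite big_pred0 // => s; apply/negP => /eqP E.
by rewrite -E leq_addr in rk.
Qed.

Lemma takiff_derivE (U : vectType K) (F : takiff U m) (k : nat) : (k < m)%N ->
  takiff_deriv F (inord k) = k.+1%:R *: F (inord k.+1).
Proof. by move=> km; rewrite ffunE inordK ?km // ltnW. Qed.

(** Leibniz rule below degree m. In the coefficient of T^(k+1) of X.F the factor k+1 is split as r +
    (k+1-r), and the two parts are the derivatives of X and of F. *)
Lemma takiff_deriv_act (X : takiff g m) (F : takiff V m) (k : nat) : (k < m)%N ->
  (takiff_deriv (takiff_act rho X F) - takiff_act rho X (takiff_deriv F)) (inord k)
  = takiff_act rho (takiff_deriv X) F (inord k).
Proof.
move=> km; rewrite [LHS]ffunE [(- _ : takiff _ _) _]ffunE takiff_derivE //.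
rewrite !takiff_actE //; try exact: ltnW.
pose x r := X (inord r); pose f s := F (inord s).
have -> : \sum_(0 <= r < k.+1) rho (X (inord r)) (takiff_deriv F (inord (k - r))) =
    \sum_(0 <= r < k.+2) (k.+1 - r)%:R *: rho (x r) (f (k.+1 - r)%N).
  rewrite [RHS]big_nat_recr //= subnn scale0r addr0 !big_nat; apply: eq_bigr => r.
  move=> /= rk; rewrite takiff_derivE ?linearZ /= ?subSn //.
  exact: leq_ltn_trans (leq_subr _ _) km.
have -> : \sum_(0 <= r < k.+1) rho (takiff_deriv X (inord r)) (F (inord (k - r))) =
    \sum_(0 <= r < k.+2) r%:R *: rho (x r) (f (k.+1 - r)%N).
  rewrite [RHS]big_nat_recl //= scale0r add0r !big_nat; apply: eq_bigr => r.
  move=> /= rk; rewrite takiff_derivE; last exact: leq_trans rk km.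
  by rewrite linearZ scale_lfunE subSS.
apply/eqP; rewrite subr_eq -big_split /= scaler_sumr !big_nat; apply/eqP.
apply: eq_bigr => r /= rk; rewrite -scalerDl -natrD subnKC //.
Qed.

End TakiffShift.

(** * Invariants of the Takiff representation and induction on the coefficients *)

Section MainProof.
Variables (R : realType) (c : smooth_class).
Local Notation K := (base_field R c).
Variables (g : lieAlgType K) (V : vectType K) (rho : lieRep g V) (m : nat).
Hypothesis SC : smooth_calculus (@smooth_coord R c).
Local Notation Vm := (takiff V m).
Local Notation S := (@takiff_deriv K m V).

Lemma takiff_repE X F : takiff_rep rho m X F = takiff_act rho X F.
Proof. by rewrite /takiff_rep /= lfunE. Qed.

Section Invariants.
Variable phi : V -> K.
Hypotheses (hphi : smooth_scalar phi) (iphi : invariant_fun rho phi).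

(* [k`! * phi_k], where [phi (f_0 + f_1 T + ...) = \sum_k phi_k T^k]. *)
Fixpoint taylor_fun (k : nat) : Vm -> K :=
  if k is k'.+1 then fun F => dir (taylor_fun k') (S F) F else fun F => phi (F ord0).

Lemma coef_linear (U : vectType K) k : linear (fun F : takiff U m => F k).
Proof. by move=> a F G; rewrite !ffunE. Qed.

Lemma taylor_smooth k : smooth_scalar (taylor_fun k).
Proof.
elim: k => [|k IH] /=; first exact: (smooth_scalar_comp_linear SC (@coef_linear V ord0)).
exact: (smooth_scalar_dir_field SC IH (@takiff_deriv_linear _ _ _)).
Qed.

(** By [dir_dir_field] the derivative of phi_(k+1) along G is that of phi_k along dG/dT plus a
    derivative of [dir (taylor_fun k) G]. The latter function is zero because G_k = 0, and dG/dT
    vanishes below k with k-th coefficient (k+1) G_(k+1). *)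
Lemma dir_taylor k (F G : Vm) : (k <= m)%N ->
  (forall j : 'I_m.+1, (j < k)%N -> G j = 0) ->
  dir (taylor_fun k) G F = k`!%:R * dir phi (G (inord k)) (F ord0).
Proof.
elim: k F G => [|k IH] F G km G0.
  rewrite /= (@dir_comp_linear _ _ _ phi (fun H : Vm => H ord0) G F (@coef_linear V ord0)).
  have -> : ord0 = inord 0 :> 'I_m.+1 by apply: val_inj; rewrite /= inordK.
  by rewrite mul1r.
rewrite /= (dir_dir_field SC (taylor_smooth k) (@takiff_deriv_linear _ _ _)).
rewrite IH ?(ltnW km) //; last first.
  move=> j jk; rewrite ffunE (leq_trans jk (ltnW km)) G0 ?scaler0 //.
  by rewrite inordK // ltnS (leq_trans jk (ltnW km)).
have -> : dir (taylor_fun k) G = fun=> 0.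
  apply/funext => H; rewrite IH ?(ltnW km) //; last by move=> j jk; exact: G0 (ltnW jk).
  have -> : G (inord k) = 0 by rewrite G0 ?inordK // ltnW.
  by rewrite (dir0r SC) // mulr0.
rewrite takiff_derivE // (dirZ SC) // mulrA factS mulnC natrM.
by rewrite /dir derive1_cst addr0.
Qed.

(** In the step, the commutator of d/dT with X is compared with the action of dX/dT, under which
    phi_k is already invariant. Their difference has only a coefficient of degree m > k, so
    [dir_taylor] annihilates it. *)
Lemma taylor_invariant k : (k <= m)%N -> invariant_fun (takiff_rep rho m) (taylor_fun k).
Proof.
move=> km X F; rewrite takiff_repE -/(dir _ _ _); elim: k km X F => [_|k IH km] X F.
  rewrite (@dir_comp_linear _ _ _ phi (fun H : Vm => H ord0) _ F (@coef_linear V ord0)).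
  have -> : ord0 = inord 0 :> 'I_m.+1 by apply: val_inj; rewrite /= inordK.
  by rewrite takiff_actE // big_nat1 subn0; exact: iphi.
have actl : linear (takiff_act rho X) by exact: takiff_act_linearr.
rewrite /= (@dir_field_comm R c SC _ _ (takiff_act rho X) S F (taylor_smooth k)) //; last first.
  exact: takiff_deriv_linear.
rewrite [X in dir X _ _ + _](_ : _ = fun=> 0); last first.
  by apply/funext => G; apply: IH; exact: ltnW.
rewrite {1}/dir derive1_cst add0r.
pose Z := S (takiff_act rho X F) - takiff_act rho X (S F).
rewrite -/Z -(subrK (takiff_act rho (takiff_deriv X) F) Z) (dirD SC) //; last exact: taylor_smooth.
rewrite (IH (ltnW km)) addr0.
have Z0 (j : 'I_m.+1) : (j < m)%N -> (Z - takiff_act rho (takiff_deriv X) F) j = 0.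
  move=> jm; rewrite -(inord_val j) [LHS]ffunE /Z takiff_deriv_act //.
  by rewrite [X in _ + X]ffunE subrr.
rewrite dir_taylor ?(ltnW km) //; last by move=> j jk; apply: Z0; exact: ltn_trans km.
have -> : (Z - takiff_act rho (takiff_deriv X) F) (inord k) = 0.
  by rewrite Z0 ?inordK // ltnW.
by rewrite (dir0r SC) // mulr0.
Qed.

End Invariants.

Definition set_coef0 (F : Vm) (v : V) : Vm :=
  [ffun j => if j == ord0 then v else F j].

Definition kills_invariants (W : vectType K) (a : W * Vm -> Vm) :=
  forall phi : Vm -> K, smooth_scalar phi -> invariant_fun (takiff_rep rho m) phi ->
    annihilates a phi.

(** One application of the Dixmier property of [rho]. An element of the form b T^k acts by 0 on
    coefficients below k and by rho(b).f_0 on the k-th. *)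
Lemma takiff_dixmier_step (W : vectType K) (a : W * Vm -> Vm) (k : nat) :
  dixmier rho -> (k <= m)%N -> smooth_map a -> kills_invariants a ->
  (forall w F (j : 'I_m.+1), (j < k)%N -> a (w, F) j = 0) ->
  exists2 b : W * Vm -> takiff g m, smooth_map b &
    forall w F (j : 'I_m.+1), (j <= k)%N ->
      a (w, F) j = takiff_act rho (b (w, F)) F j.
Proof.
move=> dix km sa ka a0.
(* The parameter space is W * Vm and v is the variable. The coefficient f_0 stored in the parameter
   is overwritten by v, which avoids splitting [Vm] into f_0 and the rest. *)
pose L (p : (W * Vm) * V) : W * Vm := (p.1.1, set_coef0 p.1.2 p.2).
have hL : linear L.
  move=> x [[w F] v] [[w' F'] v']; congr pair => /=.
  by apply/ffunP => j; rewrite !ffunE; case: ifP.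
pose a1 p := a (L p) (inord k).
have sa1 : smooth_map a1.
  apply: (smooth_map_lcomp SC (@coef_linear V (inord k))).
  exact: (smooth_map_rcomp SC hL).
have ka1 phi : smooth_scalar phi -> invariant_fun rho phi -> annihilates a1 phi.
  move=> sphi iphi [w F] v; rewrite /lie_derivative -/(dir _ _ _).
  have := ka _ (taylor_smooth sphi k) (taylor_invariant sphi iphi km) w (set_coef0 F v).
  rewrite /lie_derivative -/(dir _ _ _) dir_taylor //; last by move=> j; exact: a0.
  rewrite {2}/set_coef0 ffunE eqxx => /eqP; rewrite mulf_eq0 pnatr_eq0.
  by rewrite -leqn0 leqNgt fact_gt0 => /eqP.
have [b1 sb1 b1E] := dix _ a1 sa1 ka1.
(* Setting v = f_0 undoes the overwriting: [L (M p)] is [p]. *)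
pose M (p : W * Vm) : (W * Vm) * V := (p, p.2 ord0).
have hM : linear M.
  by move=> x [w F] [w' F']; congr pair => /=; rewrite !ffunE.
exists (fun p => takiff_mono (inord k) (b1 (M p))).
  apply: (smooth_map_lcomp SC (@takiff_mono_linear K m g (inord k))).
  exact: (smooth_map_rcomp SC hM).
move=> w F j jk; rewrite -[j in RHS]inord_val takiff_actE ?(leq_trans jk) //.
have r0 r x : (r <= m)%N -> r != k -> takiff_mono (inord k : 'I_m.+1) x (inord r) = 0 :> g.
  move=> rm rk; rewrite ffunE ifN //; apply: contra rk => /eqP /(congr1 val).
  by rewrite /= !inordK // => ->.
move: jk; rewrite leq_eqVlt => /orP[/eqP jk|jk]; last first.
  rewrite a0 // big_nat big1 // => r /andP[_ rj].
  rewrite r0 ?linear0 ?zero_lfunE //; last by rewrite neq_ltn (leq_trans rj).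
  by rewrite (leq_trans _ km) // ltnW // (leq_trans rj).
rewrite big_nat_recr //= big_nat big1 ?add0r; last first.
  move=> r /andP[_ rj]; rewrite r0 ?linear0 ?zero_lfunE // -?jk ?ltn_eqF //.
  by rewrite -ltnS (ltn_trans rj).
rewrite subnn jk ffunE eqxx (_ : inord 0 = ord0); last first.
  by apply: val_inj; rewrite /= inordK.
rewrite /M /= -b1E /a1 /L /=; congr (a (w, _) _).
  by apply/ffunP => i; rewrite ffunE; case: eqP => // ->.
by apply: val_inj; rewrite /= inordK.
Qed.

Lemma takiff_dixmier : dixmier rho -> dixmier (takiff_rep rho m).
Proof.
move=> dix W a sa ka.
suff: forall k, (k <= m.+1)%N -> exists2 b : W * Vm -> takiff g m, smooth_map b &
    forall w F (j : 'I_m.+1), (j < k)%N -> a (w, F) j = takiff_act rho (b (w, F)) F j.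
  move=> /(_ m.+1 (leqnn _))[b sb bE]; exists b => // w F.
  by rewrite takiff_repE; apply/ffunP => j; apply: bE.
elim=> [_|k IH km]; first by exists (fun=> 0) => //; exact: (smooth_map0 SC).
have [b sb bE] := IH (ltnW km).
have actl (F : Vm) : linear (fun X : takiff g m => takiff_act rho X F).
  move=> x X Y; have := congr1 (fun h : 'End(Vm) => h F) (takiff_map_linear rho x X Y).
  by rewrite /= add_lfunE scale_lfunE !lfunE.
have actr (X : takiff g m) : linear (takiff_act rho X) by exact: takiff_act_linearr.
pose B (X : takiff g m) (F : Vm) := - takiff_act rho X F.
pose a' p := a p + B (b p) p.2.
have sa' : smooth_map a'.
  apply: (smooth_mapD SC sa); apply: (smooth_map_bilinear SC) => //.
  - by move=> F x X Y; rewrite /B actl opprD scalerN.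
  - by move=> X x F F'; rewrite /B actr opprD scalerN.
(* At each point the subtracted direction comes from the single element [b (w, F)], so invariance of
   phi makes its derivative zero whatever the dependence of [b] on the point. *)
have ka' : kills_invariants a'.
  move=> phi sphi iphi w F; rewrite /lie_derivative -/(dir _ _ _) /a' /B.
  rewrite (dirD SC) // -scaleN1r (dirZ SC) //.
  have := ka _ sphi iphi w F; rewrite /lie_derivative -/(dir _ _ _) => ->.
  have := iphi (b (w, F)) F; rewrite takiff_repE -/(dir _ _ _) => ->.
  by rewrite mulr0 addr0.
have [w F j jk|b' sb' b'E] := takiff_dixmier_step dix km sa' ka'.
  by rewrite /a' /B 2!ffunE bE // subrr.
exists (fun p => b p + b' p); first exact: (smooth_mapD SC).
move=> w F j jk; have := b'E w F j jk; rewrite /a' /B 2!ffunE => /eqP.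
rewrite subr_eq => /eqP ->.
have /= E := actl F 1 (b' (w, F)) (b (w, F)); rewrite !scale1r in E.
by rewrite [b _ + b' _]addrC E [RHS]ffunE.
Qed.

End MainProof.

(** * Differentiability in epsilon-delta form and rules for differentials *)

Section EpsilonDifferential.
Variable K : numFieldType.

Lemma near0_le (V : normedModType K) (P : V -> Prop) :
  (\forall h \near 0, P h) <-> exists2 d : K, 0 < d & forall h, `|h| <= d -> P h.
Proof.
split=> [/nbhs_normP[d /= d0 hd]|[d d0 hd]].
  exists (d / 2); first by rewrite divr_gt0.
  move=> h hh; apply: hd; rewrite /= sub0r normrN.
  by apply: le_lt_trans hh _; rewrite ltr_pdivrMr // ltr_pMr // ltr1n.
by apply/nbhs_normP; exists d => // h /=; rewrite sub0r normrN => /ltW; exact: hd.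
Qed.

Lemma differentiable_eps (V W : normedModType K) (f : V -> W) x :
  differentiable f x -> forall e, 0 < e -> exists2 d, 0 < d & forall h,
    `|h| <= d -> `|f (x + h) - f x - 'd f x h| <= e * `|h|.
Proof.
move=> /diff_locally/eqaddoP h e e0.
have /near0_le[d d0 hd] := h e e0; exists d => // k /hd.
by rewrite /= fctE /= [k + x]addrC opprD addrA.
Qed.

Lemma eps_differentiable (V W : normedModType K) (f : V -> W) (L : {linear V -> W}) x :
  continuous L -> (forall e, 0 < e -> exists2 d, 0 < d & forall h,
    `|h| <= d -> `|f (x + h) - f x - L h| <= e * `|h|) ->
  differentiable f x /\ forall v, 'd f x v = L v.
Proof.
move=> cL h.
have E : f \o shift x = cst (f x) + L +o_ 0 id.
  apply/eqaddoP => e e0; apply/near0_le; have [d d0 hd] := h e e0.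
  by exists d => // k /hd; rewrite /= fctE /= [k + x]addrC opprD addrA.
have dE := diff_unique cL E.
split; last by move=> v; rewrite dE.
by apply/diff_locallyP; rewrite dE.
Qed.

Lemma linear_rV_continuous n (L : 'rV[K]_n -> K^o) : linear L -> continuous L.
Proof.
move=> hL; pose LL : {linear 'rV[K]_n -> K^o} := HB.pack L (GRing.isLinear.Build _ _ _ _ L hL).
have -> : L = fun x => \sum_i x 0 i *: L (delta_mx 0 i).
  apply/funext=> x; rewrite [x in LHS]row_sum_delta -[LHS]/(LL _) linear_sum.
  by apply: eq_bigr => i _; rewrite (linearZ_LR LL).
apply: continuous_big => [|i _ x]; first exact: add_continuous.
have ci := @coord_continuous K 1 n 0 i x.
apply: (@continuousM K _ _ (fun=> L (delta_mx 0 i)) x ci).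
exact: cst_continuous.
Qed.

End EpsilonDifferential.

Section DifferentialRules.
Variables (K : numFieldType) (n : nat).
Local Notation V := ('rV[K]_n).
Implicit Types (f g : V -> K) (x v : V).

Lemma rv_diffD f g x v :
  differentiable (f : V -> K^o) x -> differentiable (g : V -> K^o) x ->
  'd ((fun y => f y + g y) : V -> K^o) x v =
  'd (f : V -> K^o) x v + 'd (g : V -> K^o) x v.
Proof.
move=> df dg.
exact: (congr1 (fun F : V -> K^o => F v) (@diffD K V K^o f g x df dg)).
Qed.

Lemma rv_diffZ a f x v : differentiable (f : V -> K^o) x ->
  'd ((fun y => a * f y) : V -> K^o) x v = a * 'd (f : V -> K^o) x v.
Proof.
move=> df; exact: (congr1 (fun F : V -> K^o => F v) (@diffZ K V K^o f a x df)).
Qed.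

Lemma rv_diffM f g x v :
  differentiable (f : V -> K^o) x -> differentiable (g : V -> K^o) x ->
  'd ((fun y => f y * g y) : V -> K^o) x v =
  f x * 'd (g : V -> K^o) x v + g x * 'd (f : V -> K^o) x v.
Proof.
move=> df dg.
exact: (congr1 (fun F : V -> K^o => F v) (@diffM K V f g x df dg)).
Qed.

Lemma rv_diff_cst a x v : 'd ((fun=> a) : V -> K^o) x v = 0.
Proof. exact: (congr1 (fun F : V -> K^o => F v) (@diff_cst K V K^o a x)). Qed.

Lemma rv_diff_sum (I : Type) (r : seq I) (F : I -> V -> K) x v :
  (forall i, differentiable (F i : V -> K^o) x) ->
  'd ((fun y => \sum_(i <- r) F i y) : V -> K^o) x v =
  \sum_(i <- r) 'd (F i : V -> K^o) x v.
Proof.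
move=> dF; suff [] : differentiable ((fun y => \sum_(i <- r) F i y) : V -> K^o) x /\
    'd ((fun y => \sum_(i <- r) F i y) : V -> K^o) x v =
    \sum_(i <- r) 'd (F i : V -> K^o) x v by [].
elim: r => [|i r [dr dE]].
  rewrite (_ : (fun y => _) = (fun=> 0) :> (V -> K)).
    by split; [exact: (@differentiable_cst K V K^o 0 x) | rewrite big_nil rv_diff_cst].
  by apply/funext=> y; rewrite big_nil.
rewrite (_ : (fun y => _) = (fun y => F i y + \sum_(j <- r) F j y) :> (V -> K)).
  split; first exact: (@differentiableD K V K^o _ _ x (dF i) dr).
  by rewrite big_cons -dE; exact: rv_diffD (dF i) dr.
by apply/funext=> y; rewrite big_cons.
Qed.

Lemma rv_diff_coord i x v : 'd ((fun y => y 0 i) : V -> K^o) x v = v 0 i.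
Proof.
rewrite -dir_diff; last exact: differentiable_coord.
rewrite /dir derive1E (_ : (fun t : K => _) = (cst (x 0 i) + (fun t : K => v 0 i * t))).
  have h := @is_deriveD K K K^o _ _ (0:K) 1 _ _
    (is_derive_cst (x 0 i : K^o) _ _) (is_deriveZ (v 0 i) (is_derive_id (0:K) 1)).
  by rewrite (@derive_val _ _ _ _ _ _ _ h) add0r [_ *: 1]mulr1.
by apply/funext=> t; rewrite !mxE mulrC.
Qed.

End DifferentialRules.

Section RowMatrix.
Variables (K : numFieldType) (n p : nat) (A : 'M[K]_(p, n)).

Lemma mulmx_differentiable (x : 'rV[K]_p) :
  differentiable (fun y : 'rV[K]_p => y *m A) x.
Proof.
have -> : (fun y : 'rV[K]_p => y *m A) = \sum_(i < p) (fun y : 'rV[K]_p => y 0 i *: row i A).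
  by apply/funext=> y; rewrite fct_sumE mulmx_sum_row.
apply: differentiable_sum => i.
exact: (@differentiableZl K 'rV[K]_p 'rV[K]_n (fun y => y 0 i) (row i A) x
  (differentiable_coord _ _ _)).
Qed.

Lemma mulmx_comp_differentiable (f : 'rV[K]_n -> K) x :
  differentiable (f : 'rV[K]_n -> K^o) (x *m A) ->
  differentiable ((fun y => f (y *m A)) : 'rV[K]_p -> K^o) x.
Proof.
move=> df; apply: (@differentiable_comp K 'rV[K]_p 'rV[K]_n K^o (fun y => y *m A)) => //.
exact: mulmx_differentiable.
Qed.

Lemma diff_mulmx_comp (f : 'rV[K]_n -> K) x v :
  differentiable (f : 'rV[K]_n -> K^o) (x *m A) ->
  'd ((fun y => f (y *m A)) : 'rV[K]_p -> K^o) x v =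
  'd (f : 'rV[K]_n -> K^o) (x *m A) (v *m A).
Proof.
move=> df; rewrite -!dir_diff //; last exact: mulmx_comp_differentiable.
apply: (dir_comp_linear f v x) => a y z; exact: (linearP (mulmxr A)).
Qed.

End RowMatrix.

Lemma line_is_derive (K : numFieldType) (V : normedModType K) (f : V -> K) (y u : V) (s : K) :
  differentiable (f : V -> K^o) (y + s *: u) ->
  is_derive s (1 : K) ((fun t => f (y + t *: u)) : K -> K^o)
    ('d (f : V -> K^o) (y + s *: u) u).
Proof.
move=> df; set l := 'd _ _ u.
have hL : linear (fun h : K => h * l : K^o) by move=> a p q; rewrite mulrDl -mulrA.
pose L : {linear K -> K^o} := HB.pack (fun h : K => h * l : K^o) (GRing.isLinear.Build K K K^o _ _ hL).
have cL : continuous L.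
  by move=> p; apply: (@continuousM K _ id (fun=> l)); [exact: cvg_id|exact: cst_continuous].
have [|dg gE] := @eps_differentiable K K K^o (fun t => f (y + t *: u)) L s cL.
  move=> e e0; have u1 : 0 < `|u| + 1 by rewrite ltr_wpDl.
  have [d d0 hd] := differentiable_eps df (divr_gt0 e0 u1).
  exists (d / (`|u| + 1)); first by rewrite divr_gt0.
  move=> h hh; have hu : `|h *: u| <= d.
    rewrite normrZ; apply: (@le_trans _ _ (`|h| * (`|u| + 1))).
      by rewrite ler_wpM2l // lerDl.
    by rewrite -ler_pdivlMr.
  have h1 := hd _ hu.
  have E : 'd (f : V -> K^o) (y + s *: u) (h *: u) = h * l.
    exact: (linearZ_LR ('d (f : V -> K^o) (y + s *: u))).
  have h2 := eq_ind _ (fun z : K => `|f (y + s *: u + h *: u) - f (y + s *: u) - z|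
    <= e / (`|u| + 1) * `|h *: u|) h1 _ E.
  rewrite scalerDl addrA; apply: le_trans h2 _; rewrite normrZ mulrAC ler_pdivrMr //.
  by rewrite mulrA ler_wpM2l ?mulr_ge0 ?(ltW e0) // lerDl.
apply: DeriveDef; first exact/derivable1_diffP.
by rewrite deriveE // gE /= mul1r.
Qed.

Lemma young_split_terms (R : realType) (a b c k l : R) :
  a - b - l = (a - c - (l + k)) - (b - c - k).
Proof. by ring. Qed.

Lemma squeeze_difference (R : realType) (a b d e : R) :
  `|d - b| <= e -> `|d - a| <= e -> `|a - b| <= 2 * e.
Proof.
move=> h1 h2; have -> : a - b = (d - b) - (d - a) by ring.
by apply: le_trans (ler_normB _ _) _; rewrite mulr2n mulrDl mul1r lerD.
Qed.

Lemma eq_of_square_approx (R : realType) (D : R -> R) (a b : R) :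
  (forall e, 0 < e -> exists2 d, 0 < d & forall t, 0 < t -> t <= d ->
    `|D t - t ^+ 2 * a| <= e * t ^+ 2) ->
  (forall e, 0 < e -> exists2 d, 0 < d & forall t, 0 < t -> t <= d ->
    `|D t - t ^+ 2 * b| <= e * t ^+ 2) -> a = b.
Proof.
move=> ha hb; apply/eqP; rewrite -subr_eq0 -normr_le0; apply/ler_addgt0Pr => e e0.
have e2 : 0 < e / 2 by rewrite divr_gt0.
have [d1 d10 h1] := ha _ e2; have [d2 d20 h2] := hb _ e2.
pose t := Num.min d1 d2; have t0 : 0 < t by rewrite lt_min d10.
have t1 : t <= d1 by rewrite ge_min lexx.
have t2 : t <= d2 by rewrite ge_min lexx orbT.
have tt : 0 < t ^+ 2 by rewrite exprn_gt0.
rewrite add0r -(ler_pM2l tt) -{1}(gtr0_norm tt) -normrM mulrBr.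
apply: le_trans (squeeze_difference (h2 t t0 t2) (h1 t t0 t1)) _.
by rewrite [e / 2 * _]mulrC mulrCA [2 * _]mulrC divfK.
Qed.

(** * Symmetry of second derivatives over the reals *)

Section Young.
Variables (R : realType) (n : nat).
Local Notation V := ('rV[R]_n).
Variable f : V -> R.
Hypothesis df : forall x, differentiable (f : V -> R^o) x.

Definition mixed_difference x u v t : R :=
  f (x + t *: u + t *: v) - f (x + t *: u) - f (x + t *: v) + f x.

(** The mean value theorem in the direction u turns the second difference into t times a first
    difference of g = df.u, and this one is expanded at [x]. Thus g has to be differentiable at the
    point [x] only. *)
Lemma mixed_difference_approx x u v :
  differentiable ((fun y => 'd (f : V -> R^o) y u) : V -> R^o) x ->
  forall e, 0 < e -> exists2 d, 0 < d & forall t, 0 < t -> t <= d ->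
    `|mixed_difference x u v t -
      t ^+ 2 * 'd ((fun y => 'd (f : V -> R^o) y u) : V -> R^o) x v| <= e * t ^+ 2.
Proof.
move=> dg e e0; pose g y := 'd (f : V -> R^o) y u.
set N := `|u| + `|v|; have N1 : 0 < N + 1 by rewrite ltr_wpDl // addr_ge0.
(* The 2 is for the two expansions of g, whose increments have norm at most t N; N + 1 keeps the
   denominator positive. *)
have e'0 : 0 < e / (2 * (N + 1)) by rewrite divr_gt0 // mulr_gt0.
have [d d0 hd] := differentiable_eps dg e'0.
exists (d / (N + 1)); first by rewrite divr_gt0.
move=> t t0 td.
pose h (s : R) := f (x + t *: v + s *: u) - f (x + s *: u).
have dh s : is_derive s (1 : R) (h : R -> R^o) (g (x + t *: v + s *: u) - g (x + s *: u)).
  exact: (is_deriveB (line_is_derive (df _)) (line_is_derive (df _))).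
have ch : {within `[0, t], continuous (h : R -> R)}.
  by apply: derivable_within_continuous => s _; exact: ex_derive.
have [s /itvP s0t hE] := @MVT R h (fun s => g (x + t *: v + s *: u) - g (x + s *: u)) 0 t t0
  (fun s _ => dh s) ch.
have mE : mixed_difference x u v t = t * (g (x + t *: v + s *: u) - g (x + s *: u)).
  rewrite subr0 mulrC in hE; rewrite -hE /h /mixed_difference !scale0r !addr0.
  by rewrite (addrAC x (t *: u)) opprB [RHS]addrA [RHS]addrAC.
have s0 : 0 <= s by rewrite s0t.
have st : s <= t by rewrite s0t.
have tN : t * N <= d.
  apply: (@le_trans _ _ (t * (N + 1))); first by rewrite ler_pM2l // lerDl.
  by rewrite -ler_pdivlMr.
have nsu : `|s *: u| <= t * `|u| by rewrite normrZ ger0_norm // ler_wpM2r.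
have ntv : `|t *: v| <= t * `|v| by rewrite normrZ ger0_norm // ltW.
have n1 : `|t *: v + s *: u| <= t * N.
  by apply: le_trans (ler_normD _ _) _; rewrite /N mulrDr addrC lerD.
have n2 : `|s *: u| <= t * N.
  by apply: le_trans nsu _; rewrite ler_pM2l // lerDl.
have h1 := hd _ (le_trans n1 tN); have h2 := hd _ (le_trans n2 tN).
set G := 'd _ x v.
have E1 : 'd (g : V -> R^o) x (t *: v + s *: u) = t * G + s * 'd (g : V -> R^o) x u.
  by rewrite linearD !(linearZ_LR ('d (g : V -> R^o) x)).
have E2 : 'd (g : V -> R^o) x (s *: u) = s * 'd (g : V -> R^o) x u.
  exact: (linearZ_LR ('d (g : V -> R^o) x)).
have h1' := eq_ind _ (fun z : R => `|g (x + (t *: v + s *: u)) - g x - z|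
  <= e / (2 * (N + 1)) * `|t *: v + s *: u|) h1 _ E1.
have h2' := eq_ind _ (fun z : R => `|g (x + s *: u) - g x - z|
  <= e / (2 * (N + 1)) * `|s *: u|) h2 _ E2.
rewrite mE expr2 -mulrA -mulrBr normrM (gtr0_norm t0) mulrCA ler_pM2l //.
rewrite -(addrA x) in h1' *.
move: h1' h2'; set a := g (x + (_ + _)); set b := g (x + _); set c := g x; set k := s * _.
move=> h1' h2'.
rewrite (young_split_terms a b c k (t * G)).
apply: le_trans (ler_normB _ _) _; apply: le_trans (lerD h1' h2') _.
rewrite -mulrDr; apply: (@le_trans _ _ (e / (2 * (N + 1)) * (t * N + t * N))).
  by rewrite ler_wpM2l ?(ltW e'0) // lerD.
have -> : e / (2 * (N + 1)) * (t * N + t * N) = e * t * (N / (N + 1)).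
  by field; exact: lt0r_neq0.
rewrite ler_piMr ?mulr_ge0 ?(ltW e0) ?(ltW t0) // ler_pdivrMr // mul1r.
by rewrite lerDl.
Qed.

(** The second difference is symmetric in [u] and [v], so its two expansions must have the same
    coefficient of t^2. *)
Lemma young x u v :
  differentiable ((fun y => 'd (f : V -> R^o) y u) : V -> R^o) x ->
  differentiable ((fun y => 'd (f : V -> R^o) y v) : V -> R^o) x ->
  'd ((fun y => 'd (f : V -> R^o) y u) : V -> R^o) x v =
  'd ((fun y => 'd (f : V -> R^o) y v) : V -> R^o) x u.
Proof.
move=> du dv; have sym : mixed_difference x v u = mixed_difference x u v.
  apply/funext=> t; rewrite /mixed_difference (addrAC x); congr (_ + _).
  by rewrite -!addrA; congr (_ + _); exact: addrC.
have h2 := mixed_difference_approx u dv; rewrite sym in h2.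
exact: (eq_of_square_approx (mixed_difference_approx v du) h2).
Qed.

End Young.

(** * Functions of class C^k and C^infinity *)

Section SmoothReal.
Variables (R : realType).

Section Class.
Variable n : nat.
Local Notation V := ('rV[R]_n).
Implicit Types f g : V -> R.

Lemma Ck_S k f : Ck_fun k.+1 f -> Ck_fun k f.
Proof.
elim: k f => [f [df _] x|k IH f [df cf]].
  exact: (@differentiable_continuous _ V R^o).
by split=> // v; exact: IH.
Qed.

Lemma Ck_cst k a : Ck_fun k ((fun=> a) : V -> R).
Proof.
elim: k a => [a|k IH a]; first exact: cst_continuous.
split=> [x|v]; first exact: differentiable_cst.
suff -> : (fun x => 'd ((fun=> a) : V -> R^o) x v) = fun=> 0 by exact: IH.
by apply/funext=> x; exact: rv_diff_cst.
Qed.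

Lemma Ck_add k f g : Ck_fun k f -> Ck_fun k g -> Ck_fun k (fun x => f x + g x).
Proof.
elim: k f g => [f g cf cg x|k IH f g [df cf] [dg cg]].
  by apply: (@continuousD R R^o V f g x); [exact: cf|exact: cg].
split=> [x|v]; first exact: (@differentiableD R V R^o f g).
suff -> : (fun x => 'd ((fun x => f x + g x) : V -> R^o) x v) =
    (fun x => 'd (f : V -> R^o) x v + 'd (g : V -> R^o) x v) by apply: IH; [exact: cf|exact: cg].
by apply/funext=> x; exact: rv_diffD.
Qed.

Lemma Ck_scale k a f : Ck_fun k f -> Ck_fun k (fun x => a * f x).
Proof.
elim: k f => [f cf x|k IH f [df cf]].
  by apply: (@continuousM R V (fun=> a) f x); [exact: cst_continuous|exact: cf].
split=> [x|v]; first exact: (@differentiableZ R V R^o f a).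
suff -> : (fun x => 'd ((fun x => a * f x) : V -> R^o) x v) =
    (fun x => a * 'd (f : V -> R^o) x v) by apply: IH; exact: cf.
by apply/funext=> x; exact: rv_diffZ.
Qed.

Lemma Ck_coord k i f : Ck_fun k f -> Ck_fun k (fun x => x 0 i * f x).
Proof.
elim: k f => [f cf x|k IH f [df cf]].
  by apply: (@continuousM R V (fun x => x 0 i) f x); [exact: coord_continuous|exact: cf].
have dc (x : V) : differentiable ((fun x => x 0 i) : V -> R^o) x by exact: differentiable_coord.
split=> [x|v]; first exact: (@differentiableM R V (fun x => x 0 i) f).
suff -> : (fun x => 'd ((fun x => x 0 i * f x) : V -> R^o) x v) =
    (fun x => x 0 i * 'd (f : V -> R^o) x v + v 0 i * f x).
  by apply: Ck_add; [apply: IH; exact: cf|exact/Ck_scale/Ck_S].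
apply/funext=> x; rewrite (@rv_diffM R n (fun x => x 0 i) f x v) //.
by rewrite (@rv_diff_coord R n i x v) [f x * _]mulrC.
Qed.

End Class.

Lemma Ck_pull n p (A : 'M[R]_(p, n)) k (f : 'rV[R]_n -> R) :
  Ck_fun k f -> Ck_fun k (fun x => f (x *m A)).
Proof.
elim: k f => [f cf x|k IH f [df cf]].
  apply: (@continuous_comp 'rV[R]_p 'rV[R]_n R^o (fun y => y *m A) f x); last exact: cf.
  exact/differentiable_continuous/mulmx_differentiable.
split=> [x|v]; first exact: mulmx_comp_differentiable.
suff -> : (fun x => 'd ((fun x => f (x *m A)) : 'rV[R]_p -> R^o) x v) =
    (fun x => 'd (f : _ -> R^o) (x *m A) (v *m A))
  by apply: (IH (fun y => 'd (f : _ -> R^o) y (v *m A))); exact: cf.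
by apply/funext=> x; exact: diff_mulmx_comp.
Qed.

End SmoothReal.

Lemma Cinfty_calculus (R : realType) : smooth_calculus (@Cinfty_fun R).
Proof.
split.
- by move=> n a k; exact: Ck_cst.
- by move=> n f g cf cg k; exact: Ck_add.
- by move=> n a f cf k; exact: Ck_scale.
- by move=> n i f cf k; exact: Ck_coord.
- by move=> n p A f cf k; exact: Ck_pull.
- by move=> n f cf; exact: (cf 1%N).1.
- by move=> n f cf v k; exact: (cf k.+1).2.
- move=> n f cf u v x; apply: young; first exact: (cf 1%N).1.
  + exact: ((cf 2%N).2 u).1.
  + exact: ((cf 2%N).2 v).1.
Qed.

(** * Integrals of continuous functions over segments *)

Section IntervalIntegral.
Variable R : realType.
Implicit Types (f g : R -> R) (a b c k e : R).
Local Notation mu := (@lebesgue_measure R).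

Definition itv_int f a b : R := \int[mu]_(x in `[a, b]) f x.

Lemma itv_integrable f a b : continuous f -> mu.-integrable `[a, b] (EFin \o f).
Proof.
move=> cf; apply: continuous_compact_integrable; first exact: segment_compact.
exact: continuous_subspaceT.
Qed.

Lemma itv_int_cat f a b c : continuous f -> a <= b -> b <= c ->
  itv_int f a c = itv_int f a b + itv_int f b c.
Proof.
move=> cf ab bc.
have := @Rintegral_itvB R f (BLeft a) (BRight c) b (itv_integrable a c cf).
rewrite !bnd_simp => /(_ ab bc); rewrite Rintegral_itv_obnd_cbnd.
  by rewrite /itv_int => <-; rewrite addrC subrK.
apply: (integrableS _ _ _ (itv_integrable b c cf)) => //.
by apply: subset_itvr; rewrite bnd_simp.
Qed.

Lemma itv_intB f g a b : continuous f -> continuous g ->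
  itv_int (fun x => f x - g x) a b = itv_int f a b - itv_int g a b.
Proof.
by move=> cf cg; apply: RintegralB => //; exact: itv_integrable.
Qed.

Lemma itv_int_cst k a b : a <= b -> itv_int (fun=> k) a b = k * (b - a).
Proof.
move=> ab; rewrite /itv_int Rintegral_cst //= lebesgue_measure_itv /= lte_fin.
move: ab; rewrite le_eqVlt => /predU1P[->|->]; last by rewrite -EFinD.
by rewrite ltxx subrr.
Qed.

Lemma itv_int_near_cst f k e a b : continuous f -> a <= b ->
  (forall x, a <= x <= b -> `|f x - k| <= e) ->
  `|itv_int f a b - k * (b - a)| <= e * (b - a).
Proof.
move=> cf ab fk; rewrite -itv_int_cst // -itv_intB //; last exact: cst_continuous.
have cfk : continuous (fun x => f x - k).
  by move=> x; apply: cvgB; [exact: cf|exact: cvg_cst].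
apply: le_trans (le_normr_Rintegral _ _) _ => //; first exact: itv_integrable.
rewrite -(itv_int_cst e ab); apply: le_Rintegral => //.
- apply: itv_integrable; move=> x; apply: cvg_norm; exact: cfk.
- by apply: itv_integrable; exact: cst_continuous.
Qed.

End IntervalIntegral.

(** * Goursat's argument on rectangles *)

Section Goursat.
Variable R : realType.

(* [u dy + v dx] is a closed form, in the weak sense that [u] and [v] are only
   assumed to be differentiable, with [du/dx = dv/dy]. *)
Definition closed_form (u v : R -> R -> R) : Prop := forall x y,
  exists al be ga, forall e, 0 < e -> exists2 d, 0 < d & forall h k,
    `|h| <= d -> `|k| <= d ->
    `|u (x + h) (y + k) - u x y - al * h - be * k| <= e * (`|h| + `|k|) /\
    `|v (x + h) (y + k) - v x y - ga * h - al * k| <= e * (`|h| + `|k|).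

Lemma affine_approx_continuous (w : R -> R) x a :
  (forall e, 0 < e -> exists2 d, 0 < d & forall h, `|h| <= d ->
    `|w (x + h) - w x - a * h| <= e * `|h|) -> {for x, continuous w}.
Proof.
move=> hw; apply/cvgrPdist_le => e e0.
have [d d0 hd] := hw 1 ltr01.
have a1 : 0 < `|a| + 1 by rewrite ltr_wpDl.
near=> t.
have th : `|t - x| <= d by near: t; apply: cvgr_distC_le => //; exact: cvg_id.
have te : `|t - x| <= e / (`|a| + 1).
  by near: t; apply: cvgr_distC_le; [exact: cvg_id|rewrite divr_gt0].
have := hd _ th; rewrite mul1r subrKC => h1.
rewrite distrC -[w t - w x](subrK (a * (t - x))).
apply: le_trans (ler_normD _ _) _; rewrite normrM.
apply: le_trans (lerD h1 (lexx _)) _.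
rewrite -[X in X + _]mul1r -mulrDl addrC -ler_pdivlMl // mulrC //.
Unshelve. all: by end_near.
Qed.

Variables u v : R -> R -> R.
Hypothesis uv : closed_form u v.

Lemma closed_form_continuous :
  (forall x, continuous (u x)) /\ (forall y, continuous (v^~ y)).
Proof.
split=> [x y|y x]; have [al [be [ga hD]]] := uv x y.
  apply: (@affine_approx_continuous _ _ be) => e /hD[d d0 hd]; exists d => // h hh.
  have [|//|+ _] := hd 0 h; first by rewrite normr0 ltW.
  by rewrite normr0 addr0 mulr0 subr0 add0r.
apply: (@affine_approx_continuous _ _ ga) => e /hD[d d0 hd]; exists d => // h hh.
have [//||_] := hd h 0; first by rewrite normr0 ltW.
by rewrite normr0 !addr0 mulr0 subr0.
Qed.

Let U x c h := itv_int (u x) c (c + h).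
Let V y a l := itv_int (v^~ y) a (a + l).
(* The integral of [u dy + v dx] along the boundary of the rectangle of sides [l], [h]
   and lower left corner [p]. *)
Let J l h (p : R * R) :=
  U (p.1 + l) p.2 h - U p.1 p.2 h - (V (p.2 + h) p.1 l - V p.2 p.1 l).

Lemma UD x c h : 0 <= h -> U x c (h + h) = U x c h + U x (c + h) h.
Proof.
move=> h0; rewrite /U [in LHS]addrA; apply: itv_int_cat; rewrite ?lerDl //.
by case: closed_form_continuous.
Qed.

Lemma VD y a l : 0 <= l -> V y a (l + l) = V y a l + V y (a + l) l.
Proof.
move=> l0; rewrite /V [in LHS]addrA; apply: itv_int_cat; rewrite ?lerDl //.
by case: closed_form_continuous.
Qed.

(** Every inner side belongs to two quadrants with opposite orientations and cancels. *)
Lemma rectangle_split l h p : 0 <= l -> 0 <= h ->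
  J (l + l) (h + h) p = J l h p + J l h (p.1 + l, p.2)
    + J l h (p.1, p.2 + h) + J l h (p.1 + l, p.2 + h).
Proof. by move=> l0 h0; rewrite /J /= !addrA !UD ?VD //; ring. Qed.

(** The affine parts of u and v at (x, y) contribute al l h through the vertical sides and the same
    through the horizontal ones, because du/dx = dv/dy = al. Only the remainders, at most e (l + h)
    on each side, survive. *)
Lemma rectangle_local x y e : 0 < e -> exists2 d, 0 < d & forall l h p,
  0 <= l <= d -> 0 <= h <= d -> p.1 <= x <= p.1 + l -> p.2 <= y <= p.2 + h ->
  `|J l h p| <= 2 * e * (l + h) ^+ 2.
Proof.
move=> e0; have [al [be [ga hD]]] := uv x y; have [d d0 hd] := hD e e0.
have [cu cv] := closed_form_continuous.
exists d => // l h [a c] /= /andP[l0 ld] /andP[h0 hhd] /andP[ax xa] /andP[cy yc].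
pose A := U (a + l) c h - U a c h; pose B := V (c + h) a l - V c a l.
have hA : `|A - al * l * h| <= 2 * e * (l + h) * h.
  have -> : A = itv_int (fun t => u (a + l) t - u a t) c (c + h) by rewrite itv_intB.
  have := @itv_int_near_cst R (fun t => u (a + l) t - u a t) (al * l) (2 * e * (l + h)) c (c + h).
  rewrite [c + h - c]addrC addKr; apply; first by move=> t; apply: cvgB; exact: cu.
    by rewrite lerDl.
  move=> t /andP[ct tc].
  have nt : `|t - y| <= h by rewrite ler_norml; apply/andP; split; lra.
  have na : `|a - x| <= l by rewrite ler_norml; apply/andP; split; lra.
  have nal : `|a + l - x| <= l by rewrite ler_norml; apply/andP; split; lra.
  have [+ _] := hd (a + l - x) (t - y) (le_trans nal ld) (le_trans nt hhd).
  have [+ _] := hd (a - x) (t - y) (le_trans na ld) (le_trans nt hhd).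
  rewrite ![x + _]addrC ![y + _]addrC !subrK => h1 h2.
  have -> : u (a + l) t - u a t - al * l = (u (a + l) t - u x y - al * (a + l - x) - be * (t - y))
    - (u a t - u x y - al * (a - x) - be * (t - y)) by ring.
  apply: le_trans (ler_normB _ _) _; nra.
have hB : `|B - al * h * l| <= 2 * e * (l + h) * l.
  have -> : B = itv_int (fun t => v t (c + h) - v t c) a (a + l) by rewrite itv_intB.
  have := @itv_int_near_cst R (fun t => v t (c + h) - v t c) (al * h) (2 * e * (l + h)) a (a + l).
  rewrite [a + l - a]addrC addKr; apply; first by move=> t; apply: cvgB; exact: cv.
    by rewrite lerDl.
  move=> t /andP[ct tc].
  have nt : `|t - x| <= l by rewrite ler_norml; apply/andP; split; lra.
  have na : `|c - y| <= h by rewrite ler_norml; apply/andP; split; lra.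
  have nal : `|c + h - y| <= h by rewrite ler_norml; apply/andP; split; lra.
  have [_] := hd (t - x) (c + h - y) (le_trans nt ld) (le_trans nal hhd).
  have [_] := hd (t - x) (c - y) (le_trans nt ld) (le_trans na hhd).
  rewrite ![x + _]addrC ![y + _]addrC !subrK => h1 h2.
  have -> : v t (c + h) - v t c - al * h = (v t (c + h) - v x y - ga * (t - x) - al * (c + h - y))
    - (v t c - v x y - ga * (t - x) - al * (c - y)) by ring.
  apply: le_trans (ler_normB _ _) _; nra.
have -> : J l h (a, c) = (A - al * l * h) - (B - al * h * l) by rewrite /J /= /A /B; ring.
apply: le_trans (ler_normB _ _) _; apply: le_trans (lerD hA hB) _.
by rewrite -mulrDr expr2 [h + l]addrC mulrA.
Qed.

(* The corner of a quadrant of the [2 l]-by-[2 h] rectangle that carries at least a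
   quarter of the boundary integral. *)
Let quadrant l h p : R * R :=
  if `|J (l + l) (h + h) p| <= 4 * `|J l h p| then p
  else if `|J (l + l) (h + h) p| <= 4 * `|J l h (p.1 + l, p.2)| then (p.1 + l, p.2)
  else if `|J (l + l) (h + h) p| <= 4 * `|J l h (p.1, p.2 + h)| then (p.1, p.2 + h)
  else (p.1 + l, p.2 + h).

Lemma quadrantP l h p : 0 <= l -> 0 <= h ->
  [/\ `|J (l + l) (h + h) p| <= 4 * `|J l h (quadrant l h p)|,
     p.1 <= (quadrant l h p).1 <= p.1 + l & p.2 <= (quadrant l h p).2 <= p.2 + h].
Proof.
move=> l0 h0; have := rectangle_split p l0 h0; rewrite /quadrant.
set j := J (l + l) _ _; set j1 := J l h p; set j2 := J l h _.
set j3 := J l h _; set j4 := J l h _ => E.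
have : `|j| <= `|j1| + `|j2| + `|j3| + `|j4|.
  rewrite E; do 3 (apply: le_trans (ler_normD _ _) _; apply: lerD => //).
case: ifPn => [? _|]; first by split => //=; rewrite ?lexx ?lerDl ?l0 ?h0.
rewrite -ltNge => n1; case: ifPn => [? _|].
  by split => //=; rewrite ?lexx ?lerDl ?l0 ?h0.
rewrite -ltNge => n2; case: ifPn => [? _|].
  by split => //=; rewrite ?lexx ?lerDl ?l0 ?h0.
rewrite -ltNge => n3 hj; split => /=; last 2 first.
- by rewrite ?lexx ?lerDl ?l0 ?h0.
- by rewrite ?lexx ?lerDl ?l0 ?h0.
by rewrite -/j4; lra.
Qed.

(** After n bisections some subrectangle carries at least 4^(-n) of the integral, while near the
    common point of the subrectangles [rectangle_local] bounds it by an arbitrarily small multiple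
    of 4^(-n). *)
Lemma closed_form_rectangle a c l h : 0 <= l -> 0 <= h -> J l h (a, c) = 0.
Proof.
move=> l0 h0.
pose sl n : R := l / 2 ^+ n; pose sh n : R := h / 2 ^+ n.
pose fix P n : R * R := if n is k.+1 then quadrant (sl n) (sh n) (P k) else (a, c).
have slD n : sl n.+1 + sl n.+1 = sl n.
  rewrite /sl exprS; field; exact/lt0r_neq0/exprn_gt0.
have shD n : sh n.+1 + sh n.+1 = sh n.
  rewrite /sh exprS; field; exact/lt0r_neq0/exprn_gt0.
have sl0 n : 0 <= sl n by rewrite divr_ge0 // exprn_ge0.
have sh0 n : 0 <= sh n by rewrite divr_ge0 // exprn_ge0.
have PS n : [/\ `|J (sl n) (sh n) (P n)| <= 4 * `|J (sl n.+1) (sh n.+1) (P n.+1)|,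
    (P n).1 <= (P n.+1).1 <= (P n).1 + sl n.+1 &
    (P n).2 <= (P n.+1).2 <= (P n).2 + sh n.+1].
  by have := quadrantP (P n) (sl0 n.+1) (sh0 n.+1); rewrite slD shD.
have big n : `|J l h (a, c)| <= 4 ^+ n * `|J (sl n) (sh n) (P n)|.
  elim: n => [|n IH]; first by rewrite mul1r /sl /sh !divr1.
  apply: le_trans IH _; rewrite exprSr -mulrA ler_wpM2l ?exprn_ge0 //.
  by have [] := PS n.
(* Nested intervals in each coordinate; the common point is the supremum of the left ends. *)
have nest (s p : nat -> R) : (forall n, s n.+1 + s n.+1 = s n) ->
    (forall n, 0 <= s n) ->
    (forall n, p n <= p n.+1 <= p n + s n.+1) ->
    exists x, forall n, p n <= x <= p n + s n.
  move=> sD s0 pS.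
  have inc n k : p n <= p (n + k)%N.
    elim: k => [|k IH]; first by rewrite addn0.
    by rewrite addnS (le_trans IH) //; case/andP: (pS (n + k)%N).
  have dec n k : p (n + k)%N + s (n + k)%N <= p n + s n.
    elim: k => [|k IH]; first by rewrite addn0.
    rewrite addnS (le_trans _ IH) // -(sD (n + k)%N) addrA lerD2r.
    by case/andP: (pS (n + k)%N).
  have bnd n k : p k <= p n + s n.
    apply: le_trans (inc k n) _; rewrite addnC; apply: le_trans _ (dec n k).
    by rewrite lerDl.
  pose A := range p.
  have A0 : A !=set0 by exists (p 0%N); exists 0%N.
  exists (sup A) => n; apply/andP; split.
    apply: ub_le_sup; last by exists n.
    by exists (p 0%N + s 0%N) => _ [k _ <-].
  by apply: ge_sup => // _ [k _ <-].
have [x xP] := nest sl (fun n => (P n).1) slD sl0 (fun n => let: And3 _ i _ := PS n in i).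
have [y yP] := nest sh (fun n => (P n).2) shD sh0 (fun n => let: And3 _ _ i := PS n in i).
apply/eqP; rewrite -normr_le0; apply/ler_addgt0Pr => e e0; rewrite add0r.
(* With e / C in [rectangle_local] the factor 2 (l + h)^2 is absorbed; the 1 keeps C positive. *)
pose C := 2 * (l + h) ^+ 2 + 1.
have C0 : 0 < C by rewrite ltr_wpDl // mulr_ge0 // exprn_ge0 // addr_ge0.
have [d d0 dP] := rectangle_local x y (divr_gt0 e0 C0).
have [n nP] : exists n, (l + h) / 2 ^+ n <= d.
  exists (Num.bound ((l + h) / d)); rewrite ler_pdivrMr ?exprn_gt0 // mulrC.
  rewrite -ler_pdivrMr //; apply: le_trans (ltW (archi_boundP _)) _.
    by rewrite divr_ge0 ?addr_ge0 // ltW.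
  by rewrite -natrX ler_nat ltnW // ltn_expl.
have sld : sl n <= d by apply: le_trans _ nP; rewrite ler_pM2r ?invr_gt0 ?exprn_gt0 // lerDl.
have shd : sh n <= d by apply: le_trans _ nP; rewrite ler_pM2r ?invr_gt0 ?exprn_gt0 // lerDr.
have := dP (sl n) (sh n) (P n); rewrite sl0 sh0 sld shd xP yP.
move=> /(_ isT isT isT isT) hJ; apply: le_trans (big n) _.
have p4 : (0 : R) < 4 ^+ n by rewrite exprn_gt0.
rewrite -ler_pdivlMl //; apply: le_trans hJ _.
have -> : 2 * (e / C) * (sl n + sh n) ^+ 2 = (4 ^+ n)^-1 * (e * (2 * (l + h) ^+ 2 / C)).
  have -> : (4 : R) ^+ n = 2 ^+ n ^+ 2 by rewrite (_ : 4 = 2 ^+ 2) -?exprM 1?mulnC // -natrX.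
  rewrite /sl /sh; field.
  by rewrite (lt0r_neq0 C0) lt0r_neq0 // exprn_gt0.
rewrite ler_pM2l ?invr_gt0 // ler_piMr ?(ltW e0) // ler_pdivrMr // mul1r.
by rewrite /C lerDl.
Qed.

(** On the rectangle of sides [s, t] and [0, T] the horizontal sides cancel by periodicity. *)
Lemma closed_form_periodic T : 0 <= T -> (forall x y, v x (y + T) = v x y) ->
  forall s t, s <= t -> itv_int (u s) 0 T = itv_int (u t) 0 T.
Proof.
move=> T0 vT s t st.
have ts0 : 0 <= t - s by rewrite subr_ge0.
have /eqP := closed_form_rectangle s 0 ts0 T0; rewrite /J /U /V /= !add0r.
rewrite subrKC; have -> : v^~ T = v^~ 0 by apply/funext=> x; rewrite -(vT x 0) add0r.
by rewrite subrr subr0 subr_eq0 => /eqP.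
Qed.

End Goursat.

(** * The mean value inequality for holomorphic functions *)

Section MeanValue.
Variable R : realType.
Local Notation C := R[i].
Local Open Scope complex_scope.
Local Notation Re := (@complex.Re R).
Local Notation Im := (@complex.Im R).

Lemma normC_real (x : R) : `|x%:C| = `|x|%:C :> C.
Proof. by rewrite normc_def /= expr0n /= addr0 sqrtr_sqr. Qed.

Lemma normC_le_ReIm (z : C) : `|z| <= (`|Re z| + `|Im z|)%:C.
Proof.
rewrite {1}(complexE z) rmorphD /= -!normC_real; apply: le_trans (ler_normD _ _) _.
by rewrite normrM (_ : `|'i%C| = 1) ?mul1r // normc_def /= expr0n add0r expr1n sqrtr1.
Qed.

Lemma normC_ge_Im (z : C) : `|Im z|%:C <= `|z|.
Proof.
rewrite -normrN -ReiNIm; apply: le_trans (normc_ge_Re _) _.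
by rewrite normrM (_ : `|'i%C| = 1) ?mulr1 // normc_def /= expr0n add0r expr1n sqrtr1.
Qed.

Lemma posC (d : C) : 0 < d -> exists2 r : R, 0 < r & d = r%:C.
Proof. by case: d => a b; rewrite ltcE /= => /andP[/eqP -> a0]; exists a. Qed.

Lemma geC0_real (d : C) : 0 <= d -> d = (Re d)%:C.
Proof. by case: d => a b; rewrite lecE /= => /andP[/eqP -> _]. Qed.

Lemma posR_C (r : R) : 0 < r -> 0 < r%:C :> C.
Proof. by rewrite -(ltcR 0). Qed.

Lemma is_derive_eps (f : R -> R) (x l : R) : is_derive x (1 : R) f l ->
  forall e, 0 < e -> exists2 d, 0 < d &
    forall h, `|h| <= d -> `|f (x + h) - f x - l * h| <= e * `|h|.
Proof.
move=> fl e e0; have df : derivable f x 1 by exact: ex_derive.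
have /derivable1_diffP df' := df.
have [d d0 hd] := differentiable_eps df' e0; exists d => // h /hd.
by rewrite deriv1E // derive1E derive_val [_ *: _]mulrC.
Qed.

(** This is exp(x + i y). Lines of constant x are sent to circles about 0, and the period 2 pi in y
    is the one fed to [closed_form_periodic]. *)
Definition polar (x y : R) : C := (expR x * cos y) +i* (expR x * sin y).

Lemma polarD x y h k : polar (x + h) (y + k) = polar x y * polar h k.
Proof.
rewrite /polar expRD cosD sinD; apply/eqP; rewrite eq_complex /=.
by apply/andP; split; apply/eqP; ring.
Qed.

Lemma norm_polar x y : `|polar x y| = (expR x)%:C.
Proof.
by rewrite normc_def /= !exprMn -mulrDr cos2Dsin2 mulr1 sqrtr_sqr (ger0_norm (expR_ge0 x)).
Qed.

Lemma polar_approx0 (e : R) : 0 < e -> exists2 d, 0 < d & forall h k : R,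
  `|h| <= d -> `|k| <= d ->
  `|polar h k - 1 - (h%:C + 'i * k%:C)| <= (e * (`|h| + `|k|))%:C.
Proof.
move=> e0.
(* The 8 is 3 + 3 + 2: the cosine and sine remainders are multiplied by exp h <= 3, and the cross
   term (exp h - 1) k is at most 2 |h| |k| <= 2 e' |k|. *)
have [e' e'0 [e'1 e'8]] : exists2 e' : R, 0 < e' & e' <= 1 /\ 8 * e' <= e.
  exists (Num.min 1 (e / 8)); first by rewrite lt_min ltr01 divr_gt0.
  by split; [rewrite ge_min lexx | rewrite -ler_pdivlMl // mulrC ge_min lexx orbT].
have [d1 d10 h1] := is_derive_eps (is_derive_expR 0) e'0.
have [d2 d20 h2] := is_derive_eps (is_derive_cos 0) e'0.
have [d3 d30 h3] := is_derive_eps (is_derive_sin 0) e'0.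
exists (Num.min (Num.min d1 d2) (Num.min d3 e')) => [|h k].
  by rewrite !lt_min d10 d20 d30 e'0.
rewrite !le_min => /andP[/andP[hd1 _] /andP[_ he]] /andP[/andP[_ kd2] /andP[kd3 ke]].
have := h1 h hd1; have := h2 k kd2; have := h3 k kd3.
rewrite !add0r expR0 cos0 sin0 !subr0 oppr0 !(mul1r, mul0r) subr0 => E3 E2 E1.
have E0 : `|expR h - 1| <= 2 * `|h|.
  have -> : expR h - 1 = (expR h - 1 - h) + h by rewrite subrK.
  apply: le_trans (ler_normD _ _) _; rewrite mulrDl mul1r lerD2r.
  by apply: le_trans E1 _; rewrite ler_piMl.
have E : `|expR h| <= 3.
  have -> : expR h = (expR h - 1) + 1 by rewrite subrK.
  apply: le_trans (ler_normD _ _) _; rewrite normr1.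
  have : `|h| <= 1 by apply: le_trans he _.
  by move: E0; lra.
apply: le_trans (normC_le_ReIm _) _; rewrite lecR /=.
have -> : expR h * cos k - 1 - (h + (0 * k - 1 * 0)) =
  expR h * (cos k - 1) + (expR h - 1 - h) by ring.
have -> : expR h * sin k - 0 - (0 + (0 * 0 + 1 * k)) =
  expR h * (sin k - k) + (expR h - 1) * k by ring.
apply: le_trans (lerD (ler_normD _ _) (ler_normD _ _)) _; rewrite !normrM.
have := ler_pM (normr_ge0 _) (normr_ge0 _) E E2.
have := ler_pM (normr_ge0 _) (normr_ge0 _) E E3.
have := ler_pM (normr_ge0 _) (normr_ge0 _) E0 (lexx `|k|).
have hk : `|h| * `|k| <= e' * `|k| by rewrite ler_wpM2r.
have : 8 * e' * (`|h| + `|k|) <= e * (`|h| + `|k|) by rewrite ler_wpM2r ?addr_ge0.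
have : 0 <= e' * `|h| by rewrite mulr_ge0 // ltW.
by lra.
Qed.

(** The radii live in C as norms do; in the order of [R[i]] the condition 0 < e forces [e] to be
    real. *)
Definition cdiff (f : C -> C) (z l : C) : Prop := forall e : C, 0 < e ->
  exists2 d : C, 0 < d & forall h, `|h| <= d ->
    `|f (z + h) - f z - l * h| <= e * `|h|.

(* The form [f (z + w) dw / (i w)] in the logarithmic coordinate [x + i y = ln w];
   only its real part is needed. *)
Lemma cdiff_closed_form (f : C -> C) (z : C) : (forall w, exists l, cdiff f w l) ->
  closed_form (fun x y => Re (f (z + polar x y))) (fun x y => Im (f (z + polar x y))).
Proof.
move=> df x y; set p := polar x y; have [l hl] := df (z + p).
exists (Re (l * p)), (- Im (l * p)), (Im (l * p)) => e e0.
pose a := Re `|l * p|; have aE : `|l * p| = a%:C by exact: geC0_real.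
have a0 : 0 <= a by rewrite -ler0c -aE.
pose b := expR x; have bE : `|p| = b%:C by exact: norm_polar.
have b0 : 0 < b by exact: expR_gt0.
(* The increment of the argument of f is at most 2 b s, so its remainder costs e s / 2; the other
   half is for the remainder of [polar], scaled by a. *)
have e10 : 0 < e / (4 * b) by rewrite divr_gt0 // mulr_gt0.
have [_ /posC[d1 d10 ->] h1] := hl _ (posR_C e10).
have [e2 e20 [e21 ae2]] : exists2 e2 : R, 0 < e2 & e2 <= 1 /\ a * e2 <= e / 2.
  have a1 : 0 < a + 1 by rewrite ltr_wpDl.
  exists (Num.min 1 (e / 2 / (a + 1))).
    by rewrite lt_min ltr01 !divr_gt0.
  split; first by rewrite ge_min lexx.
  apply: (@le_trans _ _ ((a + 1) * (e / 2 / (a + 1)))).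
    by apply: ler_pM => //; rewrite ?lerDl ?ge_min ?lexx ?orbT // le_min ler01 ltW // !divr_gt0.
  by rewrite mulrC divfK // lt0r_neq0.
have [d2 d20 h2] := polar_approx0 e20.
exists (Num.min d2 (d1 / (4 * b))) => [|h k].
  by rewrite lt_min d20 divr_gt0 // mulr_gt0.
rewrite !le_min => /andP[hd2 hd1] /andP[kd2 kd1].
have := h2 h k hd2 kd2; set q := polar h k - 1 - _ => hq.
pose s := `|h| + `|k|; rewrite -/s in hq *.
have s0 : 0 <= s by rewrite addr_ge0.
have hp1 : `|polar h k - 1| <= (2 * s)%:C.
  rewrite -(subrK (h%:C + 'i * k%:C) (polar h k - 1)) -/q.
  apply: le_trans (ler_normD _ _) _; rewrite mulrDl mul1r rmorphD; apply: lerD.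
    by apply: le_trans hq _; rewrite lecR ler_piMl.
  apply: le_trans (normC_le_ReIm _) _.
  by rewrite lecR /= /s; apply: lerD; rewrite !(mul0r, mul1r, subr0, addr0, add0r, mulr0).
pose D := p * (polar h k - 1).
have hD : `|D| <= (b * (2 * s))%:C.
  by rewrite normrM bE rmorphM ler_wpM2l // ler0c ltW.
have hDd : `|D| <= d1%:C.
  apply: le_trans hD _; rewrite lecR.
  have : s <= d1 / (4 * b) + d1 / (4 * b) by exact: lerD.
  have -> : d1 / (4 * b) + d1 / (4 * b) = d1 / (2 * b) by field; exact: lt0r_neq0.
  by rewrite ler_pdivlMr ?mulr_gt0 //; lra.
have := h1 D hDd.
have -> : z + p + D = z + polar (x + h) (y + k) by rewrite polarD -/p /D; ring.
set T1 := _ - l * D => hT1.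
pose T := f (z + polar (x + h) (y + k)) - f (z + p) - l * p * (h%:C + 'i * k%:C).
have hT : `|T| <= (e * s)%:C.
  have -> : T = T1 + l * p * q by rewrite /T /T1 /D /q; ring.
  apply: le_trans (ler_normD _ _) _; rewrite (normrM (l * p)) aE.
  apply: le_trans (lerD hT1 (ler_wpM2l _ hq)) _; first by rewrite ler0c.
  apply: le_trans (lerD (ler_wpM2l _ hD) (lexx _)) _.
    by rewrite ler0c ltW.
  rewrite -!rmorphM -rmorphD lecR.
  have -> : e / (4 * b) * (b * (2 * s)) = e / 2 * s by field; exact: lt0r_neq0.
  rewrite [X in _ + X]mulrA -mulrDl ler_wpM2r //; lra.
split.
  rewrite -lecR; apply: le_trans _ hT; apply: le_trans _ (normc_ge_Re _).
  rewrite lecR le_eqVlt; apply/orP; left; apply/eqP; congr `|_|.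
  rewrite /T; case: (f _) => ? ?; case: (f _) => ? ?; case: (l * p) => ? ? /=; ring.
rewrite -lecR; apply: le_trans _ hT; apply: le_trans _ (normC_ge_Im _).
rewrite lecR le_eqVlt; apply/orP; left; apply/eqP; congr `|_|.
rewrite /T; case: (f _) => ? ?; case: (f _) => ? ?; case: (l * p) => ? ? /=; ring.
Qed.

Lemma cdiff_cont (f : C -> C) z l : cdiff f z l -> forall e : C, 0 < e ->
  exists2 d : C, 0 < d & forall h, `|h| <= d -> `|f (z + h) - f z| <= e.
Proof.
move=> hf _ /posC[e e0 ->]; have [_ /posC[d d0 ->] hd] := hf 1 ltr01.
have l0 : 0 < 1 + Re `|l| by rewrite ltr_pwDl // -ler0c -geC0_real.
exists (Num.min d (e / (1 + Re `|l|)))%:C => [|h].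
  by apply: posR_C; rewrite lt_min d0 divr_gt0.
rewrite (geC0_real (normr_ge0 h)) lecR le_min => /andP[h1 h2].
have := hd h; rewrite {1}(geC0_real (normr_ge0 h)) lecR => /(_ h1); rewrite mul1r => E.
rewrite -(subrK (l * h) (f (z + h) - f z)); apply: le_trans (ler_normD _ _) _.
apply: le_trans (lerD E (lexx _)) _; rewrite normrM -[X in X + _]mul1r -mulrDl.
rewrite (geC0_real (normr_ge0 h)) (geC0_real (normr_ge0 l)) -(rmorph1 (real_complex R)).
by rewrite -rmorphD -rmorphM lecR mulrC -ler_pdivlMr.
Qed.

(** The integral of Re F over a circle about z, taken in the angle, does not depend on the radius.
    It is at most 2 pi M at radius r, and close to 2 pi Re F(z) at small radius. *)
Lemma mean_value_ineq (f : C -> C) (z : C) (r : R) (M : C) :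
  (forall w, exists l, cdiff f w l) -> 0 < r ->
  (forall w, `|w| = r%:C -> `|f (z + w)| <= M) -> `|f z| <= M.
Proof.
move=> df r0 hM.
have M0 : 0 <= M.
  apply: le_trans (hM r%:C _) => //; by rewrite normC_real ger0_norm // ltW.
have [->|fz0] := eqVneq (f z) 0; first by rewrite normr0.
have nfz : `|f z| != 0 by rewrite normr_eq0.
(* A unimodular factor makes the value at z real and nonnegative, so real parts suffice. *)
pose c := (f z)^*%C / `|f z|.
have c1 : `|c| = 1 by rewrite normrM normrV ?unitfE // normr_id normcJ divff.
pose F w := c * f w.
have FE w : `|F w| = `|f w| by rewrite normrM c1 mul1r.
have Fz : F z = `|f z|.
  by rewrite /F /c mulrAC [X in X / _]mulrC -sqr_normc expr2 mulfK.
have dF w : exists l, cdiff F w l.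
  have [l hl] := df w; exists (c * l) => e /hl[d d0 hd]; exists d => // h /hd.
  by rewrite /F -mulrA -!mulrBr normrM c1 mul1r.
pose m := Re M; have ME : M = m%:C by exact: geC0_real.
have Fz0 : 0 <= F z by rewrite Fz.
rewrite -Fz (geC0_real Fz0) ME lecR.
have cf := cdiff_closed_form z dF.
pose T : R := pi *+ 2; have T0 : 0 < T by rewrite pmulrn_lgt0 // pi_gt0.
have per x y : polar x (y + T) = polar x y by rewrite /polar cosD2pi sinD2pi.
have I_cst := closed_form_periodic cf (ltW T0) (fun x y => congr1 (fun w => Im (F (z + w))) (per x y)).
have [cu _] := closed_form_continuous cf.
apply/ler_addgt0Pr => e e0.
have [l hl] := dF z; have [_ /posC[d d0 ->] hd] := cdiff_cont hl (posR_C e0).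
(* The small circle lies within the continuity radius d, and ln d' <= ln r as [closed_form_periodic]
   requires. *)
pose d' := Num.min d r; have d'0 : 0 < d' by rewrite lt_min d0.
have d'd : d' <= d by rewrite ge_min lexx.
have d'r : ln d' <= ln r by rewrite ler_ln ?posrE // ge_min lexx orbT.
have := I_cst _ _ d'r; set I1 := itv_int _ _ _; set I2 := itv_int _ _ _ => I12.
have h1 : `|I1 - Re (F z) * (T - 0)| <= e * (T - 0).
  apply: itv_int_near_cst => [||y _]; [exact: cu|exact: ltW|].
  rewrite -lecR; apply: le_trans (hd (polar (ln d') y) _).
    apply: le_trans _ (normc_ge_Re _); rewrite lecR.
    by case: (F _) => ? ?; case: (F _).
  by rewrite norm_polar (lnK d'0) lecR.
have h2 : `|I2 - 0 * (T - 0)| <= m * (T - 0).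
  apply: itv_int_near_cst => [||y _]; [exact: cu|exact: ltW|].
  rewrite subr0 -lecR -ME; apply: le_trans (normc_ge_Re _) _.
  by rewrite FE; apply: hM; rewrite norm_polar (lnK r0).
rewrite subr0 in h1; rewrite mul0r !subr0 -I12 in h2.
rewrite -(ler_pM2r T0) mulrDl -[Re _ * T](subrK I1) [X in _ <= X]addrC.
apply: lerD; first by rewrite distrC in h1; apply: le_trans (ler_norm _) h1.
by apply: le_trans (ler_norm _) h2.
Qed.

End MeanValue.

Lemma continuous_eps (K : numFieldType) (V : normedModType K) (u : V -> K) x :
  {for x, continuous (u : V -> K^o)} <->
  forall e, 0 < e -> exists2 d : K, 0 < d & forall h, `|h| <= d -> `|u (x + h) - u x| <= e.
Proof.
split=> [cu e e0|hu].
  have /(@cvgrPdist_le _ K^o) /(_ e e0) := cu.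
  move=> /nbhs_normP[d /= d0 hd]; exists (d / 2); first by rewrite divr_gt0.
  move=> h hh; rewrite distrC; apply: hd => /=; rewrite opprD addNKr normrN.
  by apply: le_lt_trans hh _; rewrite ltr_pdivrMr // ltr_pMr // ltr1n.
apply/(@cvgrPdist_le _ K^o) => e /hu[d d0 hd]; apply/nbhs_normP; exists d => // y /= yd.
by have := hd (y - x); rewrite subrKC distrC (distrC (u y)); apply; exact: ltW.
Qed.

(** * Entire functions of several variables, from the mean value inequality *)

Section ComplexLike.
Variable K : numFieldType.

(* The complex numbers enter the theory of entire functions only through the three
   properties below; working over an abstract [K] keeps unification away from [R[i]]. *)
Definition mean_value_field : Prop := forall (f : K -> K) (z r M : K),
  (forall w, derivable (f : K -> K^o) w 1) -> 0 < r ->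
  (forall w, `|w| = r -> `|f (z + w)| <= M) -> `|f z| <= M.

Definition archimedean_field : Prop :=
  forall a b : K, 0 < a -> 0 <= b -> exists n : nat, b <= a * n.+1%:R.

(** The rate is that of difference quotients with step s / (n+1). The factor 2 in the conclusion
    allows for treating real and imaginary parts separately. *)
Definition harmonic_complete : Prop := forall (u : nat -> K) (c : K),
  (forall n m, `|u n - u m| <= c / n.+1%:R + c / m.+1%:R) ->
  exists l, forall n, `|u n - l| <= 2 * c / n.+1%:R.

Hypotheses (MV : mean_value_field) (AR : archimedean_field) (HC : harmonic_complete).

Lemma derivable_eps (f : K -> K) w :
  derivable (f : K -> K^o) w 1 -> forall e : K, 0 < e ->
  exists2 d : K, 0 < d & forall h, `|h| <= d ->
    `|f (w + h) - f w - derive1 (f : K -> K^o) w * h| <= e * `|h|.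
Proof.
move=> df e e0; have /derivable1_diffP df' := df.
have [d d0 hd] := differentiable_eps df' e0; exists d => // h /hd.
by rewrite deriv1E // [_ *: _]mulrC.
Qed.

Lemma eps_derivable (f : K -> K) w l : (forall e : K, 0 < e ->
  exists2 d : K, 0 < d & forall h, `|h| <= d ->
    `|f (w + h) - f w - l * h| <= e * `|h|) -> derivable (f : K -> K^o) w 1.
Proof.
move=> h; apply/derivable1_diffP.
have hL : linear (fun x : K => l * x : K^o).
  by move=> a x y; rewrite mulrDr mulrCA.
pose L : {linear K -> K^o} := HB.pack (fun x : K => l * x : K^o) (GRing.isLinear.Build K K K^o _ _ hL).
have [] // := @eps_differentiable K K K^o f L w.
by move=> x; apply: (@continuousM K _ (fun=> l) id); [exact: cst_continuous|exact: cvg_id].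
Qed.

(** If a > b > 0, then (a / b)^k grows at least linearly by Bernoulli's inequality, against the
    bound c / z. *)
Lemma ler_of_exprn (a b z c : K) : 0 < z -> 0 <= a -> 0 <= b ->
  (forall k, z * a ^+ k <= c * b ^+ k) -> a <= b.
Proof.
move=> z0 a0 b0 h; rewrite real_leNgt ?ger0_real //; apply/negP => ba.
have [b00|bn0] := eqVneq b 0.
  have := h 1%N; rewrite b00 !expr1 mulr0 lt_geF // mulr_gt0 //.
  by rewrite -b00.
have bgt0 : 0 < b by rewrite lt_def bn0.
pose t := a / b; have t1 : 0 < t - 1 by rewrite subr_gt0 ltr_pdivlMr // mul1r.
have bern k : 1 + (t - 1) * k%:R <= t ^+ k.
  elim: k => [|k IH]; first by rewrite mulr0 addr0.
  rewrite exprS; apply: le_trans (ler_wpM2l _ IH); last by rewrite divr_ge0.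
  have -> : t * (1 + (t - 1) * k%:R) = 1 + (t - 1) * k.+1%:R + (t - 1) ^+ 2 * k%:R.
    by rewrite -natr1; ring.
  by rewrite lerDl mulr_ge0 // exprn_ge0 // ltW.
have ht k : z * t ^+ k <= c.
  by rewrite /t exprMn exprVn mulrA ler_pdivrMr ?exprn_gt0.
have c0 : 0 <= c by apply: le_trans (ht 0%N); rewrite mulr1 ltW.
have [n hn] := AR (mulr_gt0 z0 t1) c0.
have := le_trans (ler_wpM2l (ltW z0) (bern n.+1)) (ht n.+1).
rewrite mulrDr mulr1 mulrA => /le_trans /(_ hn).
by rewrite lt_geF // ltrDr.
Qed.

(** The maximum principle for the difference quotient of f at 0, obtained by comparing k-th powers
    for all k. *)
Lemma schwarz_lemma (f : K -> K) (M z : K) : (forall w, derivable (f : K -> K^o) w 1) ->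
  (forall w, `|w| <= 3 -> `|f w| <= M) -> `|z| <= 1 ->
  `|f z - f 0| <= 2 * M * `|z|.
Proof.
move=> df hM z1; have [->|z0] := eqVneq z 0; first by rewrite subrr normr0 mulr0.
have M0 : 0 <= M by apply: le_trans (hM 0 _) => //; rewrite normr0.
pose l0 := derive1 (f : K -> K^o) 0.
pose u w := if w == 0 then l0 else (f w - f 0) / w.
have cf0 := derivable_eps (df 0).
have uc : {for 0, continuous (u : K -> K^o)}.
  apply/(@continuous_eps K K) => e e0; have [d d0 hd] := cf0 e e0.
  exists d => // h hh; rewrite add0r /u eqxx.
  have [_|h0] := eqVneq h 0; first by rewrite subrr normr0 ltW.
  have := hd h hh; rewrite add0r -ler_pdivrMr ?normr_gt0 // -normfV -normrM.
  by rewrite mulrBl mulfK.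
(* [u] is not known to be differentiable at [0], but [G k] is; the mean value
   inequality for all [G k] bounds [`|u z| ^+ k] up to a factor independent of [k]. *)
pose G k w := w * u w ^+ k.
have dG k w : derivable (G k : K -> K^o) w 1.
  have [->|w0] := eqVneq w 0.
    apply: (@eps_derivable _ _ (l0 ^+ k)) => e e0.
    have uk : {for 0, continuous ((fun x => u x ^+ k) : K -> K^o)}.
      elim: k => [|k IH]; first exact: cst_continuous.
      have -> : (fun x => u x ^+ k.+1) = (fun x => u x * u x ^+ k).
        by apply/funext=> x; rewrite exprS.
      exact: continuousM.
    move/(@continuous_eps K K) : uk => /(_ e e0) [d d0 hd].
    exists d => // h /hd E; rewrite !add0r in E *.
    rewrite /G mul0r subr0 (mulrC (l0 ^+ k)) -mulrBr normrM mulrC ler_wpM2r //.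
    by move: E; rewrite {2}/u eqxx.
  have dq : derivable (fun y : K => y * ((f y - f 0) * y^-1) ^+ k : K^o) w 1.
    have d1 : derivable (fun w : K => f w - f 0 : K^o) w 1.
      by apply: derivableB; [exact: df|exact: derivable_cst].
    have d2 : derivable (fun w : K => w^-1 : K^o) w 1.
      by apply: (@derivableV K K id) => //; exact: derivable_id.
    have d3 : derivable (fun y : K => ((f y - f 0) * y^-1) ^+ k : K^o) w 1.
      elim: k => [|k IH]; first exact: derivable_cst.
      have -> : (fun y : K => ((f y - f 0) * y^-1) ^+ k.+1 : K^o) =
          (fun y => ((f y - f 0) * y^-1) * ((f y - f 0) * y^-1) ^+ k).
        by apply/funext=> y; rewrite exprS.
      exact: (derivableM (derivableM d1 d2) IH).
    exact: (derivableM (@derivable_id K K w 1) d3).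
  apply: near_eq_derivable dq.
  apply/nbhs_normP; exists `|w| => /=; first by rewrite normr_gt0.
  move=> x /= xw; rewrite /G /u ifF //; apply/negbTE; apply: contraTneq xw => ->.
  by rewrite subr0 ltxx.
have hz : 0 < `|z| by rewrite normr_gt0.
have uz k : `|z| * `|u z| ^+ k <= 3 * (2 * M) ^+ k.
  (* Since |z| <= 1, the circle of radius 2 about z stays in 1 <= |w| <= 3: the upper bound gives
     the factor 3 and the bound M on f, the lower one gives |u| <= 2 M. *)
  rewrite -normrX -normrM -/(G k z); apply: (MV (r := 2)) => // w w2.
  have h3 : `|z + w| <= 3.
    apply: le_trans (ler_normD _ _) _; rewrite w2 -[3]/(1 + 2)%:R natrD lerD2r //.
  have h1 : 1 <= `|z + w|.
    have : `|w| <= `|z + w| + `|z| by rewrite -{1}(addKr z w) addrC (le_trans (ler_normB _ _)).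
    rewrite w2 => /le_trans /(_ (lerD (lexx _) z1)).
    by rewrite -[2]/(1 + 1)%:R natrD lerD2r.
  have zw0 : z + w != 0 by rewrite -normr_gt0 (lt_le_trans ltr01).
  rewrite /G normrM normrX; apply: ler_pM => //.
  apply: lerXn2r; rewrite ?nnegrE ?mulr_ge0 // /u (negPf zw0) normrM normfV.
  rewrite ler_pdivrMr ?normr_gt0 //; apply: (@le_trans _ _ (2 * M)).
    apply: le_trans (ler_normB _ _) _; rewrite mulr2n mulrDl mul1r lerD ?hM //.
    by rewrite normr0.
  by rewrite ler_peMr // mulr_ge0.
have := ler_of_exprn hz (normr_ge0 _) (mulr_ge0 (ler0n K 2) M0) uz.
by rewrite /u (negPf z0) normrM normfV ler_pdivrMr.
Qed.

Lemma pos_lower_bound (a b : K) : 0 < a -> 0 < b -> exists2 c, 0 < c & c <= a /\ c <= b.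
Proof.
move=> a0 b0; have ab0 : 0 < a + b by rewrite addr_gt0.
exists (a * b / (a + b)); first by rewrite divr_gt0 ?mulr_gt0.
rewrite !ler_pdivrMr // !mulrDr [b * a]mulrC lerDr lerDl.
by rewrite !mulr_ge0 // ltW.
Qed.

Section SeveralVariables.
Variable V : normedModType K.
Implicit Types (F : V -> K) (x h v : V) (M r e : K).

Definition entire_on F := forall x, differentiable (F : V -> K^o) x.

Lemma entire_line F x v : entire_on F ->
  forall w, derivable (fun t : K => F (x + t *: v) : K^o) w 1.
Proof.
move=> dF w; apply/derivable1_diffP; apply: (@differentiable_comp _ K V K^o).
  apply: differentiableD; first exact: differentiable_cst.
  exact: (@differentiableZl _ _ _ (fun t : K => t) v w).
exact: dF.
Qed.

(** [schwarz_lemma] on the line through x in the direction h, parametrised by a vector of norm r. *)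
Lemma entire_lipschitz F x M r : entire_on F -> 0 < r ->
  (forall y, `|y| <= 3 * r -> `|F (x + y)| <= M) ->
  forall h, `|h| <= r -> `|F (x + h) - F x| <= 2 * M * (`|h| / r).
Proof.
move=> dF r0 hM h hr; have [->|h0] := eqVneq h 0.
  by rewrite addr0 subrr !normr0 mul0r mulr0.
have nh : 0 < `|h| by rewrite normr_gt0.
pose v := (r / `|h|) *: h.
have nv : `|v| = r by rewrite normrZ ger0_norm ?divr_ge0 ?(ltW r0) // divfK // normr_eq0.
have t0 : 0 <= `|h| / r by rewrite divr_ge0 // ltW.
have := @schwarz_lemma (fun t => F (x + t *: v)) M (`|h| / r) (entire_line dF).
rewrite scale0r addr0 ger0_norm // scalerA mulrA divfK ?lt0r_neq0 // divff ?normr_eq0 // scale1r.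
apply; last by rewrite ler_pdivrMr // mul1r.
by move=> w w3; apply: hM; rewrite normrZ nv ler_pM2r.
Qed.

Lemma entire_shift F x : entire_on F -> entire_on (fun y => F (y + x)).
Proof.
by move=> dF y; apply: (@differentiable_comp _ V V K^o (fun y => y + x)).
Qed.

Lemma entireB F G : entire_on F -> entire_on G -> entire_on (fun y => F y - G y).
Proof. by move=> dF dG y; apply: differentiableB. Qed.

Lemma entireZ F a : entire_on F -> entire_on (fun y => a * F y).
Proof. by move=> dF y; exact: (@differentiableZ K V K^o F a). Qed.

Lemma entire_diff_bound F x M r : entire_on F -> 0 < r ->
  (forall y, `|y| <= 3 * r -> `|F (x + y)| <= M) ->
  forall h, `|'d (F : V -> K^o) x h| <= 2 * M * (`|h| / r).
Proof.
move=> dF r0 hM h; have [->|h0] := eqVneq h 0.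
  by rewrite linear0 !normr0 mul0r mulr0.
have nh : 0 < `|h| by rewrite normr_gt0.
have M0 : 0 <= M by apply: le_trans (hM 0 _); rewrite ?normr0 // mulr_ge0 // ltW.
apply/ler_addgt0Pr => e e0.
have [d d0 hd] := differentiable_eps (dF x) (divr_gt0 e0 nh).
have [s s0 [sd sr]] := pos_lower_bound d0 r0.
pose k := (s / `|h|) *: h.
have nk : `|k| = s by rewrite normrZ ger0_norm ?divr_ge0 ?(ltW s0) // divfK // normr_eq0.
have := hd k; rewrite nk => /(_ sd) h1.
have := entire_lipschitz dF r0 hM (h := k); rewrite nk => /(_ sr) h2.
have : `|'d (F : V -> K^o) x k| <= 2 * M * (s / r) + e / `|h| * s.
  have -> : 'd (F : V -> K^o) x k =
      (F (x + k) - F x) - (F (x + k) - F x - 'd (F : V -> K^o) x k).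
    by rewrite subKr.
  by apply: le_trans (ler_normB _ _) _; exact: lerD.
rewrite /k (linearZ_LR ('d _ _)) normrM (ger0_norm (divr_ge0 (ltW s0) _)) //.
rewrite -ler_pdivlMl ?divr_gt0 // invf_div => /le_trans; apply.
rewrite le_eqVlt; apply/orP; left; apply/eqP; field.
by rewrite !lt0r_neq0.
Qed.

(** A second order bound from first order ones: cut h into n steps k = h / n. The increment D(y) =
    F(y + k) - F(y) is of size |h| / n, so its own Lipschitz bound makes D(x + j k) - D(x) of size
    |h|^2 / n. Summing over j compares F(x + h) - F(x) with n D(x), which tends to dF(x)h. The
    radius 6 r is 3 r for D plus 3 r for F. *)
Lemma entire_second_order F x M r : entire_on F -> 0 < r ->
  (forall y, `|y| <= 6 * r -> `|F (x + y)| <= M) ->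
  forall h, `|h| <= r ->
  `|F (x + h) - F x - 'd (F : V -> K^o) x h| <= 4 * M * (`|h| / r) ^+ 2.
Proof.
move=> dF r0 hM h hr; have [->|h0] := eqVneq h 0.
  by rewrite addr0 subrr linear0 subrr !normr0 mul0r expr0n mulr0.
have nh : 0 < `|h| by rewrite normr_gt0.
have M0 : 0 <= M by apply: le_trans (hM 0 _); rewrite ?normr0 // mulr_ge0 // ltW.
apply/ler_addgt0Pr => e e0.
have [d d0 hd] := differentiable_eps (dF x) (divr_gt0 e0 nh).
(* The step h / n must fall within the radius d where the differential at x is accurate. *)
have [N hN] := AR d0 (ltW nh); pose n := N.+1; rewrite -/n in hN.
have n0 : (0 : K) < n%:R by rewrite ltr0n.
pose k := n%:R^-1 *: h.
have nk : `|k| = `|h| / n%:R by rewrite normrZ ger0_norm ?invr_ge0 ?ltW // mulrC.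
have kr : `|k| <= r.
  by rewrite nk ler_pdivrMr //; apply: le_trans hr _; rewrite ler_peMr ?ler1n // ltW.
pose D y := F (y + k) - F y.
have dD : entire_on D by apply: entireB => //; exact: entire_shift.
have hD y : `|y| <= 3 * r -> `|D (x + y)| <= 2 * M * (`|k| / r).
  move=> yr; apply: entire_lipschitz => // y' yr'; rewrite -addrA; apply: hM.
  by apply: le_trans (ler_normD _ _) _; rewrite -[6]/(3 + 3)%:R natrD mulrDl lerD.
have hj j : (j < n)%N -> `|D (x + j%:R *: k) - D x| <= 4 * M * (`|h| / r) ^+ 2 / n%:R.
  move=> jn.
  have njk : `|j%:R *: k| <= `|h|.
    rewrite normrZ nk ger0_norm ?ler0n // mulrCA ler_piMr // ler_pdivrMr // mul1r.
    by rewrite ler_nat ltnW.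
  apply: le_trans (entire_lipschitz dD r0 hD (le_trans njk hr)) _.
  have -> : 4 * M * (`|h| / r) ^+ 2 / n%:R = 2 * (2 * M * (`|k| / r)) * (`|h| / r).
    by rewrite nk; field; rewrite !lt0r_neq0.
  rewrite ler_wpM2l ?ler_pM2r ?invr_gt0 //.
  by rewrite !mulr_ge0 // ?invr_ge0 ltW.
have tele N' : F (x + N'%:R *: k) - F x = \sum_(j < N') D (x + j%:R *: k).
  elim: N' => [|N' IH]; first by rewrite big_ord0 scale0r addr0 subrr.
  rewrite big_ord_recr -IH /= /D.
  have -> : x + N'%:R *: k + k = x + N'.+1%:R *: k.
    by rewrite -addrA -{2}(scale1r k) -scalerDl natr1.
  by rewrite addrC addrA subrK.
have hnk : n%:R *: k = h by rewrite scalerA divff ?scale1r // lt0r_neq0.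
have h1 : `|F (x + h) - F x - n%:R * D x| <= 4 * M * (`|h| / r) ^+ 2.
  rewrite -{1}hnk tele mulr_natl -[X in _ *+ X]card_ord -sumr_const -sumrB.
  apply: le_trans (ler_norm_sum _ _ _) _.
  apply: (@le_trans _ _ (\sum_(j < n) (4 * M * (`|h| / r) ^+ 2 / n%:R))).
    by apply: ler_sum => j _; exact: hj.
  by rewrite sumr_const card_ord -[X in X <= _]mulr_natl mulrCA divff ?mulr1 // lt0r_neq0.
have h2 : `|n%:R * D x - 'd (F : V -> K^o) x h| <= e.
  have -> : 'd (F : V -> K^o) x h = n%:R * 'd (F : V -> K^o) x k.
    by rewrite -[h in LHS]hnk (linearZ_LR ('d _ _)).
  rewrite -mulrBr normrM ger0_norm ?ler0n //.
  have := hd k; rewrite nk ler_pdivrMr // => /(_ hN) h3.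
  apply: le_trans (ler_wpM2l (ler0n _ _) h3) _.
  rewrite le_eqVlt; apply/orP; left; apply/eqP; field.
  by rewrite !lt0r_neq0.
rewrite -(subrK (n%:R * D x) (F (x + h) - F x)) -addrA.
by apply: le_trans (ler_normD _ _) _; exact: lerD.
Qed.

End SeveralVariables.

Lemma ler_harmonic (a b t : K) : 0 <= t ->
  (forall n : nat, a <= b + t / n.+1%:R) -> a <= b.
Proof.
move=> t0 h; apply/ler_addgt0Pr => e e0; have [n hn] := AR e0 t0.
by apply: le_trans (h n) _; rewrite lerD2l ler_pdivrMr ?ltr0n.
Qed.

Lemma diff_shift (V : normedModType K) (F : V -> K) a x :
  differentiable (F : V -> K^o) (x + a) ->
  'd ((fun y => F (y + a)) : V -> K^o) x = 'd (F : V -> K^o) (x + a) :> (V -> K^o).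
Proof.
move=> dF; apply/funext => h.
apply: (@eps_differentiable K V K^o (fun y => F (y + a)) ('d (F : V -> K^o) (x + a)) x
  (diff_continuous dF) _).2 => e e0.
have [d d0 hd] := differentiable_eps dF e0.
by exists d => // k /hd; rewrite (addrAC x k a).
Qed.

Lemma diff_difference_quotient (V : normedModType K) (F : V -> K) (c : K) a x h :
  differentiable (F : V -> K^o) (x + a) -> differentiable (F : V -> K^o) x ->
  'd ((fun y => c * (F (y + a) - F y)) : V -> K^o) x h =
  c * ('d (F : V -> K^o) (x + a) h - 'd (F : V -> K^o) x h).
Proof.
move=> dFa dF; pose G : V -> K^o := fun y => F (y + a).
have dG : differentiable G x.
  apply: (@differentiable_comp _ V V K^o (fun y => y + a)) => //.
have dD : differentiable (G - (F : V -> K^o)) x by exact: (@differentiableB K V K^o G F x).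
have := @diffZ K V K^o (G - (F : V -> K^o)) c x dD.
have := @diffB K V K^o G F x dG dF.
rewrite (diff_shift dFa) => dB dZ.
have := congr1 (fun f : V -> K^o => f h) dZ; rewrite dB; exact.
Qed.

Lemma difference_quotient_bound (e b d a t nv : K) : 0 < e ->
  `|b - d - e * a| <= t * (e * nv) -> `|e^-1 * (b - d) - a| <= t * nv.
Proof.
move=> e0 h; rewrite -(ler_pM2l e0) -{1}(ger0_norm (ltW e0)) -normrM mulrBr mulVKf ?lt0r_neq0 //.
by rewrite mulrCA.
Qed.

Lemma half_triangle (q l a e : K) : `|q - l| <= e / 2 -> `|q - a| <= e / 2 -> `|a - l| <= e.
Proof.
move=> h1 h2; have -> : a - l = (q - l) - (q - a) by ring.
by apply: le_trans (ler_normB _ _) _; rewrite [e]splitr; exact: lerD.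
Qed.

Lemma entire_split_terms (a b l p p' d : K) :
  a - b - l = (p - p' - d) + ((d - l) + ((p' - b) - (p - a))).
Proof. by ring. Qed.

Section SecondDerivative.
Variable n : nat.
Local Notation V := ('rV[K]_n).
Implicit Types (F : V -> K) (x h v : V).

Lemma entire_local_bound F x : entire_on F ->
  exists2 r, 0 < r & exists M, forall y, `|y| <= 20 * r -> `|F (x + y)| <= M.
Proof.
move=> dF; have cF : {for x, continuous (F : V -> K^o)}.
  by apply: differentiable_continuous; exact: dF.
have [d d0 hd] := (continuous_eps F x).1 cF 1 ltr01.
exists (d / 20); first by rewrite divr_gt0.
exists (1 + `|F x|) => y; rewrite mulrC divfK // => /hd yd.
rewrite -(subrK (F x) (F (x + y))); apply: le_trans (ler_normD _ _) _.
by rewrite lerD2r.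
Qed.

(** The entire quotients q_m = (F(y + e_m v) - F(y)) / e_m approach dF(y)v uniformly near x at rate
    1 / (m+1). So their differentials at x are Cauchy, and their second order bounds, uniform in m,
    pass to the limit: L is the differential of dF.v at x. The estimate for quotients of dF.h along
    v is kept for the symmetry of second derivatives. *)
Lemma entire_dir_quotient F x v : entire_on F -> exists2 s : K, 0 < s &
  exists (L : {linear V -> K^o}) (C : V -> K) (B : K),
  [/\ forall h, 0 <= C h,
   forall h m, `|(s / m.+1%:R)^-1 *
      ('d (F : V -> K^o) (x + (s / m.+1%:R) *: v) h - 'd (F : V -> K^o) x h) - L h|
        <= C h / m.+1%:R,
   exists2 r, 0 < r & forall h, `|h| <= r ->
     `|'d (F : V -> K^o) (x + h) v - 'd (F : V -> K^o) x v - L h| <= B * `|h| ^+ 2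
   & 0 <= B].
Proof.
move=> dF; have [r r0 [M hM]] := entire_local_bound x dF.
have M0 : 0 <= M by apply: le_trans (hM 0 _); rewrite ?normr0 // mulr_ge0 // ltW.
have v1 : 0 < `|v| + 1 by rewrite ltr_wpDl.
pose s := r / (`|v| + 1); have s0 : 0 < s by rewrite divr_gt0.
have sv : s * `|v| <= r by rewrite /s mulrAC ler_pdivrMr // ler_pM2l // lerDl.
pose e m := s / m.+1%:R.
have e0 m : 0 < e m by rewrite divr_gt0 // ltr0n.
have ev m : `|e m *: v| <= r.
  rewrite normrZ ger0_norm ?(ltW (e0 m)) // (le_trans _ sv) // ler_wpM2r //.
  by rewrite ler_pdivrMr ?ltr0n // ler_peMr ?ler1n // ltW.
pose g y := 'd (F : V -> K^o) y v.
pose q m y := (e m)^-1 * (F (y + e m *: v) - F y).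
have dq m : entire_on (q m).
  by apply: entireZ; apply: entireB => //; exact: entire_shift.
(* 20 = 14 + 6, where 6 r is the radius asked for by [entire_second_order] at the point x + y. *)
have bM y z : `|y| <= 14 * r -> `|z| <= 6 * r -> `|F (x + y + z)| <= M.
  move=> hy hz; rewrite -addrA; apply: hM; apply: le_trans (ler_normD _ _) _.
  by rewrite -[20]/(14 + 6)%:R natrD mulrDl lerD.
have bM3 y z : `|y| <= 14 * r -> `|z| <= 3 * r -> `|F (x + y + z)| <= M.
  move=> hy hz; apply: bM => //; apply: le_trans hz _.
  by rewrite ler_pM2r // ler_nat.
pose c := 4 * M * s * (`|v| / r) ^+ 2.
have vr0 h : 0 <= `|h| / r by rewrite divr_ge0 // ltW.
have c0 : 0 <= c by rewrite mulr_ge0 ?exprn_ge0 // mulr_ge0 ?(ltW s0) // mulr_ge0.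
have qg m y : `|y| <= 14 * r -> `|q m (x + y) - g (x + y)| <= c / m.+1%:R.
  move=> hy; have := entire_second_order dF r0 (fun z => bM y z hy) (ev m).
  rewrite (linearZ_LR ('d _ _)) -/(g _) => h1.
  have -> : q m (x + y) - g (x + y) =
      (e m)^-1 * (F (x + y + e m *: v) - F (x + y) - e m * g (x + y)).
    by rewrite mulrBr mulKf // lt0r_neq0.
  rewrite normrM ger0_norm ?invr_ge0 ?(ltW (e0 m)) // ler_pdivrMl //.
  apply: le_trans h1 _; rewrite normrZ ger0_norm ?(ltW (e0 m)) //.
  rewrite le_eqVlt; apply/orP; left; apply/eqP; rewrite /c /e; field.
  by rewrite addrC natr1 pnatr_eq0 lt0r_neq0.
pose M1 := 2 * M * (`|v| / r).
have M10 : 0 <= M1 by rewrite mulr_ge0 // mulr_ge0.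
have bq m y : `|y| <= 14 * r -> `|q m (x + y)| <= M1.
  move=> hy; have := entire_lipschitz dF r0 (fun z => bM3 y z hy) (ev m) => h1.
  rewrite normrM ger0_norm ?invr_ge0 ?(ltW (e0 m)) // ler_pdivrMl //.
  apply: le_trans h1 _; rewrite normrZ ger0_norm ?(ltW (e0 m)) //.
  rewrite le_eqVlt; apply/orP; left; apply/eqP; rewrite /M1; field.
  by rewrite lt0r_neq0.
have r6 y : `|y| <= 6 * r -> `|y| <= 14 * r.
  by move=> hy; apply: le_trans hy _; rewrite ler_pM2r // ler_nat.
have r3 y : `|y| <= 3 * r -> `|y| <= 14 * r.
  by move=> hy; apply: le_trans hy _; rewrite ler_pM2r // ler_nat.
have r1 y : `|y| <= r -> `|y| <= 14 * r.
  by move=> hy; apply: le_trans hy _; rewrite ler_peMl ?ler1n // ltW.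
have q2 m h : `|h| <= r ->
    `|q m (x + h) - q m x - 'd (q m : V -> K^o) x h| <= 4 * M1 * (`|h| / r) ^+ 2.
  by move=> hr; apply: (entire_second_order (dq m) r0) => // y /r6; exact: bq.
have dqd m m' h : `|'d (q m : V -> K^o) x h - 'd (q m' : V -> K^o) x h| <=
    (2 * c * (`|h| / r)) / m.+1%:R + (2 * c * (`|h| / r)) / m'.+1%:R.
  have -> : 'd (q m : V -> K^o) x h - 'd (q m' : V -> K^o) x h =
      'd ((fun y => q m y - q m' y) : V -> K^o) x h.
    by rewrite [in RHS](@diffB _ V K^o (q m) (q m') x) //; exact: dq.
  have -> : 2 * c * (`|h| / r) / m.+1%:R + 2 * c * (`|h| / r) / m'.+1%:R =
    2 * (c / m.+1%:R + c / m'.+1%:R) * (`|h| / r) by ring.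
  apply: (entire_diff_bound (entireB (dq m) (dq m')) r0) => y /r3 hy.
  have := lerD (qg m y hy) (qg m' y hy); apply: le_trans; rewrite (distrC (q m' (x + y))).
  by apply: le_trans (ler_normD _ _); rewrite addrA subrK.
(* Limits are taken on basis vectors only, so that L is linear by construction. *)
have lim_e i := HC (fun m m' => dqd m m' (delta_mx 0 i)).
have [l hl] := boolp.choice lim_e.
pose Lf h : K^o := \sum_i h 0 i * l i.
have hL : linear Lf.
  move=> a y z; rewrite /Lf scaler_sumr -big_split; apply: eq_bigr => i _ /=.
  by rewrite !mxE mulrDl -mulrA.
pose L : {linear V -> K^o} := HB.pack Lf (GRing.isLinear.Build K V K^o _ _ hL).
pose C h := \sum_i `|h 0 i| * (2 * (2 * c * (`|delta_mx 0 i : V| / r))).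
have C0 h : 0 <= C h.
  by apply: sumr_ge0 => i _; rewrite mulr_ge0 // mulr_ge0 // mulr_ge0 // mulr_ge0.
have dqL m h : `|'d (q m : V -> K^o) x h - L h| <= C h / m.+1%:R.
  rewrite [h in 'd _ _ h]row_sum_delta linear_sum -sumrB.
  apply: le_trans (ler_norm_sum _ _ _) _; rewrite /C mulr_suml; apply: ler_sum => i _.
  by rewrite (linearZ_LR ('d _ _)) -mulrBr normrM -mulrA ler_wpM2l.
have dqE m h : 'd (q m : V -> K^o) x h =
    (e m)^-1 * ('d (F : V -> K^o) (x + e m *: v) h - 'd (F : V -> K^o) x h).
  exact: (@diff_difference_quotient V F (e m)^-1 (e m *: v) x h (dF _) (dF _)).
exists s => //; exists L, C, (4 * M1 / r ^+ 2); split=> //; last first.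
- by apply: divr_ge0; [exact: mulr_ge0|apply: exprn_ge0; exact: ltW].
- exists r => // h hr.
  have -> : 4 * M1 / r ^+ 2 * `|h| ^+ 2 = 4 * M1 * (`|h| / r) ^+ 2.
    by field; rewrite lt0r_neq0.
  apply: (@ler_harmonic _ _ (c + c + C h)); first by rewrite !addr_ge0.
  move=> m; change (`|g (x + h) - g x - L h| <=
    4 * M1 * (`|h| / r) ^+ 2 + (c + c + C h) / m.+1%:R).
  rewrite (entire_split_terms (g (x + h)) (g x) (L h) (q m (x + h)) (q m x) ('d (q m : V -> K^o) x h)).
  apply: le_trans (ler_normD _ _) _; apply: lerD; first exact: q2.
  apply: le_trans (ler_normD _ _) _; rewrite [in X in _ <= X]addrC mulrDl; apply: lerD => //.
  apply: le_trans (ler_normB _ _) _; rewrite mulrDl; apply: lerD; last exact/qg/r1.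
  by have := qg m 0; rewrite addr0 normr0; apply; rewrite mulr_ge0 // ltW.
move=> h m.
exact: (eq_ind _ (fun z : K => `|z - L h| <= C h / m.+1%:R) (dqL m h) _ (dqE m h)).
Qed.

Lemma square_eps (f : V -> K) (L : V -> K) x (B r : K) : 0 < r -> 0 <= B ->
  (forall h, `|h| <= r -> `|f (x + h) - f x - L h| <= B * `|h| ^+ 2) ->
  forall e, 0 < e -> exists2 d, 0 < d & forall h,
    `|h| <= d -> `|f (x + h) - f x - L h| <= e * `|h|.
Proof.
move=> r0 B0 hr e e0; have B1 : 0 < B + 1 by rewrite ltr_wpDl.
have [d d0 [dr de]] := pos_lower_bound r0 (divr_gt0 e0 B1).
exists d => // h hd; apply: le_trans (hr h (le_trans hd dr)) _.
rewrite expr2 mulrA ler_wpM2r //; apply: (@le_trans _ _ ((B + 1) * (e / (B + 1)))).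
  by apply: ler_pM => //; [rewrite lerDl|exact: le_trans de].
by rewrite mulrC divfK // lt0r_neq0.
Qed.

Lemma entire_dir F v : entire_on F -> entire_on (fun y => 'd (F : V -> K^o) y v).
Proof.
move=> dF x; have [s s0 [L [C [B [C0 _ [r r0 hr] B0]]]]] := entire_dir_quotient x v dF.
exact: (@eps_differentiable K V K^o (fun y => 'd (F : V -> K^o) y v) L x
  (linear_rV_continuous (linearP L)) (square_eps r0 B0 hr)).1.
Qed.

(** The quotients of dF.u along v tend to L u, where L is the differential of dF.v, and also to the
    derivative of dF.u along v, which exists by [entire_dir]. *)
Lemma entire_dir_sym F u v x : entire_on F ->
  'd ((fun y => 'd (F : V -> K^o) y u) : V -> K^o) x v =
  'd ((fun y => 'd (F : V -> K^o) y v) : V -> K^o) x u.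
Proof.
move=> dF; have [s s0 [L [C [B [C0 hC [r r0 hr] B0]]]]] := entire_dir_quotient x v dF.
have duv := entire_dir u dF x.
pose e m := s / m.+1%:R; have e0 m : 0 < e m by rewrite divr_gt0 // ltr0n.
rewrite [RHS]((@eps_differentiable K V K^o (fun y => 'd (F : V -> K^o) y v) L x
  (linear_rV_continuous (linearP L)) (square_eps r0 B0 hr)).2 u).
apply/eqP; rewrite -subr_eq0 -normr_le0; apply/ler_addgt0Pr => eps eps0.
rewrite add0r; set A := 'd _ x v.
have v1 : 0 < `|v| + 1 by rewrite ltr_wpDl.
have ep2 : 0 < eps / 2 by rewrite divr_gt0.
have [d d0 hd] := differentiable_eps duv (divr_gt0 ep2 v1).
have [c c0 [cd ce]] := pos_lower_bound d0 ep2.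
have sv0 : 0 <= s * `|v| by rewrite mulr_ge0 // ltW.
have [m hm] := AR c0 (addr_ge0 sv0 (C0 u)).
have m0 : (0 : K) < m.+1%:R by rewrite ltr0n.
pose Q := (e m)^-1 * ('d (F : V -> K^o) (x + e m *: v) u - 'd (F : V -> K^o) x u).
have h1 : `|Q - L u| <= eps / 2.
  apply: le_trans (hC u m) _; rewrite ler_pdivrMr //; apply: le_trans (le_trans _ hm) _.
    by rewrite lerDr.
  by rewrite ler_pM2r.
have nk : `|e m *: v| = s * `|v| / m.+1%:R.
  by rewrite normrZ ger0_norm ?(ltW (e0 m)) // /e mulrAC.
have kd : `|e m *: v| <= d.
  rewrite nk ler_pdivrMr //; apply: le_trans (le_trans _ hm) _; first by rewrite lerDl.
  by rewrite ler_pM2r.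
have h2 : `|Q - A| <= eps / 2.
  have AE : 'd ((fun y => 'd (F : V -> K^o) y u) : V -> K^o) x (e m *: v) = e m * A.
    exact: (linearZ_LR ('d ((fun y => 'd (F : V -> K^o) y u) : V -> K^o) x)).
  have nk2 : `|e m *: v| = e m * `|v| by rewrite normrZ ger0_norm ?(ltW (e0 m)).
  have h3 := eq_ind _ (fun z : K => `|'d (F : V -> K^o) (x + e m *: v) u -
    'd (F : V -> K^o) x u - z| <= eps / 2 / (`|v| + 1) * `|e m *: v|) (hd _ kd) _ AE.
  have h4 := eq_ind _ (fun z : K => `|'d (F : V -> K^o) (x + e m *: v) u -
    'd (F : V -> K^o) x u - e m * A| <= eps / 2 / (`|v| + 1) * z) h3 _ nk2.
  apply: le_trans (difference_quotient_bound (e0 m) h4) _.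
  by rewrite mulrAC ler_pdivrMr // ler_wpM2l ?(ltW ep2) // lerDl.
exact: (half_triangle h1 h2).
Qed.

End SecondDerivative.

End ComplexLike.

(** * The complex numbers as an instance *)

Section ComplexInstance.
Variable R : realType.
Local Open Scope complex_scope.

Lemma complex_mean_value : mean_value_field R[i].
Proof.
move=> f z r M df /posC[r0 r00 ->] hM.
apply: (mean_value_ineq _ r00 hM) => w; exists (derive1 (f : R[i] -> R[i]^o) w).
exact: derivable_eps.
Qed.

Lemma complex_archimedean : archimedean_field R[i].
Proof.
move=> a b /posC[r r0 ->] /geC0_real ->; have [b0|b0] := leP 0 (complex.Re b).
  exists (Num.bound (complex.Re b / r)).
  rewrite -(rmorph_nat (real_complex R)) -rmorphM lecR mulrC -ler_pdivrMr //.
  apply: le_trans (ltW (archi_boundP _)) _; first by rewrite divr_ge0 // ltW.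
  by rewrite ler_nat.
exists 0%N; rewrite mulr1 lecR; apply/ltW; exact: lt_trans r0.
Qed.

(** Each u_n - c / (n+1) is below each u_m + c / (m+1), so the supremum of the former lies in all
    the intervals. *)
Lemma real_harmonic_limit (u : nat -> R) (c : R) :
  (forall n m, `|u n - u m| <= c / n.+1%:R + c / m.+1%:R) ->
  exists l, forall n, `|u n - l| <= c / n.+1%:R.
Proof.
move=> hu; pose A := range (fun n => u n - c / n.+1%:R).
have le_um n m : u n - c / n.+1%:R <= u m + c / m.+1%:R.
  have := hu n m; rewrite ler_norml => /andP[_]; rewrite !lerBlDr => /le_trans; apply.
  by rewrite addrC addrAC addrA.
have A0 : A !=set0 by exists (u 0%N - c / 1%:R); exists 0%N.
exists (sup A) => n; rewrite ler_norml; apply/andP; split.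
  rewrite lerBrDr addrC lerBlDr; apply: ge_sup => // _ [k _ <-]; exact: le_um.
rewrite lerBlDl -lerBlDr; apply: ub_le_sup; last by exists n.
by exists (u 0%N + c / 1%:R) => _ [k _ <-]; exact: le_um.
Qed.

Lemma complex_harmonic_complete : harmonic_complete R[i].
Proof.
move=> u c hu; have := hu 0%N 0%N; rewrite subrr normr0 divr1 => cc0.
have c0 : 0 <= c by rewrite -(pmulrn_lge0 _ (isT : (0 < 2)%N)) mulr2n.
pose r := complex.Re c; have cE : c = r%:C by exact: geC0_real.
have cn n : c / n.+1%:R = (r / n.+1%:R)%:C.
  by rewrite cE rmorphM fmorphV rmorph_nat.
have [l1 h1] : exists l, forall n, `|complex.Re (u n) - l| <= r / n.+1%:R.
  apply: real_harmonic_limit => n m; have := hu n m; rewrite !cn -rmorphD => h.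
  rewrite -lecR; apply: le_trans h; apply: le_trans (normc_ge_Re _).
  by case: (u n) => ? ?; case: (u m).
have [l2 h2] : exists l, forall n, `|complex.Im (u n) - l| <= r / n.+1%:R.
  apply: real_harmonic_limit => n m; have := hu n m; rewrite !cn -rmorphD => h.
  rewrite -lecR; apply: le_trans h; apply: le_trans (normC_ge_Im _).
  by case: (u n) => ? ?; case: (u m).
exists (l1 +i* l2) => n; apply: le_trans (normC_le_ReIm _) _.
rewrite -mulrA cn -(rmorph_nat (real_complex R) 2) -rmorphM lecR mulr_natl mulr2n.
by have := lerD (h1 n) (h2 n); case: (u n).
Qed.

Lemma entire_calculus : smooth_calculus (@entire_fun R[i]).
Proof.
pose K : numFieldType := R[i].
split.
- by move=> n a x; exact: (@differentiable_cst K 'rV[K]_n K^o a x).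
- by move=> n f g df dg x; exact: (@differentiableD K 'rV[K]_n K^o f g x).
- by move=> n a f df x; exact: (@differentiableZ K 'rV[K]_n K^o f a x).
- move=> n i f df x; apply: (@differentiableM K 'rV[K]_n (fun x => x 0 i) f x) => //.
  exact: differentiable_coord.
- by move=> n p A f df x; exact: (@mulmx_comp_differentiable K n p A f x (df _)).
- by move=> n f df x.
- move=> n f df v.
  exact: (@entire_dir _ complex_mean_value complex_archimedean complex_harmonic_complete n f v df).
- move=> n f df u v x.
  exact: (@entire_dir_sym _ complex_mean_value complex_archimedean complex_harmonic_complete n f u v x df).
Qed.

End ComplexInstance.

Import -(notations) mpoly.

(** * Polynomial functions *)

Section Polynomials.
Variables (K : numFieldType).

Section OneSpace.
Variable n : nat.
Local Notation V := ('rV[K]_n).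
Implicit Types f g : V -> K.

Lemma polynomial_cst a : polynomial_fun ((fun=> a) : V -> K).
Proof. by exists (mpolyC n a) => x; rewrite mevalC. Qed.

Lemma polynomial_coord i : polynomial_fun ((fun x => x 0 i) : V -> K).
Proof. by exists (mpolyX K (mnm1 i)) => x; rewrite mevalXU. Qed.

Lemma polynomialD f g : polynomial_fun f -> polynomial_fun g ->
  polynomial_fun (fun x => f x + g x).
Proof.
by move=> [p hp] [q hq]; exists (p + q) => x; rewrite mevalD -hp -hq.
Qed.

Lemma polynomialM f g : polynomial_fun f -> polynomial_fun g ->
  polynomial_fun (fun x => f x * g x).
Proof.
by move=> [p hp] [q hq]; exists (p * q) => x; rewrite mevalM -hp -hq.
Qed.

(** Polynomial functions form the algebra generated by constants and coordinates; with this
    induction, differentials are computed on functions and never on formal polynomials. *)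
Lemma polynomial_ind (P : (V -> K) -> Prop) :
  (forall a, P (fun=> a)) -> (forall i, P (fun x => x 0 i)) ->
  (forall f g, P f -> P g -> P (fun x => f x + g x)) ->
  (forall f g, P f -> P g -> P (fun x => f x * g x)) ->
  forall f, polynomial_fun f -> P f.
Proof.
move=> PC PX PD PM f [p hp]; have {f hp} -> : f = (fun x : V => meval (fun i => x 0 i) p).
  exact/funext.
elim/mpolyind: p => [|c m p _ _ IH].
  rewrite (_ : (fun x => _) = (fun=> 0)); first exact: PC.
  by apply/funext=> x; rewrite meval0.
rewrite (_ : (fun x => _) = (fun x : V => c * meval (fun i => x 0 i) (mpolyX K m)
    + meval (fun i => x 0 i) p)); last first.
  by apply/funext=> x; rewrite mevalD mevalZ.
apply: PD => //; apply: (PM (fun=> c)) => //.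
rewrite (_ : (fun x => _) = (fun x : V => \prod_(i < n) x 0 i ^+ m i)); last first.
  by apply/funext=> x; rewrite mevalX.
elim: (index_enum _) => [|i r IHr].
  by rewrite (_ : (fun x => _) = (fun=> 1)) //; apply/funext=> x; rewrite big_nil.
rewrite (_ : (fun x => _) = (fun x : V => x 0 i ^+ m i * \prod_(i <- r) x 0 i ^+ m i)).
  apply: (PM) => //; elim: (m i) => [|k IHk]; first exact: PC.
  rewrite (_ : (fun x => _) = (fun x : V => x 0 i * x 0 i ^+ k)); first exact: PM.
  by apply/funext=> x; rewrite exprS.
by apply/funext=> x; rewrite big_cons.
Qed.

Lemma polynomial_differentiable f : polynomial_fun f ->
  forall x, differentiable (f : V -> K^o) x.
Proof.
move: f; apply: polynomial_ind => [a x|i x|f g df dg x|f g df dg x].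
- exact: (@differentiable_cst K V K^o a x).
- exact: differentiable_coord.
- exact: (@differentiableD K V K^o f g x).
- exact: (@differentiableM K V f g x).
Qed.

Lemma polynomial_diff v f : polynomial_fun f ->
  polynomial_fun (fun x => 'd (f : V -> K^o) x v).
Proof.
(* The function itself is carried along because the product rule multiplies differentials by it. *)
move=> pf; suff [] : polynomial_fun f /\ polynomial_fun (fun x => 'd (f : V -> K^o) x v) by [].
move: f pf; apply: polynomial_ind => [a|i|f g [pf df] [pg dg]|f g [pf df] [pg dg]].
- split; first exact: polynomial_cst.
  rewrite (_ : (fun x => _) = (fun=> 0)); first exact: polynomial_cst.
  by apply/funext=> x; exact: rv_diff_cst.
- split; first exact: polynomial_coord.
  rewrite (_ : (fun x => _) = (fun=> v 0 i)); first exact: polynomial_cst.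
  by apply/funext=> x; exact: rv_diff_coord.
- split; first exact: polynomialD.
  rewrite (_ : (fun x => _) = (fun x => 'd (f : V -> K^o) x v + 'd (g : V -> K^o) x v)).
    exact: polynomialD.
  by apply/funext=> x; apply: rv_diffD; exact: polynomial_differentiable.
- split; first exact: polynomialM.
  rewrite (_ : (fun x => _) =
    (fun x => f x * 'd (g : V -> K^o) x v + g x * 'd (f : V -> K^o) x v)).
    by apply: polynomialD; exact: polynomialM.
  by apply/funext=> x; apply: rv_diffM; exact: polynomial_differentiable.
Qed.

End OneSpace.

Lemma polynomial_pull n p (A : 'M[K]_(p, n)) (f : 'rV[K]_n -> K) :
  polynomial_fun f -> polynomial_fun (fun x => f (x *m A)).
Proof.
move: f; apply: polynomial_ind => [a|i|f g pf pg|f g pf pg].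
- exact: polynomial_cst.
- rewrite (_ : (fun x => _) = (fun x : 'rV[K]_p => \sum_j x 0 j * A j i)).
    elim: (index_enum _) => [|j r IH].
      rewrite (_ : (fun x => _) = (fun=> 0)); first exact: polynomial_cst.
      by apply/funext=> x; rewrite big_nil.
    rewrite (_ : (fun x => _) = (fun x : 'rV[K]_p => x 0 j * A j i + \sum_(j <- r) x 0 j * A j i)).
      apply: polynomialD => //; apply: polynomialM; first exact: polynomial_coord.
      exact: polynomial_cst.
    by apply/funext=> x; rewrite big_cons.
  by apply/funext=> x; rewrite mxE.
- exact: (polynomialD pf pg).
- exact: (polynomialM pf pg).
Qed.

(** Symmetry is left as a hypothesis since its source depends on the field: [young] over the reals,
    entire functions over the complex numbers. *)
Lemma polynomial_calculus :
  (forall n f, polynomial_fun f -> forall u v x,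
    'd ((fun y => 'd (f : 'rV[K]_n -> K^o) y u) : 'rV[K]_n -> K^o) x v =
    'd ((fun y => 'd (f : 'rV[K]_n -> K^o) y v) : 'rV[K]_n -> K^o) x u) ->
  smooth_calculus (@polynomial_fun K).
Proof.
move=> sym; split=> //.
- exact: polynomial_cst.
- by move=> n f g; exact: polynomialD.
- by move=> n a f; apply: polynomialM; exact: polynomial_cst.
- by move=> n i f; apply: polynomialM; exact: polynomial_coord.
- by move=> n p A f; exact: polynomial_pull.
- by move=> n f; exact: polynomial_differentiable.
- by move=> n f pf v; exact: polynomial_diff.
Qed.

End Polynomials.

Lemma real_polynomial_calculus (R : realType) : smooth_calculus (@polynomial_fun R).
Proof.
apply: polynomial_calculus => n f pf u v x; apply: young.
- exact: polynomial_differentiable.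
- exact/polynomial_differentiable/polynomial_diff.
- exact/polynomial_differentiable/polynomial_diff.
Qed.

Lemma complex_polynomial_calculus (R : realType) : smooth_calculus (@polynomial_fun R[i]).
Proof.
apply: polynomial_calculus => n f pf u v x.
exact: (sc_sym (entire_calculus R) (polynomial_differentiable pf)).
Qed.

Lemma taylor_step_identity (F : fieldType) (a c s t r : F) : r != 0 ->
  t * (a * (c * s) * (t / r)) + r * (a ^+ 2 * (c * s) * (t / r) ^+ 2) =
  (a + a ^+ 2) * (c * (r * s) * (t / r) ^+ 2).
Proof. by move=> r0; field. Qed.

(** * Homogeneous polynomials with l^1 coefficient bounds *)

Section HomogeneousPolynomials.
Variables (R : realType) (n : nat).
Local Notation V := ('rV[R]_n).
Implicit Types (P Q : V -> R) (M a r : R) (x h v : V) (k : nat).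

(* [P] comes from a homogeneous polynomial of degree [k] in noncommuting variables
   whose coefficients have l^1 norm at most [M]. *)
Fixpoint homog k M P : Prop :=
  match k with
  | 0%N => exists2 a, `|a| <= M & forall x, P x = a
  | k'.+1 => exists (c : 'I_n -> R) (Q : 'I_n -> V -> R),
      [/\ \sum_i c i <= M, forall i, homog k' (c i) (Q i)
        & forall x, P x = \sum_i x 0 i * Q i x]
  end.

Lemma homog_ge0 k M P : homog k M P -> 0 <= M.
Proof.
elim: k M P => [|k IH] M P /=; first by case=> a aM _; exact: le_trans aM.
case=> c [Q [cM hQ _]]; apply: le_trans cM; apply: sumr_ge0 => i _.
exact: IH (hQ i).
Qed.

Lemma homog_le k M M' P : M <= M' -> homog k M P -> homog k M' P.
Proof.
move=> MM'; case: k => [|k] /=; first by case=> a aM; exists a => //; exact: le_trans MM'.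
by case=> c [Q [cM hQ hP]]; exists c, Q; split=> //; exact: le_trans MM'.
Qed.

Lemma homog_ext k M P Q : (forall x, P x = Q x) -> homog k M P -> homog k M Q.
Proof.
by move=> /funext ->.
Qed.

Lemma homog0 k M : 0 <= M -> homog k M (fun=> 0).
Proof.
elim: k M => [|k IH] M M0 /=; first by exists 0; rewrite ?normr0.
exists (fun=> 0), (fun=> fun=> 0); split=> [||x]; first by rewrite big1.
- by move=> _; exact: IH.
- by rewrite big1 // => i _; rewrite mulr0.
Qed.

Lemma homogD k M M' P P' : homog k M P -> homog k M' P' ->
  homog k (M + M') (fun x => P x + P' x).
Proof.
elim: k M M' P P' => [|k IH] M M' P P' /=.
  move=> [a aM hP] [a' aM' hP']; exists (a + a').
    by apply: le_trans (ler_normD _ _) _; exact: lerD.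
  by move=> x; rewrite hP hP'.
move=> [c [Q [cM hQ hP]]] [c' [Q' [cM' hQ' hP']]].
exists (fun i => c i + c' i), (fun i x => Q i x + Q' i x); split.
- by rewrite big_split lerD.
- by move=> i; exact: IH.
- by move=> x; rewrite hP hP' -big_split; apply: eq_bigr => i _; rewrite mulrDr.
Qed.

Lemma homogZ k M P a : homog k M P -> homog k (`|a| * M) (fun x => a * P x).
Proof.
elim: k M P => [|k IH] M P /=.
  move=> [b bM hP]; exists (a * b); first by rewrite normrM ler_wpM2l.
  by move=> x; rewrite hP.
move=> [c [Q [cM hQ hP]]].
exists (fun i => `|a| * c i), (fun i x => a * Q i x); split.
- by rewrite -mulr_sumr ler_wpM2l.
- by move=> i; exact: IH.
- by move=> x; rewrite hP mulr_sumr; apply: eq_bigr => i _; rewrite mulrCA.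
Qed.

Lemma homog_sum k (I : Type) (r : seq I) (p : pred I) (M : I -> R) (P : I -> V -> R) :
  (forall i, p i -> homog k (M i) (P i)) ->
  homog k (\sum_(i <- r | p i) M i) (fun x => \sum_(i <- r | p i) P i x).
Proof.
move=> hP; elim: r => [|i r IH].
  by rewrite big_nil; under eq_fun do rewrite big_nil; exact: homog0.
apply: (@homog_ext _ _ (fun x => (if p i then P i x else 0) + \sum_(j <- r | p j) P j x)).
  by move=> x; rewrite big_cons; case: ifP => //; rewrite add0r.
rewrite big_cons; case: (boolP (p i)) => [/hP pi|_]; [exact: homogD|].
by apply: homog_ext IH => x; rewrite add0r.
Qed.

Lemma homogX k M P i : homog k M P -> homog k.+1 M (fun x => x 0 i * P x).
Proof.
move=> hP; have M0 := homog_ge0 hP.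
exists (fun j => if j == i then M else 0), (fun j => if j == i then P else fun=> 0); split.
- by rewrite -big_mkcond big_pred1_eq.
- by move=> j; case: ifP => // _; exact: homog0.
- move=> x; rewrite (bigD1 i) //= eqxx big1 ?addr0 // => j /negPf ->.
  by rewrite mulr0.
Qed.

Lemma coord_le_norm x i : `|x 0 i| <= `|x|.
Proof.
have -> : `|x| = \big[Num.max/0]_ij `|x ij.1 ij.2| by exact: mx_normrE.
exact: (le_bigmax _ (fun ij => `|x ij.1 ij.2|) (0, i)).
Qed.

Lemma homog_bound k M P x r : homog k M P -> `|x| <= r -> `|P x| <= M * r ^+ k.
Proof.
move=> hP xr; elim: k M P hP => [|k IH] M P /=.
  by case=> a aM ->; rewrite expr0 mulr1.
case=> c [Q [cM hQ ->]]; apply: le_trans (ler_norm_sum _ _ _) _.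
have r0 : 0 <= r by exact: le_trans xr.
apply: (@le_trans _ _ (\sum_i c i * r ^+ k.+1)); last first.
  by rewrite -mulr_suml ler_wpM2r // exprn_ge0.
apply: ler_sum => i _; rewrite normrM exprS mulrCA ler_pM //; last exact: IH.
exact: le_trans (coord_le_norm _ _) xr.
Qed.

Lemma homog_increment k M P x h r : 0 < r -> homog k M P -> `|x| <= r -> `|x + h| <= r ->
  `|P (x + h) - P x| <= k%:R * (M * r ^+ k) * (`|h| / r).
Proof.
move=> r0 hP xr xhr; elim: k M P hP => [|k IH] M P.
  by case=> a aM hP; rewrite !hP subrr normr0 !mul0r.
case=> c [Q [cM hQ hP]]; rewrite !hP -sumrB.
apply: le_trans (ler_norm_sum _ _ _) _.
apply: (@le_trans _ _ (\sum_i c i * (k.+1%:R * r ^+ k.+1 * (`|h| / r)))); last first.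
  rewrite -mulr_suml [_ * (M * _)]mulrCA -!mulrA ler_wpM2r //.
  by rewrite !mulr_ge0 // ?invr_ge0 ?exprn_ge0 ?(ltW r0).
apply: ler_sum => i _; rewrite mxE.
have -> : (x 0 i + h 0 i) * Q i (x + h) - x 0 i * Q i x =
  h 0 i * Q i (x + h) + x 0 i * (Q i (x + h) - Q i x) by ring.
have -> : c i * (k.+1%:R * r ^+ k.+1 * (`|h| / r)) =
  `|h| * (c i * r ^+ k) + r * (k%:R * (c i * r ^+ k) * (`|h| / r)).
  by rewrite -natr1 exprS; field; exact: lt0r_neq0.
apply: le_trans (ler_normD _ _) _; rewrite !normrM lerD // ler_pM // ?coord_le_norm //.
- exact: homog_bound (hQ i) xhr.
- exact: le_trans (coord_le_norm _ _) xr.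
- exact: IH (hQ i).
Qed.

Lemma homog_differentiable k M P : homog k M P ->
  forall x, differentiable (P : V -> R^o) x.
Proof.
elim: k M P => [|k IH] M P.
  by case=> a _ /funext -> x; exact: (@differentiable_cst R V R^o a x).
case=> c [Q [_ hQ /funext ->]] x.
rewrite (_ : (fun x => _) = \sum_i (fun x : V => x 0 i * Q i x)); last first.
  by apply/funext=> y; rewrite fct_sumE.
apply: (@differentiable_sum R V R^o) => i.
apply: (@differentiableM R V (fun x => x 0 i) (Q i)); first exact: differentiable_coord.
exact: IH (hQ i) x.
Qed.

Lemma homog_diffE k M P (c : 'I_n -> R) (Q : 'I_n -> V -> R) x v :
  (forall i, homog k (c i) (Q i)) -> (forall x, P x = \sum_i x 0 i * Q i x) ->
  'd (P : V -> R^o) x v =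
  \sum_i (x 0 i * 'd (Q i : V -> R^o) x v + Q i x * v 0 i).
Proof.
move=> hQ /funext ->; have dQ j := homog_differentiable (hQ j).
have dx j y : differentiable ((fun z : V => z 0 j) : V -> R^o) y by exact: differentiable_coord.
have dM i : differentiable ((fun y : V => y 0 i * Q i y) : V -> R^o) x.
  exact: (@differentiableM R V (fun x => x 0 i) (Q i) x (dx i x) (dQ i x)).
apply: etrans (rv_diff_sum _ v dM) _; apply: eq_bigr => i _.
by rewrite -(rv_diff_coord i x v); exact: rv_diffM (dx i x) (dQ i x).
Qed.

(** The factor k+1 counts the letters of a word that can be differentiated, each being replaced by a
    coordinate of v. *)
Lemma homog_diff k M P v : homog k.+1 M P ->
  homog k (k.+1%:R * M * `|v|) (fun x => 'd (P : V -> R^o) x v).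
Proof.
elim: k M P => [|k IH] M P [c [Q [cM hQ hP]]].
  have {}hQ i : homog 0 (c i) (Q i) by exact: hQ.
  apply: (@homog_le _ (\sum_i `|v 0 i| * c i)).
    rewrite mul1r mulrC; apply: (@le_trans _ _ (\sum_i `|v| * c i)).
      apply: ler_sum => i _; rewrite ler_wpM2r ?coord_le_norm //; exact: homog_ge0 (hQ i).
    by rewrite -mulr_sumr ler_wpM2l.
  apply: (@homog_ext _ _ (fun x => \sum_i v 0 i * Q i x)); last first.
    by apply: homog_sum => i _; exact: homogZ (hQ i).
  move=> x; rewrite (homog_diffE M x v hQ hP); apply: eq_bigr => i _.
  have [a _ /funext ->] := hQ i.
  by rewrite rv_diff_cst mulr0 add0r mulrC.
have {}hQ i : homog k.+1 (c i) (Q i) by exact: hQ.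
apply: (@homog_le _ (\sum_i (k.+1%:R * c i * `|v| + `|v 0 i| * c i))).
  apply: (@le_trans _ _ (\sum_i c i * (k.+2%:R * `|v|))).
    apply: ler_sum => i _; rewrite -[k.+2%:R]natr1.
    have -> : c i * ((k.+1%:R + 1) * `|v|) = k.+1%:R * c i * `|v| + `|v| * c i by ring.
    rewrite lerD2l ler_wpM2r ?coord_le_norm //; exact: homog_ge0 (hQ i).
  by rewrite -mulr_suml [_ * M]mulrC -mulrA ler_wpM2r // mulr_ge0.
apply: (@homog_ext _ _
  (fun x => \sum_i (x 0 i * 'd (Q i : V -> R^o) x v + v 0 i * Q i x))).
  move=> x; rewrite (homog_diffE M x v hQ hP); apply: eq_bigr => i _.
  by rewrite [Q i x * _]mulrC.
apply: homog_sum => i _; apply: homogD; last exact: homogZ (hQ i).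
by apply: homogX; exact: IH (hQ i).
Qed.

(** Splitting off one variable leaves h_i times an increment of Q_i, which costs k, and x_i times a
    remainder of Q_i, which costs k^2; and k + k^2 <= (k+1)^2. *)
Lemma homog_taylor k M P x h r : 0 < r -> homog k M P -> `|x| <= r -> `|x + h| <= r ->
  `|P (x + h) - P x - 'd (P : V -> R^o) x h| <= k%:R ^+ 2 * (M * r ^+ k) * (`|h| / r) ^+ 2.
Proof.
move=> r0 hP xr xhr; elim: k M P hP => [|k IH] M P.
  by case=> a aM /funext ->; rewrite rv_diff_cst !subrr normr0 expr0n !mul0r.
case=> c [Q [cM hQ hP]].
have -> : 'd (P : V -> R^o) x h = _ := homog_diffE M x h hQ hP.
rewrite !hP -!sumrB; apply: le_trans (ler_norm_sum _ _ _) _.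
apply: (@le_trans _ _ (\sum_i c i * (k.+1%:R ^+ 2 * r ^+ k.+1 * (`|h| / r) ^+ 2))); last first.
  rewrite -mulr_suml [_ * (M * _)]mulrCA -!mulrA ler_wpM2r //.
  by rewrite !mulr_ge0 // ?invr_ge0 ?exprn_ge0 ?(ltW r0) // divr_ge0 // ltW.
apply: ler_sum => i _; rewrite mxE; set d := 'd _ x h.
have -> : (x 0 i + h 0 i) * Q i (x + h) - x 0 i * Q i x - (x 0 i * d + Q i x * h 0 i) =
  h 0 i * (Q i (x + h) - Q i x) + x 0 i * (Q i (x + h) - Q i x - d) by ring.
have c0 : 0 <= c i by exact: homog_ge0 (hQ i).
apply: (@le_trans _ _ (`|h| * (k%:R * (c i * r ^+ k) * (`|h| / r)) +
  r * (k%:R ^+ 2 * (c i * r ^+ k) * (`|h| / r) ^+ 2))).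
  apply: le_trans (ler_normD _ _) _; rewrite !normrM lerD // ler_pM // ?coord_le_norm //.
  - exact: homog_increment (hQ i) xr xhr.
  - exact: le_trans (coord_le_norm _ _) xr.
  - exact: IH (hQ i).
rewrite taylor_step_identity ?lt0r_neq0 // -exprS.
have -> : c i * (k.+1%:R ^+ 2 * r ^+ k.+1 * (`|h| / r) ^+ 2) =
  k.+1%:R ^+ 2 * (c i * r ^+ k.+1 * (`|h| / r) ^+ 2).
  by move: (k.+1%:R ^+ 2) (r ^+ k.+1) ((_ / r) ^+ 2) => a b b2; ring.
apply: ler_wpM2r.
  by rewrite !mulr_ge0 ?invr_ge0 ?exprn_ge0 ?divr_ge0 ?(ltW r0) //; exact: ltW.
by rewrite -natr1; set a : R := k%:R; have : 0 <= a by []; nra.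
Qed.

End HomogeneousPolynomials.

(** Each of the k variables of a word becomes a linear form of l^1 norm at most C. *)
Lemma homog_pull (R : realType) n p (A : 'M[R]_(p, n)) C k M (P : 'rV[R]_n -> R) :
  0 <= C -> (forall i, \sum_j `|A j i| <= C) -> homog k M P ->
  homog k (M * C ^+ k) (fun x => P (x *m A)).
Proof.
move=> C0 hC; elim: k M P => [|k IH] M P.
  by case=> a aM hP; exists a => //; rewrite mulr1.
case=> c [Q [cM hQ hP]].
apply: (@homog_le _ _ _ (\sum_i \sum_j `|A j i| * (c i * C ^+ k))).
  apply: (@le_trans _ _ (\sum_i c i * C ^+ k.+1)).
    apply: ler_sum => i _; have h := homog_ge0 (IH _ _ (hQ i)).
    by rewrite exprS mulrCA -mulr_suml ler_wpM2r.
  by rewrite -mulr_suml ler_wpM2r // exprn_ge0.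
apply: (@homog_ext _ _ _ _
  (fun x => \sum_i \sum_j A j i * (x 0 j * Q i (x *m A)))).
  move=> x; rewrite hP; apply: eq_bigr => i _; rewrite mxE mulr_suml.
  by apply: eq_bigr => j _; rewrite mulrCA mulrA.
apply: homog_sum => i _; apply: homog_sum => j _; apply: homogZ.
by apply: homogX; exact: IH (hQ i).
Qed.

(** * Series dominated by a geometric series of ratio 1/2 *)

Lemma half_expr_cvg (R : realType) : (fun N => 2^-1 ^+ N : R) @ \oo --> (0 : R).
Proof. by apply: cvg_expr; rewrite ger0_norm ?invr_ge0 // invf_lt1 // ltr1n. Qed.

Lemma le_geometric (R : realType) (a b c : R) :
  (forall N : nat, a <= b + c * 2^-1 ^+ N) -> a <= b.
Proof.
move=> h; have hc : (fun N => b + c * 2^-1 ^+ N) @ \oo --> b.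
  rewrite -[X in _ --> X]addr0 -[X in _ + X](mulr0 c).
  by apply: cvgD; [exact: cvg_cst | apply: cvgMr; exact: half_expr_cvg].
by apply: (cvgr_to_ge hc); apply: nearW.
Qed.

(** The subtracted term is what makes the induction on m close. *)
Lemma geometric_tail (R : realType) (u : nat -> R) (c : R) N m :
  (forall k, `|u k| <= c * 2^-1 ^+ k) ->
  `|\sum_(N <= k < N + m) u k| <= 2 * c * 2^-1 ^+ N - 2 * c * 2^-1 ^+ (N + m).
Proof.
move=> h; elim: m => [|m IH]; first by rewrite addn0 big_geq // normr0 subrr.
rewrite addnS big_nat_recr ?leq_addr //=; apply: le_trans (ler_normD _ _) _.
apply: le_trans (lerD IH (h _)) _; rewrite [_ ^+ (N + m).+1]exprS.
by set x := _ ^+ (N + m); set y := _ ^+ N; lra.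
Qed.

Lemma geometric_sum (R : realType) (u : nat -> R) (c : R) : 0 <= c ->
  (forall k, `|u k| <= c * 2^-1 ^+ k) ->
  forall N, `|limn (series u) - \sum_(0 <= k < N) u k| <= 2 * c * 2^-1 ^+ N.
Proof.
move=> c0 h N.
have cu : cvgn (series u).
  apply: normed_cvg; apply: (@series_le_cvg _ _ (geometric c 2^-1)).
  - by move=> k /=.
  - by move=> k; rewrite /geometric /= mulr_ge0 ?exprn_ge0 ?invr_ge0.
  - by move=> k; rewrite /geometric /=; exact: h.
  - apply: is_cvg_geometric_series.
    by rewrite ger0_norm ?invr_ge0 // invf_lt1 // ltr1n.
have hd : (fun n => `|series u n - \sum_(0 <= k < N) u k|) @ \oo -->
    `|limn (series u) - \sum_(0 <= k < N) u k|.
  by apply: cvg_norm; apply: cvgB; [exact: cu | exact: cvg_cst].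
apply: (cvgr_to_le hd); exists N => // m /= Nm.
have M0 : 0 <= 2 * c * 2^-1 ^+ m :> R by rewrite !mulr_ge0 // exprn_ge0 // invr_ge0.
have := geometric_tail N (m - N) h; rewrite subnKC // => hN.
rewrite /series /= (big_cat_nat (leq0n N) Nm) //= addrAC subrr add0r.
by apply: le_trans hN _; rewrite gerBl.
Qed.

(** * Expansions at the origin and their closure properties *)

Section PowerSeries.
Variables (R : realType) (n : nat).
Local Notation V := ('rV[R]_n).
Implicit Types (P : nat -> V -> R) (f g : V -> R) (s M C a : R) (x h v : V).

(** The growth rate s is an inverse radius. The error is asked for only where |x| s <= 1/2, so that
    every estimate is geometric of ratio 1/2. *)
Definition expands s M C P f : Prop :=
  [/\ 0 < s, forall k, homog k (M * s ^+ k) (P k) &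
      forall x N, `|x| * s <= 2^-1 ->
        `|f x - \sum_(0 <= k < N) P k x| <= C * 2^-1 ^+ N].

Definition expandable f : Prop := exists s M C P, expands s M C P f.

Lemma expands_ge0 s M C P f : expands s M C P f -> 0 <= M.
Proof. by case=> s0 hP _; have := homog_ge0 (hP 0%N); rewrite mulr1. Qed.

Lemma expands_ge0C s M C P f : expands s M C P f -> 0 <= C.
Proof.
by case=> s0 _ /(_ 0 0%N); rewrite normr0 mul0r mulr1 invr_ge0 => /(_ (ler0n _ 2)) h; exact: le_trans h.
Qed.

Lemma expands_le s s' M C P f : s <= s' -> expands s M C P f -> expands s' M C P f.
Proof.
move=> ss' e; have M0 := expands_ge0 e; case: e => s0 hP hf.
split=> [|k|x N hx]; first exact: lt_le_trans ss'.
  by apply: homog_le (hP k); rewrite ler_wpM2l // lerXn2r // nnegrE ltW // (lt_le_trans s0).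
by apply: hf; apply: le_trans hx; rewrite ler_wpM2l.
Qed.

Lemma expandable_cst a : expandable (fun=> a).
Proof.
exists 1, `|a|, `|a|, (fun k => if k == 0%N then fun=> a else fun=> 0); split=> //.
  move=> [|k] /=; first by exists a; rewrite ?mulr1.
  by apply: (homog0 _ k.+1); rewrite expr1n mulr1.
move=> x [|N] _; first by rewrite big_geq // subr0 mulr1.
rewrite big_nat_recl //= big1 // addr0 subrr normr0 mulr_ge0 // exprn_ge0 // invr_ge0.
Qed.

Lemma expandableD f g : expandable f -> expandable g -> expandable (fun x => f x + g x).
Proof.
move=> [s1 [M1 [C1 [P1 e1]]]] [s2 [M2 [C2 [P2 e2]]]].
have [[s10 _ _] [s20 _ _]] := (e1, e2).
have {}e1 : expands (s1 + s2) M1 C1 P1 f by apply: expands_le e1; rewrite lerDl ltW.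
have {}e2 : expands (s1 + s2) M2 C2 P2 g by apply: expands_le e2; rewrite lerDr ltW.
exists (s1 + s2), (M1 + M2), (C1 + C2), (fun k x => P1 k x + P2 k x).
case: e1 => s0 h1 f1; case: e2 => _ h2 f2; split=> // [k|x N hx].
  by rewrite mulrDl; apply: homogD.
rewrite big_split opprD addrACA mulrDl; apply: le_trans (ler_normD _ _) _.
by apply: lerD; [exact: f1 | exact: f2].
Qed.

Lemma expandableZ a f : expandable f -> expandable (fun x => a * f x).
Proof.
move=> [s [M [C [P [s0 hP hf]]]]].
exists s, (`|a| * M), (`|a| * C), (fun k x => a * P k x); split=> // [k|x N hx].
  by rewrite -mulrA; exact: homogZ.
by rewrite -mulr_sumr -mulrBr normrM -mulrA ler_wpM2l // hf.
Qed.

Lemma expandableX i f : expandable f -> expandable (fun x => x 0 i * f x).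
Proof.
move=> [s [M [C [P e]]]]; have M0 := expands_ge0 e; have C0 := expands_ge0C e.
case: e => s0 hP hf.
(* Degrees shift by one, so M s^k is read as (M / s) s^(k+1), and |x_i| <= 1 / (2 s) supplies the
   extra factor 1/2 in the error. *)
exists s, (M / s), (C / s), (fun k x => if k is k'.+1 then x 0 i * P k' x else 0).
split=> // [[|k]|x N hx].
- by exists 0; rewrite ?normr0 // mulr1 divr_ge0 // ltW.
- rewrite exprS mulrA divfK ?lt0r_neq0 //; exact: homogX.
have hxi : `|x 0 i| <= 2^-1 / s by rewrite ler_pdivlMr // (le_trans _ hx) // ler_pM2r // coord_le_norm.
have hs N' : `|x 0 i| * (C * 2^-1 ^+ N') <= C / s * 2^-1 ^+ N'.+1.
  have -> : C / s * 2^-1 ^+ N'.+1 = 2^-1 / s * (C * 2^-1 ^+ N').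
    by rewrite exprS; ring.
  by rewrite ler_wpM2r // mulr_ge0 // exprn_ge0 // invr_ge0.
case: N => [|N].
  rewrite big_geq // subr0 normrM.
  apply: (@le_trans _ _ (`|x 0 i| * (C * 2^-1 ^+ 0))).
    by rewrite ler_wpM2l //; have := hf x 0%N hx; rewrite big_geq // subr0.
  apply: le_trans (hs 0%N) _; rewrite ler_wpM2l ?divr_ge0 ?(ltW s0) //.
  by rewrite expr1 expr0 invf_le1 // ler1n.
rewrite big_nat_recl // add0r -mulr_sumr -mulrBr normrM.
by apply: le_trans (hs N); rewrite ler_wpM2l // hf.
Qed.

End PowerSeries.

Lemma mulmx_norm_le (R : realType) n p (A : 'M[R]_(p, n)) (C : R) (x : 'rV[R]_p) :
  0 <= C -> (forall i, \sum_j `|A j i| <= C) -> `|x *m A| <= `|x| * C.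
Proof.
move=> C0 hC.
have -> : `|x *m A| = \big[Num.max/0]_ij `|(x *m A) ij.1 ij.2| by exact: mx_normrE.
apply: bigmax_le => [|[i j] _ /=]; first by rewrite mulr_ge0.
rewrite (ord1 i) mxE; apply: le_trans (ler_norm_sum _ _ _) _.
apply: (@le_trans _ _ (\sum_k `|x| * `|A k j|)).
  by apply: ler_sum => k _; rewrite normrM ler_wpM2r // coord_le_norm.
by rewrite -mulr_sumr ler_wpM2l.
Qed.

Lemma expandable_pull (R : realType) n p (A : 'M[R]_(p, n)) (f : 'rV[R]_n -> R) :
  expandable f -> expandable (fun x => f (x *m A)).
Proof.
move=> [s [M [C [P [s0 hP hf]]]]].
pose D := 1 + \sum_i \sum_j `|A j i|.
have D0 : 0 < D by rewrite ltr_pwDl // sumr_ge0 // => i _; rewrite sumr_ge0.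
have hD i : \sum_j `|A j i| <= D.
  rewrite /D (bigD1 i) //= addrCA lerDl addr_ge0 // sumr_ge0 // => k _.
  by rewrite sumr_ge0.
exists (s * D), M, C, (fun k x => P k (x *m A)); split=> [|k|x N hx].
- exact: mulr_gt0.
- by rewrite exprMn mulrA; apply: homog_pull => //; exact: ltW.
- apply: hf; apply: le_trans hx; rewrite [s * D]mulrC mulrA ler_wpM2r ?(ltW s0) //.
  exact: mulmx_norm_le (ltW D0) hD.
Qed.

Lemma natr_lt_exp2 (R : realType) k : k.+1%:R <= 2 ^+ k :> R.
Proof. by rewrite -natrX ler_nat ltn_expl. Qed.

Lemma natr_sqr_le_exp4 (R : realType) k : k%:R ^+ 2 <= 4 ^+ k :> R.
Proof.
have -> : 4 = 2 ^+ 2 :> R by ring.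
rewrite exprAC lerXn2r ?nnegrE ?exprn_ge0 //.
by apply: le_trans (natr_lt_exp2 R k); rewrite ler_nat.
Qed.

(** * Termwise differentiation *)

Section PowerSeriesDerivative.
Variables (R : realType) (n : nat).
Local Notation V := ('rV[R]_n).
Variables (s M C : R) (P : nat -> V -> R) (f : V -> R).
Hypothesis e : expands s M C P f.

Let s0 : 0 < s. Proof. by case: e. Qed.
Let M0 : 0 <= M. Proof. exact: expands_ge0 e. Qed.
Let C0 : 0 <= C. Proof. exact: expands_ge0C e. Qed.
Let hP k : homog k (M * s ^+ k) (P k). Proof. by case: e. Qed.

Definition dterm (v : V) (k : nat) (x : V) : R := 'd (P k.+1 : V -> R^o) x v.
Definition dsum (v x : V) : R := limn (series (fun k => dterm v k x)).

(** The factor k+1 <= 2^k is absorbed by raising the growth rate. Taking 16 s also shrinks the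
    domain to |x| 8 s <= 1/4, which leaves room for increments in [dsum_taylor]. *)
Lemma dterm_homog v k : homog k (M * s * `|v| * (16 * s) ^+ k) (dterm v k).
Proof.
apply: homog_le (homog_diff v (hP k.+1)).
rewrite exprS.
have h : k.+1%:R * s ^+ k <= (16 * s) ^+ k.
  rewrite exprMn ler_wpM2r ?exprn_ge0 ?(ltW s0) //.
  apply: le_trans (natr_lt_exp2 R k) _.
  by rewrite lerXn2r ?nnegrE // ler_nat.
have -> : k.+1%:R * (M * (s * s ^+ k)) * `|v| = M * s * `|v| * (k.+1%:R * s ^+ k) by ring.
by rewrite ler_wpM2l // !mulr_ge0 // ltW.
Qed.

Lemma dterm_expands v : expands (16 * s) (M * s * `|v|) (2 * (M * s * `|v|))
  (dterm v) (dsum v).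
Proof.
split=> [|k|x N hx]; [by rewrite mulr_gt0 | exact: dterm_homog |].
apply: geometric_sum => [|k]; first by rewrite !mulr_ge0 // ltW.
apply: le_trans (homog_bound (dterm_homog v k) (lexx _)) _.
rewrite -mulrA -exprMn ler_wpM2l //; first by rewrite !mulr_ge0 // ltW.
rewrite mulrC lerXn2r ?nnegrE ?mulr_ge0 ?(ltW s0) //.
Qed.

Lemma dsum_linear (x : V) : `|x| * (16 * s) <= 2^-1 -> linear (dsum^~ x : V -> R^o).
Proof.
move=> hx a u v; apply/eqP; rewrite -subr_eq0 -normr_le0.
pose D (w : V) := 2 * (M * s * `|w|).
have hD w N : `|dsum w x - \sum_(0 <= k < N) dterm w k x| <= D w * 2^-1 ^+ N.
  by have [_ _] := dterm_expands w; apply.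
apply: (@le_geometric _ _ _ (D (a *: u + v) + `|a| * D u + D v)) => N.
have E : \sum_(0 <= k < N) dterm (a *: u + v) k x =
  a * (\sum_(0 <= k < N) dterm u k x) + \sum_(0 <= k < N) dterm v k x.
  rewrite mulr_sumr -big_split; apply: eq_bigr => k _.
  exact: (linearP ('d (P k.+1 : V -> R^o) x)).
have := hD (a *: u + v) N; rewrite E; have := hD u N; have := hD v N.
set A := \sum_(_ <= _ < _) _; set B := \sum_(_ <= _ < _) _.
rewrite add0r !mulrDl => h1 h2 h3.
have -> : dsum (a *: u + v) x - (a *: dsum u x + dsum v x) =
  (dsum (a *: u + v) x - (a * B + A)) - a * (dsum u x - B) - (dsum v x - A).
  by rewrite /GRing.scale /=; ring.
apply: le_trans (ler_normB _ _) _; apply: lerD => //.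
apply: le_trans (ler_normB _ _) _; apply: lerD => //.
by rewrite normrM -mulrA ler_wpM2l.
Qed.

(** [homog_taylor] at radius 1 / (8 s): the ratio 1/8 is 1/4 times 1/2, where 4^(-k) absorbs k^2 and
    2^(-k) gives a bound independent of N. *)
Lemma partial_taylor (x h : V) N : `|x| * (8 * s) <= 1 -> `|x + h| * (8 * s) <= 1 ->
  `|\sum_(0 <= k < N.+1) P k (x + h) - \sum_(0 <= k < N.+1) P k x
     - \sum_(0 <= k < N) dterm h k x| <= 2 * M * (8 * s * `|h|) ^+ 2.
Proof.
move=> hx hxh; pose r := (8 * s)^-1.
have s80 : 0 < 8 * s by rewrite mulr_gt0.
have r0 : 0 < r by rewrite invr_gt0.
have toR (y : V) : `|y| * (8 * s) <= 1 -> `|y| <= r.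
  by rewrite -ler_pdivlMr // div1r.
have D0 : 'd (P 0%N : V -> R^o) x h = 0.
  by case: (hP 0%N) => a _ /funext ->; rewrite rv_diff_cst.
have -> : \sum_(0 <= k < N) dterm h k x = \sum_(0 <= k < N.+1) 'd (P k : V -> R^o) x h.
  by rewrite [RHS]big_nat_recl // -[LHS]add0r; congr (_ + _); exact: esym D0.
rewrite -!sumrB; apply: le_trans (ler_norm_sum _ _ _) _.
apply: (@le_trans _ _ (\sum_(0 <= k < N.+1) M * (8 * s * `|h|) ^+ 2 * 2^-1 ^+ k)).
  apply: ler_sum => k _; apply: le_trans (homog_taylor r0 (hP k) (toR _ hx) (toR _ hxh)) _.
  have -> : `|h| / r = 8 * s * `|h| by rewrite /r invrK mulrC.
  have -> : k%:R ^+ 2 * (M * s ^+ k * r ^+ k) = M * (k%:R ^+ 2 * (s * r) ^+ k).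
    by rewrite exprMn; ring.
  have -> : s * r = 4^-1 * 2^-1 by rewrite /r; field; exact: lt0r_neq0.
  rewrite [leRHS]mulrAC; apply: ler_wpM2r; first by rewrite exprn_ge0 // mulr_ge0 // ltW.
  apply: ler_wpM2l => //.
  rewrite exprMn mulrA ler_piMl ?exprn_ge0 ?invr_ge0 // exprVn ler_pdivrMr ?exprn_gt0 //.
  by rewrite mul1r natr_sqr_le_exp4.
have -> : 2 * M * (8 * s * `|h|) ^+ 2 = M * (8 * s * `|h|) ^+ 2 * 2 by ring.
rewrite -mulr_sumr; apply: ler_wpM2l.
  by rewrite mulr_ge0 // exprn_ge0 // mulr_ge0 // ltW.
have := @geometric_tail R (fun k => 2^-1 ^+ k) 1 0 N.+1.
rewrite !add0n => h1;
have {h1} h1 : `|\sum_(0 <= k < N.+1) 2^-1 ^+ k| <= 2 * 1 * 2^-1 ^+ 0 - 2 * 1 * 2^-1 ^+ N.+1 :> R.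
  by apply: h1 => k; rewrite mul1r ger0_norm // exprn_ge0 // invr_ge0.
rewrite expr0 !mulr1 in h1; apply: le_trans (ler_norm _) _; apply: le_trans h1 _.
by rewrite gerBl mulr_ge0 // exprn_ge0 // invr_ge0.
Qed.

Lemma dsum_taylor (x h : V) : `|x| * (8 * s) <= 1 -> `|x + h| * (8 * s) <= 1 ->
  `|x| * (16 * s) <= 2^-1 ->
  `|f (x + h) - f x - dsum h x| <= 2 * M * (8 * s * `|h|) ^+ 2.
Proof.
move=> hx hxh hx'; set D := 2 * (M * s * `|h|).
have [_ _ hf] := e; have [_ _ /(_ x _ hx') hD] := dterm_expands h.
have to2 (y : V) : `|y| * (8 * s) <= 1 -> `|y| * s <= 2^-1.
  move=> hy; rewrite -(ler_pM2l (_ : 0 < 8)) // mulrCA; apply: le_trans hy _; lra.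
apply: (@le_geometric _ _ _ (C + C + D)) => N.
have hp := partial_taylor N hx hxh.
have h1 := hf _ N.+1 (to2 _ hx); have h2 := hf _ N.+1 (to2 _ hxh); have h3 := hD N.
have q : C * 2^-1 ^+ N.+1 <= C * 2^-1 ^+ N.
  rewrite ler_wpM2l // exprS ler_piMl ?exprn_ge0 ?invr_ge0 // invf_le1 // ler1n //.
move: hp h1 h2 h3 q; set A := \sum_(_ <= _ < _) P _ (x + h).
set B := \sum_(_ <= _ < _) P _ x; set E := \sum_(_ <= _ < _) _.
move=> hp h1 h2 h3 q.
have -> : f (x + h) - f x - dsum h x =
  (A - B - E) + (f (x + h) - A) - (f x - B) - (dsum h x - E) by ring.
rewrite [(C + C + D) * _]mulrDl [(C + C) * _]mulrDl [leRHS]addrA [X in _ <= X + _]addrA.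
apply: le_trans (ler_normB _ _) _; apply: lerD => //.
apply: le_trans (ler_normB _ _) _; apply: lerD; last exact: le_trans q.
apply: le_trans (ler_normD _ _) _; apply: lerD => //; exact: le_trans q.
Qed.

Lemma expands_diff (x : V) : `|x| * (16 * s) <= 2^-1 ->
  differentiable (f : V -> R^o) x /\ forall v, 'd (f : V -> R^o) x v = dsum v x.
Proof.
move=> hx; have hL := dsum_linear hx.
pose L : {linear V -> R^o} := HB.pack (dsum^~ x : V -> R^o) (GRing.isLinear.Build R V R^o _ _ hL).
apply: (@eps_differentiable R V R^o f L x); first exact: linear_rV_continuous hL.
move=> eps e0; pose B := 2 * M * (8 * s) ^+ 2.
have B0 : 0 <= B by apply: mulr_ge0; [exact: mulr_ge0 | exact: sqr_ge0].
(* The first bound gives |x + h| 8 s <= 1/4 + 1/4; the second turns B |h|^2 into at most eps |h|. *)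
exists (Num.min (32 * s)^-1 (eps / (B + 1))).
  by rewrite lt_min invr_gt0 mulr_gt0 //= divr_gt0 // ltr_wpDl.
move=> h; rewrite le_min => /andP[h1 h2].
have h3 : `|h| * (32 * s) <= 1 by rewrite -ler_pdivlMr ?div1r // mulr_gt0.
have n0 := normr_ge0 x; have n1 := normr_ge0 h.
have n2 : `|x + h| <= `|x| + `|h| by exact: ler_normD.
apply: le_trans (dsum_taylor _ _ hx) _.
- by apply: le_trans (_ : _ <= `|x| * (16 * s)) _; [rewrite ler_wpM2l // ler_pM2r // ler_nat | lra].
- apply: (@le_trans _ _ ((`|x| + `|h|) * (8 * s))).
    by rewrite ler_wpM2r // mulr_ge0 // ltW.
  by rewrite mulrDl; lra.
have -> : 2 * M * (8 * s * `|h|) ^+ 2 = B * `|h| * `|h| by rewrite /B; ring.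
rewrite ler_wpM2r //; move: h2; rewrite ler_pdivlMr ?ltr_wpDl // => h2.
apply: le_trans h2; rewrite mulrC ler_wpM2l // lerDl //.
Qed.

End PowerSeriesDerivative.

(** * Unconditional sums *)

Lemma partial_sumE (I : choiceType) (U : zmodType) (u : I -> U) (A : {fset I}) :
  partial_sum u A = \sum_(i <- A) u i.
Proof. by rewrite /partial_sum (big_seq_fsetE _ A xpredT). Qed.

#[local] Existing Instance totally_filter.

Lemma totally_cvgP (R : realType) (I : choiceType) (u : I -> R) (l : R) :
  partial_sum (u : I -> R^o) @ totally --> (l : R^o) <->
  forall e : R, 0 < e -> exists J0 : {fset I}, forall J, (J0 `<=` J)%fset ->
    `|l - \sum_(i <- J) u i| <= e.
Proof.
split=> [/cvgrPdist_le h e /h[J0 _ hJ0]|h].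
  by exists J0 => J /hJ0; rewrite partial_sumE.
apply/cvgrPdist_le => e /h[J0 hJ0]; exists J0 => // J /hJ0.
by rewrite partial_sumE.
Qed.

(** Past a suitable J0 all partial sums are within 1 of l, so a sum over any finite set disjoint
    from J0 is at most 2 in absolute value. Applying this to the nonnegative and to the negative
    terms of J outside J0 gives 2 + 2 = 4. *)
Lemma totally_cvg_bounded (R : realType) (I : choiceType) (u : I -> R) (l : R) :
  partial_sum (u : I -> R^o) @ totally --> (l : R^o) ->
  exists B : R, forall J : {fset I}, \sum_(i <- J) `|u i| <= B.
Proof.
move=> /totally_cvgP/(_ 1 ltr01)[J0 hJ0].
exists (\sum_(i <- J0) `|u i| + 4) => J; pose K := (J0 `|` J)%fset.
have hp (p : pred I) : `|l - \sum_(i <- J0) u i - \sum_(i <- K | (i \notin J0) && p i) u i| <= 1.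
  have -> : l - \sum_(i <- J0) u i - \sum_(i <- K | (i \notin J0) && p i) u i =
    l - \sum_(i <- [fset i in K | (i \in J0) || p i]%fset) u i.
    rewrite -big_fset_condE (bigID (mem J0)) /= opprD addrA; congr (_ - _ - _).
      rewrite [RHS]big_fset_condE; congr (\sum_(i <- enum_fset _) _).
      by apply/fsetP => i; rewrite /K !inE /=; case: (i \in J0); rewrite ?andbF ?andbT ?orbT.
    by apply: eq_bigl => i; rewrite andbC; case: (i \in J0); rewrite ?andbF ?andbT ?orbT.
  by apply: hJ0; apply/fsubsetP => i hi; rewrite /K !inE hi.
have hp2 (p : pred I) : `|\sum_(i <- K | (i \notin J0) && p i) u i| <= 2.
  have := hp p; have := hp pred0; rewrite [X in _ - X]big_pred0; last by move=> i; rewrite andbF.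
  rewrite subr0; set x := l - _; set y := \sum_(_ <- _ | _) _ => h1 h2.
  have -> : y = x - (x - y) by ring.
  by apply: le_trans (ler_normB _ _) _; exact: lerD.
have -> : 4 = 2 + 2 :> R by lra.
apply: (@le_trans _ _ (\sum_(i <- K) `|u i|)).
  rewrite [leRHS](bigID (mem J)) /= (_ : \sum_(i <- J) _ = \sum_(i <- K | i \in J) `|u i|).
    by rewrite lerDl sumr_ge0.
  rewrite [RHS]big_fset_condE; congr (\sum_(i <- enum_fset _) _).
  by apply/fsetP => i; rewrite /K !inE /=; case: (i \in J); rewrite ?orbT ?andbF.
rewrite (bigID (mem J0)) /= lerD //.
  rewrite big_fset_condE (_ : [fset i in K | i \in J0]%fset = J0) //.
  by apply/fsetP => i; rewrite /K !inE /=; case: (i \in J0); rewrite ?andbF ?andbT ?orbT.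
rewrite (bigID (fun i => 0 <= u i)) /= lerD //.
  apply: le_trans (hp2 (fun i => 0 <= u i)); rewrite ler_normr; apply/orP; left.
  by apply: ler_sum => i /andP[_ hi]; rewrite ger0_norm.
apply: le_trans (hp2 (fun i => ~~ (0 <= u i))); rewrite ler_normr; apply/orP; right.
rewrite -sumrN; apply: ler_sum => i /andP[_ hi]; rewrite ltr0_norm // ltNge //.
Qed.

(** * Multi-indices and monomials *)

Section Monomials.
Variables (R : realType) (n : nat).
Local Notation V := ('rV[R]_n).
Local Notation mon := {ffun 'I_n -> nat}.
Implicit Types (al be : mon) (x : V) (J : {fset mon}).

Definition mdegree al : nat := \sum_i al i.
Definition monomial al x : R := \prod_i x 0 i ^+ al i.

Lemma monomial_homog al : homog (mdegree al) 1 (monomial al).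
Proof.
rewrite /mdegree /monomial; elim: (index_enum _) => [|i r IH].
  by rewrite big_nil; exists 1; rewrite ?normr1 // => x; rewrite big_nil.
rewrite big_cons; apply: (@homog_ext _ _ _ _ (fun x => x 0 i ^+ al i * \prod_(j <- r) x 0 j ^+ al j)).
  by move=> x; rewrite big_cons.
elim: (al i) => [|k IHk]; first by apply: homog_ext IH => x; rewrite mul1r.
by rewrite addSn; apply: homog_ext (homogX i IHk) => x; rewrite exprS mulrA.
Qed.

Lemma monomial_bound al x r : `|x| <= r -> `|monomial al x| <= r ^+ mdegree al.
Proof. by move=> hx; have := homog_bound (monomial_homog al) hx; rewrite mul1r. Qed.

Lemma monomial_const al t : monomial al (const_mx t) = t ^+ mdegree al.
Proof.
rewrite /monomial /mdegree -prodrXr.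
by apply: eq_bigr => i _; rewrite mxE.
Qed.

Lemma degree_fset : exists U : nat -> {fset mon},
  forall N al, (al \in U N) = (mdegree al < N)%N.
Proof.
exists (fun N => [fset al in
    [seq ([ffun i => nat_of_ord (b i)] : mon) | b : {ffun 'I_n -> 'I_N}]
  | (mdegree al < N)%N]%fset) => N al.
rewrite !inE /=; apply: andb_idl => hal; apply/mapP.
have hi i : (al i < N)%N.
  by apply: leq_ltn_trans hal; rewrite /mdegree (bigD1 i) //= leq_addr.
exists [ffun i => Ordinal (hi i)]; first by rewrite mem_enum.
by apply/ffunP => i; rewrite !ffunE.
Qed.

End Monomials.

(** * From multi-index series to homogeneous expansions *)

Section AnalyticExpansion.
Variables (R : realType) (n : nat).
Local Notation V := ('rV[R]_n).
Local Notation mon := {ffun 'I_n -> nat}.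
Implicit Types (al be : mon) (x a : V) (J : {fset mon}) (f : V -> R).

Lemma sum_degree_fset (U : nat -> {fset mon}) (F : mon -> R) N :
  (forall N al, (al \in U N) = (mdegree al < N)%N) ->
  \sum_(al <- U N) F al = \sum_(0 <= k < N) \sum_(al <- U k.+1 | mdegree al == k) F al.
Proof.
move=> hU; elim: N => [|N IH].
  rewrite big_geq //; have -> : U 0%N = fset0 by apply/fsetP => al; rewrite hU inE.
  by rewrite big_nil.
rewrite big_nat_recr //= -IH (bigID (fun al => mdegree al == N)) /= addrC; congr (_ + _).
rewrite big_fset_condE; congr (\sum_(al <- enum_fset _) _).
by apply/fsetP => al; rewrite !inE /= !hU ltnS ltn_neqAle andbC.
Qed.

(** Convergence at the single point (t, ..., t) is enough for the bounds: the absolute sums of c_al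
    t^|al| are bounded by B, so the coefficients of degree k have l^1 norm at most B t^(-k). *)
Lemma analytic_expandable f a : analytic_fun f -> expandable (fun x => f (a + x)).
Proof.
move=> /(_ a)[c hc]; have {hc} : \forall x \near (0 : V),
    partial_sum (fun al => c al * monomial al x : R^o) @ totally --> (f (a + x) : R^o).
  move/nbhs0P : hc; apply: filterS => x /=.
  rewrite (_ : (fun al => _) = (fun al => c al * monomial al x)) //.
  apply/funext => al; congr (_ * _); apply: eq_bigr => i _.
  by rewrite !mxE addrAC subrr add0r.
move=> /near0_le[t t0 hc].
pose x0 : V := const_mx t.
have hx0 : `|x0| <= t.
  have -> : `|x0| = \big[Num.max/0]_ij `|x0 ij.1 ij.2| by exact: mx_normrE.
  by apply: bigmax_le => [|ij _]; [exact: ltW | rewrite mxE gtr0_norm].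
have [B hB] := totally_cvg_bounded (hc x0 hx0).
have B0 : 0 <= B by have := hB fset0; rewrite big_nil.
have [U hU] := degree_fset n.
pose P k x := \sum_(al <- U k.+1 | mdegree al == k) c al * monomial al x.
have hP k : homog k (B * t^-1 ^+ k) (P k).
  apply: (@homog_le _ _ _ (\sum_(al <- U k.+1 | mdegree al == k) `|c al| * 1)).
    rewrite exprVn ler_pdivlMr ?exprn_gt0 // mulr_suml.
    apply: le_trans (hB (U k.+1)); rewrite [leRHS](bigID (fun al => mdegree al == k)) /=.
    apply: (@le_trans _ _ (\sum_(al <- U k.+1 | mdegree al == k) `|c al * monomial al x0|)).
      apply: ler_sum => al /eqP hal.
      by rewrite monomial_const hal normrM mulr1 normrX (gtr0_norm t0).
    by rewrite lerDl sumr_ge0.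
  apply: homog_sum => al /eqP <-; apply: homogZ; exact: monomial_homog.
have hb x k : `|x| * t^-1 <= 2^-1 -> `|P k x| <= B * 2^-1 ^+ k.
  move=> hx; apply: le_trans (homog_bound (hP k) (lexx _)) _.
  rewrite -mulrA -exprMn; apply: ler_wpM2l => //; rewrite [t^-1 * _]mulrC.
  by rewrite lerXn2r // nnegrE ?invr_ge0 // mulr_ge0 // invr_ge0 ltW.
exists t^-1, B, (2 * B), P; split; [by rewrite invr_gt0 | exact: hP |].
move=> x N hx; have := geometric_sum B0 (fun k => hb x k hx) N.
suff -> : limn (series (fun k => P k x)) = f (a + x) by [].
apply/cvg_lim => //; apply/cvgrPdist_le => e e0.
have xt : `|x| <= t.
  move: hx; rewrite ler_pdivrMr // => /le_trans; apply.
  by rewrite ler_piMl ?ltW // invf_lt1 // ltr1n.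
have /totally_cvgP/(_ e e0)[J0 hJ0] := hc x xt.
(* Beyond this bound every index of J0 has degree below m, so [U m] contains J0. *)
exists (\sum_(al <- J0) mdegree al).+1 => // m /= hm.
rewrite /series /= -(sum_degree_fset (fun al => c al * monomial al x) m hU).
apply: hJ0; apply/fsubsetP => al hal; rewrite hU; apply: leq_trans hm.
by rewrite ltnS (big_fsetD1 al) //= leq_addr.
Qed.

End AnalyticExpansion.

(** * From homogeneous expansions to multi-index series *)

Section HomogeneousCoefficients.
Variables (R : realType) (n : nat).
Local Notation V := ('rV[R]_n).
Local Notation mon := {ffun 'I_n -> nat}.
Implicit Types (al be : mon) (i : 'I_n) (x a : V) (J : {fset mon}) (f : V -> R).

Definition raise_at i al : mon := [ffun j => al j + (j == i)]%N.
Definition lower_at i al : mon := [ffun j => al j - (j == i)]%N.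

Lemma raise_atK i : cancel (raise_at i) (lower_at i).
Proof. by move=> al; apply/ffunP => j; rewrite !ffunE addnK. Qed.

Lemma lower_atK i al : (0 < al i)%N -> raise_at i (lower_at i al) = al.
Proof.
move=> hi; apply/ffunP => j; rewrite !ffunE subnK //.
by case: eqP => // ->.
Qed.

Lemma mdegree_raise i al : mdegree (raise_at i al) = (mdegree al).+1.
Proof.
rewrite /mdegree (eq_bigr (fun j => al j + (j == i))%N) => [|j _]; last by rewrite ffunE.
by rewrite big_split /= -(big_mkcond (fun j => j == i) (fun=> 1%N)) /= big_pred1_eq addn1.
Qed.

Lemma monomial_raise i al x : monomial (raise_at i al) x = x 0 i * monomial al x.
Proof.
rewrite /monomial (bigD1 i) //= [in RHS](bigD1 i) //= mulrA -exprS ffunE eqxx addn1.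
congr (_ * _); apply: eq_bigr => j ji; by rewrite ffunE (negPf ji) addn0.
Qed.

Lemma sum_lower_at (F : mon -> R) i J :
  \sum_(al <- J | (0 < al i)%N) F (lower_at i al) =
  \sum_(be <- [fset lower_at i al | al in [fset al in J | (0 < al i)%N]]%fset) F be.
Proof.
rewrite big_imfset /=; first by rewrite big_fset_condE.
move=> al be; rewrite !inE /= => /andP[_ h1] /andP[_ h2] h.
by rewrite -(lower_atK h1) h lower_atK.
Qed.

(** Words with the same letters are collected into one monomial: the coefficient of al sums, over
    the first letter i, that of al with i removed in Q_i. Merging words cannot increase the l^1
    norm. *)
Lemma homog_coefficients k M (P : V -> R) : homog k M P ->
  exists c : mon -> R, [/\ forall al, mdegree al != k -> c al = 0,
    forall J, \sum_(al <- J) `|c al| <= M &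
    forall x J, (forall al, mdegree al = k -> al \in J) ->
      P x = \sum_(al <- J) c al * monomial al x].
Proof.
elim: k M P => [|k IH] M P.
  case=> a aM hP; pose z : mon := [ffun=> 0%N].
  have dz : mdegree z = 0%N by rewrite /mdegree big1 // => i _; rewrite ffunE.
  have M0 : 0 <= M by apply: le_trans aM.
  exists (fun al => if al == z then a else 0); split=> [al|J|x J hJ].
  - by have [->|//] := eqVneq al z; rewrite dz.
  - have [zJ|zJ] := boolP (z \in J).
      rewrite (big_fsetD1 z) //= eqxx big1_seq ?addr0 // => al /andP[_].
      by rewrite !inE => /andP[/negPf -> _]; rewrite normr0.
    rewrite big1_seq // => al /andP[_ hal]; case: eqP => [E|_]; last by rewrite normr0.
    by rewrite E (negPf zJ) in hal.
  - rewrite (big_fsetD1 z) ?hJ //= eqxx big1_seq => [|al /andP[_]].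
      by rewrite hP addr0 /monomial big1 ?mulr1 // => i _; rewrite ffunE.
    by rewrite !inE => /andP[/negPf -> _]; rewrite mul0r.
case=> d [Q [dM hQ hP]].
have /(@choice _ _ _)[c hc] i := IH _ _ (hQ i).
exists (fun al => \sum_i (if (0 < al i)%N then c i (lower_at i al) else 0)); split.
- move=> al hal; apply: big1 => i _; case: ifP => // hi.
  have [h0 _ _] := hc i; apply: h0; apply: contra hal => /eqP <-.
  by rewrite -(mdegree_raise i) lower_atK.
- move=> J; apply: le_trans dM.
  apply: (@le_trans _ _ (\sum_i \sum_(al <- J | (0 < al i)%N) `|c i (lower_at i al)|)).
    rewrite (exchange_big_dep xpredT) //=; apply: ler_sum => al _.
    apply: le_trans (ler_norm_sum _ _ _) _; rewrite [leRHS]big_mkcond.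
    by apply: ler_sum => i _; case: ifP => //; rewrite normr0.
  apply: ler_sum => i _; rewrite (sum_lower_at (fun be => `|c i be|)).
  by have [_ + _] := hc i; apply.
- move=> x J hJ; rewrite hP.
  transitivity (\sum_i \sum_(al <- J | (0 < al i)%N) c i (lower_at i al) * monomial al x).
    apply: eq_bigr => i _.
    transitivity (\sum_(al <- J | (0 < al i)%N) x 0 i *
        (c i (lower_at i al) * monomial (lower_at i al) x)); last first.
      by apply: eq_bigr => al hi; rewrite mulrCA -monomial_raise lower_atK.
    rewrite (sum_lower_at (fun be => x 0 i * (c i be * monomial be x))) -mulr_sumr.
    have [_ _ h] := hc i; congr (_ * _); apply: h => be hbe; apply/imfsetP => /=.
    exists (raise_at i be); last by rewrite raise_atK.
    by rewrite !inE /= hJ ?mdegree_raise ?hbe //= ffunE eqxx addn1.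
  rewrite (exchange_big_dep xpredT) //=; apply: eq_bigr => al _.
  rewrite mulr_suml big_mkcond; apply: eq_bigr => i _.
  by case: ifP => // _; rewrite mul0r.
Qed.

(** The coefficient of al is taken from the part of degree |al|. For J containing all degrees below
    N, the sum over J is the N-th partial sum of the expansion, with error C 2^(-N), plus terms of
    degree at least N, which total at most 2 M 2^(-N). *)
Lemma expandable_analytic f :
  (forall a, expandable (fun x => f (a + x))) -> analytic_fun f.
Proof.
move=> hf a; have [s [M [C [P e]]]] := hf a.
have M0 := expands_ge0 e; have C0 := expands_ge0C e; have [s0 hP he] := e.
have /(@choice _ _ _)[c hc] k := homog_coefficients (hP k).
have [U hU] := degree_fset n.
exists (fun al => c (mdegree al) al); apply: (proj2 (@nbhs0P R V _ a)).
apply/near0_le; exists (2^-1 / s); first by rewrite divr_gt0 // invr_gt0.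
move=> x; rewrite ler_pdivlMr // => hx /=.
rewrite (_ : (fun al => _) = (fun al => c (mdegree al) al * monomial al x)); last first.
  apply/funext => al; congr (_ * _); apply: eq_bigr => i _.
  by rewrite !mxE addrAC subrr add0r.
apply/totally_cvgP => eps e0.
have [N hN] : exists N, (C + 2 * M) * 2^-1 ^+ N <= eps.
  have h : (fun N => (C + 2 * M) * 2^-1 ^+ N) @ \oo --> (0 : R).
    by rewrite -(mulr0 (C + 2 * M)); apply: cvgMr; exact: half_expr_cvg.
  have /cvgrPdist_le/(_ _ e0)[N _ /(_ N (leqnn N))] := h.
  by rewrite sub0r normrN => hN; exists N; apply: le_trans hN; exact: ler_norm.
exists (U N) => J hJ; apply: le_trans hN; rewrite mulrDl.
have -> : f (a + x) - \sum_(al <- J) c (mdegree al) al * monomial al x =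
  (f (a + x) - \sum_(0 <= k < N) P k x) -
  \sum_(al <- J | (N <= mdegree al)%N) c (mdegree al) al * monomial al x.
  rewrite -addrA -opprD [in LHS](bigID (fun al => mdegree al < N)%N) /=; congr (_ - (_ + _)).
    rewrite big_fset_condE (_ : [fset al in J | (mdegree al < N)%N]%fset = U N); last first.
      apply/fsetP => al; rewrite !inE /= -hU; apply: andb_idl => /(fsubsetP hJ).
      by [].
    rewrite (sum_degree_fset _ _ hU); apply: eq_bigr => k _.
    have [h0 _ hs] := hc k; rewrite (hs x (U k.+1)) => [|al hal]; last by rewrite hU hal.
    rewrite [RHS](bigID (fun al => mdegree al == k)) /= [X in _ + X]big1 ?addr0 => [|al /h0 ->].
      by apply: eq_bigr => al /eqP ->.
    by rewrite mul0r.
  by apply: eq_bigl => al; rewrite -leqNgt.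
apply: le_trans (ler_normB _ _) _; apply: lerD; first exact: he.
apply: le_trans (ler_norm_sum _ _ _) _.
(* All degrees occurring in J are below N + m, so the remaining terms can be grouped by degree over
   a finite range. *)
pose m := (\sum_(al <- J) mdegree al).+1.
have hm al : al \in J -> (mdegree al < N + m)%N.
  move=> hal; rewrite /m addnS ltnS; apply: leq_trans (leq_addl _ _).
  by rewrite (big_fsetD1 al) //= leq_addr.
apply: (@le_trans _ _ (\sum_(N <= k < N + m) M * 2^-1 ^+ k)); last first.
  have hM k : `|M * 2^-1 ^+ k| <= M * 2^-1 ^+ k.
    by rewrite ger0_norm // mulr_ge0 // exprn_ge0 // invr_ge0.
  apply: le_trans (ler_norm _) _; apply: le_trans (geometric_tail N m hM) _.
  by rewrite gerBl !mulr_ge0 // exprn_ge0 // invr_ge0.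
apply: (@le_trans _ _ (\sum_(N <= k < N + m) \sum_(al <- J | mdegree al == k) `|c k al| * `|x| ^+ k)).
  apply: (@le_trans _ _ (\sum_(al <- J | (N <= mdegree al)%N)
      \sum_(N <= k < N + m | k == mdegree al) `|c k al| * `|x| ^+ k)).
    rewrite big_seq_cond [leRHS]big_seq_cond; apply: ler_sum => al /andP[hal hN].
    by rewrite big_nat1_eq hN (hm al hal) /= normrM ler_wpM2l // monomial_bound.
  rewrite (exchange_big_dep xpredT) //= [leLHS]big_nat [leRHS]big_nat.
  apply: ler_sum => k /andP[Nk _]; rewrite le_eqVlt; apply/orP; left; apply/eqP.
  by apply: eq_bigl => al; rewrite eq_sym; case: eqP => [->|]; rewrite ?andbF ?Nk.
apply: ler_sum => k _; have [_ hk _] := hc k.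
rewrite -mulr_suml; apply: (@le_trans _ _ (M * s ^+ k * `|x| ^+ k)).
  apply: ler_wpM2r; first exact: exprn_ge0.
  apply: le_trans (hk J); rewrite [leRHS](bigID (fun al => mdegree al == k)) /=.
  by rewrite lerDl sumr_ge0.
rewrite -mulrA -exprMn; apply: ler_wpM2l => //; rewrite [s * _]mulrC.
by rewrite lerXn2r // nnegrE ?invr_ge0 // mulr_ge0 // ltW.
Qed.

End HomogeneousCoefficients.

(** * Real analytic functions satisfy the calculus *)

Section AnalyticCalculus.
Variable R : realType.

Lemma differentiable_translate n (f : 'rV[R]_n -> R) a x :
  differentiable ((fun y => f (a + y)) : 'rV[R]_n -> R^o) x ->
  differentiable (f : 'rV[R]_n -> R^o) (a + x) /\
  forall v, 'd (f : 'rV[R]_n -> R^o) (a + x) v =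
            'd ((fun y => f (a + y)) : 'rV[R]_n -> R^o) x v.
Proof.
move=> dg; apply: (@eps_differentiable R 'rV[R]_n R^o f ('d _ x)).
  exact: diff_continuous dg.
move=> e e0; have [d d0 hd] := differentiable_eps dg e0.
by exists d => // h /hd; rewrite addrA.
Qed.

Lemma analyticP n (f : 'rV[R]_n -> R) :
  analytic_fun f <-> forall a, expandable (fun x => f (a + x)).
Proof.
by split=> [h a|]; [exact: analytic_expandable | exact: expandable_analytic].
Qed.

(** Every point serves as a centre, so [expands_diff] is needed only at 0. *)
Lemma analytic_differentiable n (f : 'rV[R]_n -> R) : analytic_fun f ->
  forall x, differentiable (f : 'rV[R]_n -> R^o) x.
Proof.
move=> /analyticP hf x; have [s [M [C [P e]]]] := hf x.
have h0 : `|0 : 'rV[R]_n| * (16 * s) <= 2^-1 by rewrite normr0 mul0r invr_ge0.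
have [d _] := expands_diff e h0.
by have [] := differentiable_translate d; rewrite addr0.
Qed.

(** [expands_diff] identifies the differential with [dsum] on the whole ball where [dterm_expands]
    controls the error, hence an expansion of the derivative at the same centre. *)
Lemma analytic_diff n (f : 'rV[R]_n -> R) v : analytic_fun f ->
  analytic_fun (fun x => 'd (f : 'rV[R]_n -> R^o) x v).
Proof.
move=> af; have df := analytic_differentiable af.
apply/analyticP => a; have [s [M [C [P e]]]] := (analyticP f).1 af a.
have [s0 hP hd] := dterm_expands e v.
exists (16 * s), (M * s * `|v|), (2 * (M * s * `|v|)), (dterm P v); split=> // x N hx.
have [d dE] := expands_diff e hx.
have [_ hE] := differentiable_translate d.
by rewrite hE dE; exact: hd.
Qed.

Lemma analytic_calculus : smooth_calculus (@analytic_fun R).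
Proof.
split.
- by move=> n a; apply/analyticP => b; exact: expandable_cst.
- move=> n f g /analyticP hf /analyticP hg; apply/analyticP => a.
  exact: expandableD (hf a) (hg a).
- by move=> n c f /analyticP hf; apply/analyticP => a; exact: expandableZ (hf a).
- move=> n i f /analyticP hf; apply/analyticP => a.
  (* Expansions are centred at a, where the coordinate reads a_i + x_i. *)
  rewrite (_ : (fun x => _) = (fun x : 'rV[R]_n => x 0 i * f (a + x) + a 0 i * f (a + x))).
    by apply: expandableD; [exact: expandableX | exact: expandableZ].
  by apply/funext => x; rewrite !mxE addrC mulrDl.
- move=> n p A f /analyticP hf; apply/analyticP => a.
  under eq_fun do rewrite mulmxDl.
  exact: (expandable_pull A (hf (a *m A))).
- by move=> n f; exact: analytic_differentiable.
- by move=> n f af v; exact: analytic_diff.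
- move=> n f af u v x; apply: young.
  + exact: analytic_differentiable.
  + exact/analytic_differentiable/analytic_diff.
  + exact/analytic_differentiable/analytic_diff.
Qed.

End AnalyticCalculus.

Lemma smooth_coord_calculus (R : realType) (c : smooth_class) :
  smooth_calculus (@smooth_coord R c).
Proof.
case: c.
- exact: real_polynomial_calculus.
- exact: complex_polynomial_calculus.
- exact: analytic_calculus.
- exact: Cinfty_calculus.
- exact: entire_calculus.
Qed.

Theorem mainTheorem1 (R : realType) (c : smooth_class)
    (g : lieAlgType (base_field R c)) (V : vectType (base_field R c))
    (rho : lieRep g V) (m : nat) :
  dixmier rho -> dixmier (takiff_rep rho m).
Proof. exact: takiff_dixmier (smooth_coord_calculus R c). Qed.
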